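(* Let $M$ be a smooth manifold and let $T\in\Omega^2(M,TM)$. There is a one-to-one correspondence $$\frac{\Omega^3(M)}{\operatorname{im}\big(d^{T}|_{\Omega^2(M)}\big)}\;\cong\;\left\{\text{exact curved Courant algebroids over } M \text{ with curvature } T\right\}\big/\sim,$$ where $\sim$ denotes isomorphism.
   Context: Everything is smooth. A tuple $(\mathbb{E},\langle\,,\rangle,\rho,[\,,])$ over $M$ consists of a vector bundle $\mathbb{E}\to M$, a non-degenerate symmetric pairing $\langle\,,\rangle\in\Gamma(\mathrm{Sym}^2\mathbb{E}^* )$, a vector bundle morphism $\rho:\mathbb{E}\to TM$ over $\mathrm{id}_M$ (the anchor), and an $\mathbb{R}$-bilinear bracket $[\,,]:\Gamma(\mathbb{E})\times\Gamma(\mathbb{E})\to\Gamma(\mathbb{E})$. Define $\rho^*:T^*M\to\mathbb{E}$ by $\langle\rho^*\alpha,b\rangle=\alpha(\rho(b))$. A metric algebroid is a tuple such that for all $a,b,c\in\Gamma(\mathbb{E})$: $[a,b]+[b,a]=\rho^*d\langle a,b\rangle$ and $\rho(a)\langle b,c\rangle=\langle[a,b],c\rangle+\langle b,[a,c]\rangle$. For a metric algebroid put $F(a,b):=\rho([a,b])-[\rho(a),\rho(b)]_{\mathrm{Lie}}$. It is a curved Courant algebroid if $F$ is $C^\infty(M)$-bilinear and skew-symmetric, i.e. $F\in\Gamma(\wedge^2\mathbb{E}^*\otimes TM)$, and $F(a,b)=0$ whenever $a\in\ker\rho$ (pointwise). When $\rho$ is surjective (transitive case) there is a unique $T\in\Omega^2(M,TM)$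 with $F(a,b)=T(\rho(a),\rho(b))$, and $T$ is called the curvature. A metric algebroid is exact if $0\to T^*M\xrightarrow{\rho^*}\mathbb{E}\xrightarrow{\rho}TM\to0$ is exact (so exact implies transitive). An isomorphism of metric algebroids over $M$ is a vector bundle isomorphism $\phi:\mathbb{E}\to\mathbb{E}'$ over the identity with $\langle\phi a,\phi b\rangle'=\langle a,b\rangle$, $\rho'\circ\phi=\rho$, $[\phi a,\phi b]'=\phi[a,b]$. For $T\in\Omega^2(M,TM)$, $\iota_T$ is the unique degree-$1$ graded derivation of $\Omega^\bullet(M)$ with $\iota_Tf=0$ on functions and $(\iota_T\alpha)(X,Y)=\alpha(T(X,Y))$ on $1$-forms, and $d^{T}:=d-\iota_T$ is the curved exterior derivative. *)

(* Defs.v *)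
From HB Require Import structures.
From mathcomp Require Import all_boot all_order all_algebra perm.
From mathcomp Require Import all_classical all_reals.
From mathcomp Require Import topology normedtype derive.
From mathcomp Require Import ring.

Set Implicit Arguments.
Unset Strict Implicit.
Unset Printing Implicit Defensive.

Import Order.TTheory GRing.Theory Num.Theory.
Import numFieldNormedType.Exports.

Local Open Scope classical_set_scope.
Local Open Scope ring_scope.

Section SmoothEuclidean.
Variables (R : realType) (n : nat).
Implicit Types (U : set 'rV[R]_n) (f g : 'rV[R]_n -> R).

Fixpoint Ck (k : nat) U f : Prop :=
  (forall x, U x -> {for x, continuous f}) /\
  if k is k'.+1 then
    forall i : 'I_n, (forall x, U x -> derivable f x (delta_mx 0 i)) /\
                     Ck k' U ('D_(delta_mx 0 i) f)
  else True.

Definition Cinfty U f : Prop := forall k, Ck k U f.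

Lemma Ck_continuous k U f x : Ck k U f -> U x -> {for x, continuous f}.
Proof. by case: k => [|k] [cf _]; apply: cf. Qed.

Lemma CkW k U f : Ck k.+1 U f -> Ck k U f.
Proof.
elim: k f => [|k IH] f [cf df]; split => // i.
by have [di dki] := df i; split=> //; apply: IH.
Qed.

Lemma open_near_eq U f g x :
  open U -> (forall x, U x -> f x = g x) -> U x -> {near x, f =1 g}.
Proof.
move=> oU fg Ux; have : nbhs x U by apply: open_nbhs_nbhs.
by apply: filterS => y; apply: fg.
Qed.

Lemma continuous_ext U f g x : open U -> (forall x, U x -> f x = g x) ->
  U x -> {for x, continuous f} -> {for x, continuous g}.
Proof.
move=> oU fg Ux cf.
have gf := open_near_eq oU fg Ux.
have cf' : f @ x --> g x by rewrite -fg.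
have K : g @ x `=>` f @ x := near_eq_cvg (FF := nbhs_filter x) gf.
by rewrite /prop_for /continuous_at; apply: cvg_trans K cf'.
Qed.

Lemma Ck_ext k U f g : open U -> (forall x, U x -> f x = g x) ->
  Ck k U f -> Ck k U g.
Proof.
move=> oU; elim: k f g => [|k IH] f g fg [cf df]; split=> //.
- by move=> x Ux; exact: (continuous_ext oU fg Ux (cf x Ux)).
- by move=> x Ux; exact: (continuous_ext oU fg Ux (cf x Ux)).
move=> i; have [di dki] := df i; split=> [x Ux|].
  exact: (near_eq_derivable (open_near_eq oU fg Ux) (di x Ux)).
apply: IH dki => x Ux; exact: (near_eq_derive _ (open_near_eq oU fg Ux)).
Qed.

Lemma CkS k U V f : V `<=` U -> Ck k U f -> Ck k V f.
Proof.
move=> VU; elim: k f => [|k IH] f [cf df].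
  by split=> // x /VU; exact: cf.
split=> [x /VU|i]; first exact: cf.
by have [di dki] := df i; split=> [x /VU|]; [exact: di|exact: IH].
Qed.

Lemma Ck_cst k U (c : R) : open U -> Ck k U (cst c).
Proof.
move=> oU; elim: k c => [|k IH] c; split=> //; try by move=> x _; exact: cst_continuous.
move=> i; split=> [x _|]; first exact: derivable_cst.
by apply: (Ck_ext oU _ (IH 0)) => x _; rewrite derive_cst.
Qed.

Lemma CkD k U f g : open U -> Ck k U f -> Ck k U g -> Ck k U (f + g).
Proof.
move=> oU; elim: k f g => [|k IH] f g [cf df] [cg dg]; split=> //.
- by move=> x Ux; apply: continuousD; [apply: cf|apply: cg].
- by move=> x Ux; apply: continuousD; [apply: cf|apply: cg].
move=> i; have [di dki] := df i; have [ei eki] := dg i; split=> [x Ux|].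
  by apply: derivableD; [apply: di|apply: ei].
apply: (Ck_ext oU _ (IH _ _ dki eki)) => x Ux.
by rewrite deriveD; [|apply: di|apply: ei].
Qed.

Lemma CkM k U f g : open U -> Ck k U f -> Ck k U g -> Ck k U (f * g).
Proof.
move=> oU; elim: k f g => [|k IH] f g Cf Cg.
  by split=> // x Ux; apply: continuousM; apply: Ck_continuous Ux; eassumption.
have [cf df] := Cf; have [cg dg] := Cg; split.
  by move=> x Ux; apply: continuousM; [apply: cf|apply: cg].
move=> i; have [di dki] := df i; have [ei eki] := dg i; split=> [x Ux|].
  by apply: derivableM; [apply: di|apply: ei].
have C := CkD oU (IH _ _ (CkW Cf) eki) (IH _ _ (CkW Cg) dki).
by apply: (Ck_ext oU _ C) => x Ux; rewrite deriveM; [|apply: di|apply: ei].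
Qed.

End SmoothEuclidean.

(* A smooth [n]-manifold without boundary: a Hausdorff second countable space
   with a smooth atlas, which need not be maximal.  [cmap c] and [cinv c] are
   total functions whose values matter only on [cdom c] and on the open set
   [cmap c @` cdom c]. *)
Record manifold (R : realType) (n : nat) := Manifold {
  carrier :> topologicalType;
  chart : Type;
  cdom : chart -> set carrier;
  cmap : chart -> carrier -> 'rV[R]_n;
  cinv : chart -> 'rV[R]_n -> carrier;
  manifold_hausdorff : hausdorff_space carrier;
  manifold_second_countable : @second_countable carrier;
  cdom_open : forall c, open (cdom c);
  cdom_cover : forall p, exists c, cdom c p;
  cimage_open : forall c, open (cmap c @` cdom c);
  cmapK : forall c p, cdom c p -> cinv c (cmap c p) = p;
  cmap_continuous : forall c p, cdom c p -> {for p, continuous (cmap c)};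
  cinv_continuous : forall c y, (cmap c @` cdom c) y ->
    {for y, continuous (cinv c)};
  transition_smooth : forall c d (i : 'I_n),
    Cinfty (cmap c @` (cdom c `&` cdom d)) (fun y => cmap d (cinv c y) 0 i)
}.

Section SmoothFunctions.
Variables (R : realType) (n : nat) (M : manifold R n).
Implicit Types (U : set M) (f g : M -> R).

(* Meant for open [U] only. *)
Definition smooth_on U f : Prop :=
  forall c : chart M, Cinfty (cmap c @` (cdom c `&` U)) (f \o cinv c).

Lemma cimageI_open (c : chart M) U : open U -> open (cmap c @` (cdom c `&` U)).
Proof.
move=> oU; rewrite openE => _ [p [cp Up] <-].
have Vp : (cmap c @` cdom c) (cmap c p) by exists p.
have := cinv_continuous Vp; rewrite /prop_for /continuous_at cmapK // => cc.
have /cc nU : nbhs p U by apply: open_nbhs_nbhs.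
have nV : nbhs (cmap c p) (cmap c @` cdom c).
  by apply: open_nbhs_nbhs; split=> //; exact: cimage_open.
have nW : nbhs (cmap c p) ((cinv c @^-1` U) `&` (cmap c @` cdom c)).
  exact: filterI.
rewrite /interior; move: nW; apply: filterS => y [Uy [q cq qy]].
by move: Uy; rewrite -qy /= cmapK // => Uq; exists q.
Qed.

Lemma smooth_on_cst U (r : R) : open U -> smooth_on U (cst r).
Proof. by move=> oU c k; apply: Ck_cst; apply: cimageI_open. Qed.

Lemma smooth_onD U f g :
  open U -> smooth_on U f -> smooth_on U g -> smooth_on U (f + g).
Proof.
move=> oU sf sg c k; exact: (CkD (cimageI_open oU) (sf c k) (sg c k)).
Qed.

Lemma smooth_onM U f g :
  open U -> smooth_on U f -> smooth_on U g -> smooth_on U (f * g).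
Proof.
move=> oU sf sg c k; exact: (CkM (cimageI_open oU) (sf c k) (sg c k)).
Qed.

Lemma smooth_onS U V f : V `<=` U -> smooth_on U f -> smooth_on V f.
Proof.
move=> VU sf c k; apply: CkS (sf c k).
by apply: image_subset; apply: setIS.
Qed.

Lemma smooth_on_ext U f g : open U -> (forall p, U p -> f p = g p) ->
  smooth_on U f -> smooth_on U g.
Proof.
move=> oU fg sf c k; apply: (Ck_ext (cimageI_open oU) _ (sf c k)).
by move=> _ [p [cp Up] <-] /=; rewrite cmapK // fg.
Qed.

Definition smoothp : {pred M -> R} := fun f => `[< smooth_on setT f >].

Lemma smoothpP f : reflect (smooth_on setT f) (f \in smoothp).
Proof. exact: asboolP. Qed.

Lemma smoothp_subring : subring_closed smoothp.
Proof.
have sM : {in smoothp &, forall f g, f * g \in smoothp}.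
  move=> f g /smoothpP sf /smoothpP sg; apply/smoothpP.
  by apply: smooth_onM => //; apply: openT.
have sC r : cst r \in smoothp by apply/smoothpP/smooth_on_cst/openT.
split=> //; first exact: (sC 1).
move=> f g /smoothpP sf sg; apply/smoothpP; apply: smooth_onD => //.
  exact: openT.
rewrite -mulN1r; apply/smoothpP; apply: sM => //; exact: (sC (-1)).
Qed.

Lemma smoothp_scaler : scaler_closed smoothp.
Proof.
move=> r f /smoothpP sf; apply/smoothpP.
have -> : r *: f = cst r * f by [].
by apply: smooth_onM => //; [exact: openT|apply/smooth_on_cst/openT].
Qed.

HB.instance Definition _ := GRing.isSubringClosed.Build _ smoothp smoothp_subring.
HB.instance Definition _ := GRing.isScaleClosed.Build _ _ smoothp smoothp_scaler.

(* The ring of smooth functions on [M], which is also a real vector space. *)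
Record cinf := Cinf { cinf_fun :> M -> R; _ : cinf_fun \in smoothp }.

HB.instance Definition _ := [isSub for cinf_fun].
HB.instance Definition _ := [Choice of cinf by <:].
HB.instance Definition _ :=
  GRing.SubChoice_isSubComPzRing.Build _ _ cinf (subringClosedP _).
HB.instance Definition _ := [SubZmodule_isSubLmodule of cinf by <:].

Definition mkcinf f (sf : smooth_on setT f) : cinf := Cinf (introT (smoothpP f) sf).

Lemma cinfP (f : cinf) : smooth_on setT f.
Proof. exact/smoothpP/(valP f). Qed.

Definition ccst (r : R) : cinf := mkcinf (smooth_on_cst r openT).

End SmoothFunctions.

Section TangentSpaces.
Variables (R : realType) (n : nat) (M : manifold R n).
Implicit Types (p : M) (f g : cinf M).

(* Tangent vectors at [p] are the derivations at [p] of the ring of smooth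
   functions. *)
Definition derivation_at p (v : cinf M -> R) : Prop :=
  linear_for *%R v /\ forall f g, v (f * g) = f p * v g + g p * v f.

Definition derivationp p : {pred cinf M -> R} := fun v => `[< derivation_at p v >].

Lemma derivationpP p v : reflect (derivation_at p v) (v \in derivationp p).
Proof. exact: asboolP. Qed.

Lemma derivationp_submod p : submod_closed (derivationp p).
Proof.
split=> [|r u v /derivationpP[lu du] /derivationpP[lv dv]]; apply/derivationpP.
  by split=> [r f g|f g]; rewrite ?mulr0 ?addr0.
have E h : (r *: u + v) h = r * u h + v h by [].
split=> [s f g|f g]; rewrite !E.
  by rewrite lu lv; ring.
by rewrite du dv; ring.
Qed.

HB.instance Definition _ p :=
  GRing.isSubmodClosed.Build _ _ (derivationp p) (derivationp_submod p).

Record tangent p := Tangent {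
  tangent_fun :> cinf M -> R;
  _ : tangent_fun \in derivationp p
}.

HB.instance Definition _ p := [isSub for @tangent_fun p].
HB.instance Definition _ p := [Choice of tangent p by <:].
HB.instance Definition _ p := [SubChoice_isSubLmodule of tangent p by <:].

Lemma tangentP p (v : tangent p) : derivation_at p v.
Proof. exact/derivationpP/(valP v). Qed.

Definition mktangent p (v : cinf M -> R) (dv : derivation_at p v) : tangent p :=
  Tangent (introT (derivationpP p v) dv).

(* Here and for forms, bundle morphisms, pairings and anchors below, smoothness
   is tested on smooth functions, vector fields or sections defined on all of
   [M], which suffices since these extend arbitrary germs. *)
Record vfield := VField {
  vfield_fun :> forall p, tangent p;
  vfield_smooth : forall f, smooth_on setT (fun p => vfield_fun p f)
}.
Implicit Types X Y : vfield.

Definition vapp X f : cinf M := mkcinf (vfield_smooth X f).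

Lemma vappE X f p : vapp X f p = X p f.
Proof. by []. Qed.

Lemma vapp_linear X : linear (vapp X).
Proof.
move=> r f g; apply/val_inj/funext => p /=.
by have [l _] := tangentP (X p); rewrite [LHS]l.
Qed.

Lemma vappM X f g : vapp X (f * g) = f * vapp X g + g * vapp X f.
Proof.
by apply/val_inj/funext => p /=; have [_ d] := tangentP (X p); rewrite [LHS]d.
Qed.

Lemma lie_subproof X Y p :
  derivation_at p (fun f => X p (vapp Y f) - Y p (vapp X f)).
Proof.
have [lX dX] := tangentP (X p); have [lY dY] := tangentP (Y p).
split=> [r f g|f g].
  by rewrite !vapp_linear lX lY; ring.
have addX u v : X p (u + v) = X p u + X p v by rewrite -[u]scale1r lX mul1r scale1r.
have addY u v : Y p (u + v) = Y p u + Y p v by rewrite -[u]scale1r lY mul1r scale1r.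
rewrite !vappM addX addY !dX !dY.
by rewrite !vappE; ring.
Qed.

Definition lie_bracket X Y p : tangent p := mktangent (lie_subproof X Y p).

End TangentSpaces.

Section AlternatingMaps.
Variables (R : realType) (V : lmodType R).

Definition update k (v : 'I_k -> V) (i : 'I_k) (x : V) : 'I_k -> V :=
  fun j => if j == i then x else v j.

Definition multilinear k (w : ('I_k -> V) -> R) : Prop :=
  forall v i, linear_for *%R (fun x => w (update v i x)).

Definition is_alternating k (w : ('I_k -> V) -> R) : Prop :=
  forall v (i j : 'I_k), i != j -> v i = v j -> w v = 0.

(* Normalised so that [wedge a b] evaluates on two vectors [x], [y] to
   [a x * b y - a y * b x] when [k = l = 1]. *)
Definition wedge k l (a : ('I_k -> V) -> R) (b : ('I_l -> V) -> R)
    (v : 'I_(k + l) -> V) : R :=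
  ((k`! * l`!)%N%:R)^-1 *
  \sum_(s : {perm 'I_(k + l)})
    (-1) ^+ s * (a (fun i => v (s (lshift l i))) * b (fun j => v (s (rshift k j)))).

Lemma wedge_multilinear k l (a : ('I_k -> V) -> R) (b : ('I_l -> V) -> R) :
  multilinear a -> multilinear b -> multilinear (wedge a b).
Proof.
move=> ma mb v i r x y; rewrite /wedge mulrCA -mulrDr [r * _]mulr_sumr -big_split /=.
congr (_ * _); apply: eq_bigr => s _.
pose F z := a (fun m => update v i z (s (lshift l m))) *
            b (fun m => update v i z (s (rshift k m))).
suff FE : F (r *: x + y) = r * F x + F y.
  by have := congr1 (fun z => (-1) ^+ s * z) FE; rewrite /= mulrDr [_ * (r * _)]mulrCA.
rewrite {}/F; have [t ti] : exists t, i = s t by exists ((s^-1)%g i); rewrite permKV.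
have E z m : update v i z (s m) = update (v \o s) t z m.
  by rewrite /update ti (inj_eq perm_inj).
have {}E z : (fun m => update v i z (s m)) = update (v \o s) t z by apply/funext.
pose v' := v \o s.
have FL z : (fun m => update v i z (s (lshift l m))) = update v' t z \o @lshift k l.
  by rewrite -E.
have FR z : (fun m => update v i z (s (rshift k m))) = update v' t z \o @rshift k l.
  by rewrite -E.
rewrite (FL (_ + _)) (FL x) (FL y) (FR (_ + _)) (FR x) (FR y).
move: v' {E FL FR ti} => v'; case: (split_ordP t) => u -> {t}.
  have A z : update v' (lshift l u) z \o @lshift k l = update (v' \o @lshift k l) u z.
    by apply/funext => m; rewrite /update /= (inj_eq (@lshift_inj _ _)).
  have B z : update v' (lshift l u) z \o @rshift k l = v' \o @rshift k l.
    by apply/funext => m; rewrite /update /= eq_rlshift.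
  rewrite (A (_ + _)) (A x) (A y) (B (_ + _)) (B x) (B y) ma.
  by rewrite mulrDl mulrA.
have A z : update v' (rshift k u) z \o @rshift k l = update (v' \o @rshift k l) u z.
  by apply/funext => m; rewrite /update /= (inj_eq (@rshift_inj _ _)).
have B z : update v' (rshift k u) z \o @lshift k l = v' \o @lshift k l.
  by apply/funext => m; rewrite /update /= eq_lrshift.
rewrite (A (_ + _)) (A x) (A y) (B (_ + _)) (B x) (B y) mb.
by rewrite mulrDr [_ * (r * _)]mulrCA.
Qed.

Lemma wedge_alternating k l (a : ('I_k -> V) -> R) (b : ('I_l -> V) -> R) :
  is_alternating (wedge a b).
Proof.
move=> v i j ij vij; rewrite /wedge; set S := \sum_(s : _) _.
suff SN : S = - S.
  have : S *+ 2 = 0 by rewrite mulr2n {1}SN addNr.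
  by move/eqP; rewrite mulrn_eq0 /= => /eqP ->; rewrite mulr0.
rewrite {1}/S (reindex_inj (mulIg (tperm i j))) /= -sumrN.
have vt x : v (tperm i j x) = v x by case: tpermP => // ->.
apply: eq_bigr => s _; rewrite odd_permM odd_tperm ij addbT signrN mulNr.
congr (- (_ * (_ * _))).
  by congr a; apply/funext => x; rewrite permM vt.
by congr b; apply/funext => x; rewrite permM vt.
Qed.

End AlternatingMaps.

Section DifferentialForms.
Variables (R : realType) (n : nat) (M : manifold R n).

Record dform (k : nat) := Form {
  form_fun :> forall p : M, ('I_k -> tangent p) -> R;
  form_multilinear : forall p, multilinear (@form_fun p);
  form_alternating : forall p, is_alternating (@form_fun p);
  form_smooth : forall X : 'I_k -> vfield M,
    smooth_on setT (fun p => form_fun (fun i => X i p))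
}.
Arguments form_fun {k} w p v : rename.

Definition form_app k (w : dform k) (X : 'I_k -> vfield M) : cinf M :=
  mkcinf (form_smooth w X).

Lemma form_eq k (w w' : dform k) : (forall p v, w p v = w' p v) -> w = w'.
Proof.
case: w w' => [w m a s] [w' m' a' s'] /= E.
have {}E : w = w' by apply/functional_extensionality_dep => p; apply/funext => v.
by subst w'; congr Form; exact: Prop_irrelevance.
Qed.

Lemma form0_subproof k (p : M) : multilinear (fun _ : 'I_k -> tangent p => 0 : R) /\
  is_alternating (fun _ : 'I_k -> tangent p => 0 : R).
Proof. by split=> // v i r x y; rewrite mulr0 addr0. Qed.

Definition form0 k : dform k :=
  @Form k (fun _ _ => 0) (fun p => (form0_subproof k p).1)
    (fun p => (form0_subproof k p).2) (fun _ => smooth_on_cst 0 openT).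

Section Comb.
Variables (k : nat) (r : R) (w w' : dform k).

Lemma comb_multilinear p : multilinear (fun v => r * w p v + w' p v).
Proof. by move=> v i s x y; rewrite !form_multilinear; ring. Qed.

Lemma comb_alternating p : is_alternating (fun v => r * w p v + w' p v).
Proof.
move=> v i j ij vij.
by rewrite (form_alternating w ij vij) (form_alternating w' ij vij) mulr0 addr0.
Qed.

Lemma comb_smooth (X : 'I_k -> vfield M) :
  smooth_on setT (fun p => r * w p (fun i => X i p) + w' p (fun i => X i p)).
Proof. exact: (cinfP (r *: form_app w X + form_app w' X)). Qed.

(* [r w + w'] *)
Definition form_comb := Form comb_multilinear comb_alternating comb_smooth.
End Comb.

HB.instance Definition _ k := gen_eqMixin (dform k).
HB.instance Definition _ k := gen_choiceMixin (dform k).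

Section Lmod.
Variable k : nat.
Let addf (w w' : dform k) := form_comb 1 w w'.
Let oppf (w : dform k) := form_comb (-1) w (form0 k).
Let scalef (r : R) (w : dform k) := form_comb r w (form0 k).

Let addfA : associative addf.
Proof. by move=> u v w; apply: form_eq => p x /=; ring. Qed.
Let addfC : commutative addf.
Proof. by move=> u v; apply: form_eq => p x /=; ring. Qed.
Let add0f : left_id (form0 k) addf.
Proof. by move=> u; apply: form_eq => p x /=; ring. Qed.
Let addNf : left_inverse (form0 k) oppf addf.
Proof. by move=> u; apply: form_eq => p x /=; ring. Qed.

HB.instance Definition _ := GRing.isZmodule.Build (dform k) addfA addfC add0f addNf.

Let scalefA r s w : scalef r (scalef s w) = scalef (r * s) w.
Proof. by apply: form_eq => p x /=; ring. Qed.
Let scale1f : left_id 1 scalef.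
Proof. by move=> u; apply: form_eq => p x /=; ring. Qed.
Let scalefDr : right_distributive scalef +%R.
Proof. by move=> r u v; apply: form_eq => p x /=; ring. Qed.
Let scalefDl w : {morph scalef^~ w : r s / r + s}.
Proof. by move=> r s; apply: form_eq => p x /=; ring. Qed.

HB.instance Definition _ :=
  GRing.Zmodule_isLmodule.Build R (dform k) scalefA scale1f scalefDr scalefDl.

Lemma formDE (w w' : dform k) p x : (w + w') p x = w p x + w' p x.
Proof. by rewrite -[w p x]mul1r. Qed.
Lemma formNE (w : dform k) p x : (- w) p x = - w p x.
Proof. by rewrite -[RHS]addr0 -mulN1r. Qed.
Lemma formZE r (w : dform k) p x : (r *: w) p x = r * w p x.
Proof. by rewrite -[RHS]addr0. Qed.
End Lmod.

Section FormWedge.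
Variables (k l : nat) (w : dform k) (w' : dform l).

Lemma form_wedge_smooth (X : 'I_(k + l) -> vfield M) :
  smooth_on setT (fun p => wedge (w p) (w' p) (fun i => X i p)).
Proof.
pose t (s : {perm 'I_(k + l)}) : M -> R := (-1) ^+ s *:
  (cinf_fun (form_app w (fun i => X (s (lshift l i)))) *
   cinf_fun (form_app w' (fun j => X (s (rshift k j))))).
suff -> : (fun p => wedge (w p) (w' p) (fun i => X i p)) =
          ((k`! * l`!)%N%:R)^-1 *: \sum_(s : {perm 'I_(k + l)}) t s.
  apply/smoothpP/rpredZ/rpred_sum => s _; apply/rpredZ/rpredM; exact: valP.
by apply/funext => p; rewrite fct_sumE.
Qed.

Definition form_wedge : dform (k + l) :=
  Form (fun p => wedge_multilinear (@form_multilinear _ w p) (@form_multilinear _ w' p))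
    (fun p => @wedge_alternating _ _ _ _ (w p) (w' p)) form_wedge_smooth.
End FormWedge.

(* Operators of degree 1 on the graded algebra of differential forms. *)
Definition operator1 := forall k, dform k -> dform k.+1.

(* The two sides of the Leibniz rule live in degrees [(k + l).+1] and
   [k + l.+1], hence the cast. *)
Definition graded_derivation (D : operator1) : Prop :=
  (forall k, linear (@D k)) /\
  (forall k l (w : dform k) (w' : dform l),
     D _ (form_wedge w w') =
     form_wedge (D _ w) w' +
     (-1) ^+ k *: ecast m (dform m) (addnS k l) (form_wedge w (D _ w'))).

(* The invariant formula for the exterior derivative.  In the second sum the
   arguments of [w] are [[X i, X j]] followed by the [X m] with [m] different
   from [i] and [j], in increasing order. *)
Definition ext_deriv_formula k (w : dform k) (X : 'I_k.+1 -> vfield M) (p : M) : R :=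
  \sum_(i < k.+1)
    (-1) ^+ i * X i p (form_app w (fun m => X (lift i m))) +
  \sum_(i < k.+1) \sum_(j < k.+1 | (i < j)%N)
    (-1) ^+ (i + j)%N *
    w p (fun m : 'I_k =>
           if m == 0%N :> nat then lie_bracket (X i) (X j) p
           else X (inord (bump i (bump j.-1 m.-1))) p).

Definition is_ext_deriv k (w : dform k) (w' : dform k.+1) : Prop :=
  forall (X : 'I_k.+1 -> vfield M) p, w' p (fun i => X i p) = ext_deriv_formula w X p.

Definition ext_deriv : operator1 := fun k w => xget 0 (is_ext_deriv w).

(* Omega^2(M, TM) *)
Record tform2 := TForm2 {
  tform2_fun :> forall p : M, tangent p -> tangent p -> tangent p;
  tform2_linear : forall p (x : tangent p), linear (tform2_fun x);
  tform2_skew : forall p (x y : tangent p), tform2_fun x y = - tform2_fun y x;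
  tform2_smooth : forall (X Y : vfield M) f,
    smooth_on setT (fun p => tform2_fun (X p) (Y p) f)
}.
Arguments tform2_fun T p x y : rename.

(* [insertion T] is the unique operator with these properties. *)
Definition is_insertion (T : tform2) (D : operator1) : Prop :=
  [/\ graded_derivation D,
      forall w : dform 0, D _ w = 0 &
      forall (w : dform 1) (p : M) (v : 'I_2 -> tangent p),
        D _ w p v = w p (fun=> T p (v 0) (v 1))].

Definition insertion (T : tform2) : operator1 :=
  xget (fun k _ => 0) (is_insertion T).

Definition curved_deriv (T : tform2) : operator1 :=
  fun k w => ext_deriv w - insertion T w.

End DifferentialForms.

(* A smooth real vector bundle of constant rank [rk], given by its fibres and
   smoothly compatible local trivialisations: [tmap t p] is meant to be used
   for [p] in [tdom t] only. *)
Record vbundle (R : realType) (n : nat) (M : manifold R n) := VBundle {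
  fibre :> M -> lmodType R;
  rk : nat;
  triv : Type;
  tdom : triv -> set M;
  tmap : triv -> forall p, fibre p -> 'rV[R]_rk;
  tdom_open : forall t, open (tdom t);
  tdom_cover : forall p, exists t, tdom t p;
  tmap_linear : forall t p, tdom t p -> linear (@tmap t p);
  tmap_bij : forall t p, tdom t p -> bijective (@tmap t p);
  tmap_smooth : forall t u, exists g : M -> 'M[R]_rk,
    (forall i j, smooth_on (tdom t `&` tdom u) (fun p => g p i j)) /\
    (forall p (e : fibre p), (tdom t `&` tdom u) p ->
       tmap u e = tmap t e *m g p)
}.

Section Sections.
Variables (R : realType) (n : nat) (M : manifold R n) (E : vbundle M).

Record section := Section_ {
  section_fun :> forall p : M, E p;
  section_smooth : forall t (j : 'I_(rk E)),
    smooth_on (tdom t) (fun p => tmap t (section_fun p) 0 j)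
}.

Lemma section_eq (a b : section) : (forall p, a p = b p) -> a = b.
Proof.
case: a b => [a sa] [b sb] /= ab.
have {}ab : a = b by exact/functional_extensionality_dep.
by subst b; congr Section_; exact: Prop_irrelevance.
Qed.

Lemma section0_smooth t (j : 'I_(rk E)) :
  smooth_on (tdom t) (fun p => tmap t (0 : E p) 0 j).
Proof.
apply: smooth_on_ext (smooth_on_cst 0 (tdom_open t)); first exact: tdom_open.
move=> p tp; have := tmap_linear tp (-1) 0 0.
by rewrite scaler0 addr0 scaleN1r addNr => ->; rewrite mxE.
Qed.

Definition section0 : section := Section_ section0_smooth.

Lemma section_comb_smooth (f : cinf M) (a b : section) t (j : 'I_(rk E)) :
  smooth_on (tdom t) (fun p => tmap t (f p *: a p + b p) 0 j).
Proof.
have fs : smooth_on (tdom t) f by apply: smooth_onS (cinfP f).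
have oT := tdom_open t.
have := smooth_onD oT (smooth_onM oT fs (section_smooth a t j)) (section_smooth b t j).
by apply: smooth_on_ext => // p tp; rewrite (tmap_linear tp) !mxE.
Qed.

(* [f a + b] *)
Definition section_comb f a b : section := Section_ (section_comb_smooth f a b).

HB.instance Definition _ := gen_eqMixin section.
HB.instance Definition _ := gen_choiceMixin section.

Let adds (a b : section) := section_comb 1 a b.
Let opps (a : section) := section_comb (-1) a section0.
Let scales (f : cinf M) (a : section) := section_comb f a section0.

Let addsA : associative adds.
Proof. by move=> a b c; apply: section_eq => p /=; rewrite !scale1r addrA. Qed.
Let addsC : commutative adds.
Proof. by move=> a b; apply: section_eq => p /=; rewrite !scale1r addrC. Qed.
Let add0s : left_id section0 adds.
Proof. by move=> a; apply: section_eq => p /=; rewrite scaler0 add0r. Qed.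
Let addNs : left_inverse section0 opps adds.
Proof.
by move=> a; apply: section_eq => p /=; rewrite scale1r addr0 scaleN1r addNr.
Qed.

HB.instance Definition _ := GRing.isZmodule.Build section addsA addsC add0s addNs.

Let scalesA f g a : scales f (scales g a) = scales (f * g) a.
Proof. by apply: section_eq => p /=; rewrite !addr0 scalerA. Qed.
Let scale1s : left_id 1 scales.
Proof. by move=> a; apply: section_eq => p /=; rewrite addr0 scale1r. Qed.
Let scalesDr : right_distributive scales +%R.
Proof.
by move=> f a b; apply: section_eq => p /=; rewrite !addr0 !scale1r scalerDr.
Qed.
Let scalesDl a : {morph scales^~ a : f g / f + g}.
Proof.
by move=> f g; apply: section_eq => p /=; rewrite !addr0 scale1r scalerDl.
Qed.

HB.instance Definition _ :=
  GRing.Zmodule_isLmodule.Build (cinf M) section scalesA scale1s scalesDr scalesDl.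

Lemma sectionDE (a b : section) p : (a + b) p = a p + b p.
Proof. by rewrite -[a p]scale1r. Qed.
Lemma sectionZE (f : cinf M) (a : section) p : (f *: a) p = f p *: a p.
Proof. by rewrite -[RHS]addr0. Qed.

End Sections.

Record vbmorphism (R : realType) (n : nat) (M : manifold R n) (E E' : vbundle M) :=
  VBMorphism {
    vbm_fun :> forall p, {linear E p -> E' p};
    vbm_smooth : forall (a : section E) t (j : 'I_(rk E')),
      smooth_on (tdom t) (fun p => tmap t (vbm_fun p (a p)) 0 j)
  }.

Definition vbm_app (R : realType) (n : nat) (M : manifold R n) (E E' : vbundle M)
    (phi : vbmorphism E E') (a : section E) : section E' :=
  Section_ (vbm_smooth phi a).

Record algebroid_data (R : realType) (n : nat) (M : manifold R n) := AlgebroidData {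
  bundle :> vbundle M;
  pairing : forall p, bundle p -> bundle p -> R;
  anchor : forall p, {linear bundle p -> tangent p};
  bracket : section bundle -> section bundle -> section bundle;
  pairing_linear : forall p (e : bundle p), linear_for *%R (pairing e);
  pairing_sym : forall p (e e' : bundle p), pairing e e' = pairing e' e;
  pairing_nondeg : forall p (e : bundle p), (forall e', pairing e e' = 0) -> e = 0;
  pairing_smooth : forall a b : section bundle,
    smooth_on setT (fun p => pairing (a p) (b p));
  anchor_smooth : forall (a : section bundle) (f : cinf M),
    smooth_on setT (fun p => anchor p (a p) f);
  bracket_linearl : forall (b : section bundle) (r : R) (a a' : section bundle),
    bracket (ccst M r *: a + a') b = ccst M r *: bracket a b + bracket a' b;
  bracket_linearr : forall (b : section bundle) (r : R) (a a' : section bundle),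
    bracket b (ccst M r *: a + a') = ccst M r *: bracket b a + bracket b a'
}.

Section Algebroids.
Variables (R : realType) (n : nat) (M : manifold R n).

Section Data.
Variable A : algebroid_data M.
Implicit Types a b c : section A.

Definition spairing a b : cinf M := mkcinf (pairing_smooth a b).
Definition sanchor a : vfield M := VField (anchor_smooth a).

(* [rho^* alpha] is the unique [e] with [<e, e'> = alpha (rho e')]. *)
Definition coanchor (p : M) (alpha : tangent p -> R) : A p :=
  xget 0 [set e | forall e', pairing e e' = alpha (anchor A p e')].

Definition differential (f : cinf M) (p : M) : tangent p -> R := fun v => v f.

Definition metric_algebroid : Prop :=
  (forall a b (p : M),
     (bracket a b + bracket b a) p = coanchor (differential (spairing a b) (p := p))) /\
  (forall a b c,
     vapp (sanchor a) (spairing b c) =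
     spairing (bracket a b) c + spairing b (bracket a c)).

(* [F(a, b) = rho [a, b] - [rho a, rho b]] *)
Definition anchor_defect a b (p : M) : tangent p :=
  anchor A p (bracket a b p) - lie_bracket (sanchor a) (sanchor b) p.

Definition curved_courant_algebroid : Prop :=
  [/\ metric_algebroid,
      (forall (f : cinf M) a a' b p,
         anchor_defect (f *: a + a') b p =
         f p *: anchor_defect a b p + anchor_defect a' b p),
      (forall (f : cinf M) a b b' p,
         anchor_defect a (f *: b + b') p =
         f p *: anchor_defect a b p + anchor_defect a b' p),
      (forall a b p, anchor_defect a b p = - anchor_defect b a p) &
      (forall a b p, anchor A p (a p) = 0 -> anchor_defect a b p = 0)].

Definition has_curvature (T : tform2 M) : Prop :=
  forall a b p, anchor_defect a b p = T p (anchor A p (a p)) (anchor A p (b p)).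

(* Exactness of [0 -> T*M -> E -> TM -> 0] in every fibre. *)
Definition exact_algebroid : Prop :=
  forall p : M,
    [/\ (forall alpha beta : {scalar tangent p},
           coanchor alpha = coanchor beta -> alpha =1 beta),
        (forall e : A p,
           anchor A p e = 0 <-> exists alpha : {scalar tangent p}, e = coanchor alpha) &
        (forall v : tangent p, exists e : A p, anchor A p e = v)].

End Data.

Definition is_isomorphism (A A' : algebroid_data M) (phi : vbmorphism A A') : Prop :=
  [/\ (exists psi : vbmorphism A' A,
         forall p, cancel (phi p) (psi p) /\ cancel (psi p) (phi p)),
      (forall p (e e' : A p), pairing (phi p e) (phi p e') = pairing e e'),
      (forall p (e : A p), anchor A' p (phi p e) = anchor A p e) &
      (forall a b : section A,
         bracket (vbm_app phi a) (vbm_app phi b) = vbm_app phi (bracket a b))].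

Record exact_cca (T : tform2 M) := ExactCCA {
  ecca_data :> algebroid_data M;
  ecca_cca : curved_courant_algebroid ecca_data;
  ecca_exact : exact_algebroid ecca_data;
  ecca_curvature : has_curvature ecca_data T
}.

Definition isomorphic (T : tform2 M) (A A' : exact_cca T) : Prop :=
  exists phi : vbmorphism A A', is_isomorphism phi.

(* Congruence modulo the image of [curved_deriv T] on 2-forms. *)
Definition cohomologous (T : tform2 M) (H H' : dform M 3) : Prop :=
  exists B : dform M 2, H' - H = curved_deriv T B.

End Algebroids.

(* The set of classes of an equivalence relation [r]; [set] is avoided because
   [exact_cca T] lives in a larger universe. *)
Definition quotient (X : Type) (r : X -> X -> Prop) : Type :=
  {C : X -> Prop | exists x, C = r x}.

(* Main.v *)
From HB Require Import structures.
Require Import Defs.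
From mathcomp Require Import all_boot all_order all_algebra perm.
From mathcomp Require Import all_classical all_reals all_analysis.
From mathcomp Require Import ring lra.

(** Write [rho] for the anchor, [<a, b>] for the pairing, and fix the curvature
    [T].  The bundle TM + T*M, with its canonical pairing and with the Dorfman
    bracket in which [X, Y] is replaced by [X, Y] + T(X, Y), is an exact curved
    Courant algebroid with curvature [T] ([std_data]; the Jacobi identity is not
    among the axioms).  Adding [rho^* H(rho a, rho b, -)] to the bracket gives
    another one for each three-form [H] ([twist]), and the bijection is induced
    by the map sending [H] to this twist ([std_ecca]).

    Everything rests on the comparison of two brackets along a bundle isometry
    [phi : A -> A'] that commutes with the anchors.  Consider
    [<[phi a, phi b], phi c> - <[a, b], c>].  It is linear over functions in [c].
    In the metric axioms the terms with derivatives only involve the pairing and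
    the anchor, hence they cancel and the expression is skew in [a, b, c]; so it
    is linear over functions in all of them.  If [rho c = 0] it vanishes, because
    [[phi a, phi b]] and [phi [a, b]] have the same image under the anchor and
    the kernel of the anchor is isotropic.  Thus it is a three-form on [M]
    ([bracket_diff_descends]).

    Surjectivity.  If [A] is any exact algebroid, a splitting of the anchor with
    isotropic image provides an isometry from TM + T*M to [A]
    ([standard_isometry]), which is an isomorphism from the twist by the
    three-form above.  The splitting comes from a partition of unity.

    Injectivity.  An isometry of TM + T*M commuting with the anchor is of the form
    [a |-> a + rho^* B(rho a, -)] with a two-form [B], and expanding the bracket
    shows that its three-form is [d^T B] ([bfield_expand]).  Hence the twists by
    [H] and [H'] are isomorphic exactly when [H' - H] is in the image of [d^T].

    It remains to connect these arguments with the definitions.  Tangent vectors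
    are derivations of the ring of smooth functions; Hadamard's lemma and bump
    functions provide frames for them ([frame_at]), after which charts are not
    used any more.  The exterior derivative is specified by its invariant formula
    and the insertion [iota_T] as a graded derivation, so a form, respectively an
    operator, with the required properties has to be exhibited.  For two-forms the
    former is again a difference of brackets, this time with [T = 0]
    ([curved_formula_form]).  For the latter, [form_insP] gives an explicit
    derivation on forms of all degrees, and [insertion_unique2] shows that on
    two-forms there is no other choice. *)

Set Implicit Arguments.
Unset Strict Implicit.
Unset Printing Implicit Defensive.

Import Order.TTheory GRing.Theory Num.Theory.
Import numFieldNormedType.Exports.

Local Open Scope classical_set_scope.
Local Open Scope ring_scope.

(** * Differentiable functions of several variables *)

Section Line.
Variables (R : realType) (V : normedModType R).

Lemma is_derive_line (f : V -> R) (y v : V) (t : R) :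
  derivable f (y + t *: v) v ->
  is_derive t 1 (fun s : R => f (y + s *: v)) ('D_v f (y + t *: v)).
Proof.
have E : (fun h : R => h^-1 *: (((fun s : R => f (y + s *: v)) \o shift t) (h *: 1) -
                          f (y + t *: v))) =
         (fun h : R => h^-1 *: ((f \o shift (y + t *: v)) (h *: v) - f (y + t *: v))).
  apply/funext => h /=; congr (_ *: (f _ - _)).
  by rewrite [h *: 1]mulr1 scalerDl addrCA.
move=> d; apply: DeriveDef.
  by rewrite /derivable E.
by rewrite /derive E.
Qed.

Lemma is_derive_lineM (f : V -> R) (y v : V) (c t : R) :
  derivable f (y + (t * c) *: v) v ->
  is_derive t 1 (fun s : R => f (y + (s * c) *: v)) (c * 'D_v f (y + (t * c) *: v)).
Proof.
move=> /is_derive_line d.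
have dc : is_derive t 1 (fun s : R => s * c) c.
  have -> : (fun s : R => s * c) = c *: id by apply/funext => s; rewrite mulrC.
  by apply: is_derive_eq; rewrite [LHS]mulr1.
have dd := is_derive1_comp (g := fun s : R => s * c) d dc.
by apply: is_derive_eq; rewrite [LHS]mulrC.
Qed.

End Line.

(** The differential is defined by choice among the linear maps that
    approximate; this is the way to identify it. *)
Lemma differentiable_linear_approx (R : realType) (V W : normedModType R)
    (f : V -> W) (df : {linear V -> W}) (x : V) : continuous df ->
  (forall e, 0 < e -> \forall h \near 0, `|f (h + x) - (f x + df h)| <= e * `|h|) ->
  differentiable f x /\ forall w, 'd f x w = df w.
Proof.
move=> cdf E; have {}E : f \o shift x = cst (f x) + df +o_ 0 id by apply/eqaddoP.
have dfx := diff_unique cdf E.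
split=> [|w]; last by rewrite dfx.
by apply/diff_locallyP; rewrite dfx; split.
Qed.

Section Euclid.
Variables (R : realType) (n : nat).
Implicit Types (U V : set 'rV[R]_n) (f g : 'rV[R]_n -> R).

(** Continuous partial derivatives give differentiability: the increment
    [f (x + h) - f x] is telescoped along the path that changes one coordinate
    at a time, and the mean value theorem is applied on each edge. *)
Lemma partials_diff f (x : 'rV[R]_n) :
  (\forall y \near x, forall i, derivable f y (delta_mx 0 i)) ->
  (forall i, {for x, continuous ('D_(delta_mx 0 i) f)}) ->
  differentiable f x /\
  forall w, 'd f x w = \sum_i w 0 i * 'D_(delta_mx 0 i) f x.
Proof.
move=> df cf.
pose D (w : 'rV[R]_n) : R := \sum_i w 0 i * 'D_(delta_mx 0 i) f x.
have linD : linear D.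
  move=> c u v; rewrite /D scaler_sumr -big_split /=; apply: eq_bigr => i _.
  by rewrite !mxE mulrDl scalerAl.
pose DL : {linear 'rV[R]_n -> R} := HB.pack D (GRing.isLinear.Build _ _ _ _ D linD).
have cD : continuous DL.
  move=> w; apply: differentiable_continuous.
  have -> : (DL : 'rV[R]_n -> R) =
      \sum_(i < n) (fun w : 'rV[R]_n => w 0 i * 'D_(delta_mx 0 i) f x).
    by apply/funext => u; rewrite fct_sumE.
  apply: differentiable_sum => i.
  by apply: differentiableM => //; apply: differentiable_coord.
apply: (@differentiable_linear_approx R _ _ f DL x cD) => e e0.
have [r /= r0 Hr] : exists2 r : R, 0 < r & forall y, ball x r y ->
    (forall i, derivable f y (delta_mx 0 i)) /\
    (forall i, `|'D_(delta_mx 0 i) f x - 'D_(delta_mx 0 i) f y| <= e / n.+1%:R).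
  have H : \forall y \near x, (forall i, derivable f y (delta_mx 0 i)) /\
    (forall i, `|'D_(delta_mx 0 i) f x - 'D_(delta_mx 0 i) f y| <= e / n.+1%:R).
    near=> y; split; first by near: y.
    near: y; apply: filter_forall => i.
    have := cf i => /cvgrPdist_le; apply.
    by rewrite divr_gt0.
  by have /nbhs_ballP [r r0 Hr] := H; exists r.
near=> h.
have hr : `|h| < r.
  near: h; apply/nbhs_ballP; exists r => // y.
  by rewrite -ball_normE /= sub0r normrN.
(* [x + P m] is the vertex of that path at which the first [m] coordinates have moved. *)
pose P (m : nat) : 'rV[R]_n := \row_i (if (i < m)%N then h 0 i else 0).
have Pn : P n = h by apply/rowP => i; rewrite mxE ltn_ord.
have P0 : P 0%N = 0 by apply/rowP => i; rewrite !mxE.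
have -> : f (h + x) - (f x + D h) =
   \sum_(i < n) (f (x + P i.+1) - f (x + P i) - h 0 i * 'D_(delta_mx 0 i) f x).
  rewrite sumrB -/(D h) opprD addrA; congr (_ - _).
  rewrite -(big_mkord xpredT (fun i => f (x + P i.+1) - f (x + P i))) telescope_sumr //.
  by rewrite Pn P0 addr0 (addrC h).
apply: le_trans (ler_norm_sum _ _ _) _.
have : \sum_(i < n) (e / n.+1%:R * `|h|) <= e * `|h|.
  rewrite sumr_const card_ord -mulrnAl ler_wpM2r //.
  rewrite -mulr_natr -mulrA ler_piMr ?(ltW e0) //.
  by rewrite mulrC ler_pdivrMr // mul1r ler_nat.
apply: le_trans; apply: ler_sum => i _.

have hi : `|h 0 i| <= `|h|.
  rewrite [leRHS]/Num.Def.normr/= mx_normrE.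
  exact: (le_bigmax _ (fun ij : 'I_1 * 'I_n => `|h ij.1 ij.2|) (0, i)).
have PS t : P i + (t * h 0 i) *: delta_mx 0 i =
    \row_j (if (j < i)%N then h 0 j else if j == i then t * h 0 i else 0).
  apply/rowP => j; rewrite !mxE eqxx /=.
  by case: ltngtP => [ji|ji|/val_inj ->]; rewrite ?eqxx ?mulr1 ?add0r //;
     rewrite -val_eqE /= ?(ltn_eqF ji) ?(gtn_eqF ji) mulr0 ?addr0.
have PS1 : P i.+1 = P i + (1 * h 0 i) *: delta_mx 0 i.
  rewrite PS; apply/rowP => j; rewrite !mxE ltnS leq_eqVlt val_eqE.
  by case: (eqVneq j i) => [->|_] /=; rewrite ?ltnn ?mul1r //.
have inb (t : R) : t \in `[0, 1] -> ball x r (x + (P i + (t * h 0 i) *: delta_mx 0 i)).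
  rewrite in_itv /= => /andP[t0 t1].
  rewrite PS -ball_normE /= opprD addrA subrr add0r normrN.
  apply: le_lt_trans hr; rewrite [leLHS]/Num.Def.normr/= mx_normrE.
  apply/bigmax_leP; split=> // -[a j] _ /=; rewrite mxE.
  have hj : `|h 0 j| <= `|h|.
    rewrite [leRHS]/Num.Def.normr/= mx_normrE.
    exact: (le_bigmax _ (fun ij : 'I_1 * 'I_n => `|h ij.1 ij.2|) (0, j)).
  case: ifP => // _; case: ifP => _; last by rewrite normr0.
  by rewrite normrM ger0_norm // (le_trans _ hi) // ler_piMl.
pose g (s : R) : R := f (x + P i + (s * h 0 i) *: delta_mx 0 i).
pose g' (s : R) : R :=
  h 0 i * 'D_(delta_mx 0 i) f (x + P i + (s * h 0 i) *: delta_mx 0 i).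
have dg (t : R) : t \in `[0, 1] -> is_derive t 1 g (g' t).
  by move=> t01; apply: is_derive_lineM; have := inb _ t01; rewrite addrA => /Hr[].
have dg0 (t : R) : t \in `]0, 1[ -> is_derive t 1 g (g' t).
  by move=> t01; apply: dg; move: t01; rewrite !in_itv /= => /andP[/ltW -> /ltW ->].
have cg : {within `[0, 1], continuous g}.
  by apply: derivable_within_continuous => t t01; have [] := dg t t01.
have [c c01] := MVT_segment ler01 dg0 cg.
rewrite /g /g'.
rewrite mul0r scale0r addr0 subr0 mulr1 PS1 addrA => ->.
rewrite -mulrBr normrM mulrC ler_pM //.
have /Hr [_ /(_ i)] := inb _ c01.
by rewrite distrC addrA.
Unshelve. all: by end_near. Qed.

End Euclid.

Section Chain.
Variables (R : realType) (W V : normedModType R).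

Lemma derive_line0 (U : normedModType R) (h : W -> U) (x v : W) :
  'D_1 (fun s : R => h (s *: v + x)) 0 = 'D_v h x.
Proof.
have E : (fun s : R => s^-1 *: (((fun s : R => h (s *: v + x)) \o shift 0) (s *: 1) -
                          h (0 *: v + x))) =
         (fun s : R => s^-1 *: ((h \o shift x) (s *: v) - h x)).
  by apply/funext => s /=; rewrite addr0 scale0r add0r [_%:A]mulr1.
by rewrite /derive E.
Qed.

Lemma is_derive_diff_comp (h : W -> V) (f : V -> R) (x v : W) :
  derivable h x v -> differentiable f (h x) ->
  is_derive x v (f \o h) ('d f (h x) ('D_v h x)).
Proof.
move=> dh df; pose g (s : R) := h (s *: v + x).
have g0 : g 0 = h x by rewrite /g scale0r add0r.
have dg' : derivable g 0 1 by move/derivable1P: dh.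
have dg : differentiable g 0 by apply/derivable1_diffP.
have Dg : 'D_1 g 0 = 'D_v h x by exact: derive_line0.
have df0 : differentiable f (g 0) by rewrite g0.
have dfg : differentiable (f \o g) 0.
  exact: differentiable_comp dg df0.
apply: DeriveDef.
  by apply/derivable1P; move/derivable1_diffP: dfg.
rewrite -Dg (deriveE _ dg).
transitivity ('D_1 (f \o g) 0); first exact/esym/(derive_line0 (f \o h)).
by rewrite (deriveE _ dfg) diff_comp //= g0.
Qed.

End Chain.

Section CkFacts.
Variables (R : realType) (n : nat).
Implicit Types (U V : set 'rV[R]_n) (f g : 'rV[R]_n -> R).

(** [Ck] is a conjunction of pointwise conditions, and the directional
    derivatives are germs. *)
Lemma Ck_local k U f :
  (forall x, U x -> exists V, V x /\ Ck k V f) -> Ck k U f.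
Proof.
elim: k f => [|k IH] f H; split=> //.
- by move=> x /H [V [Vx [cf _]]]; apply: cf.
- by move=> x /H [V [Vx [cf _]]]; apply: cf.
move=> i; split=> [x /H [V [Vx [_ /(_ i) [df _]]]]|]; first exact: df.
by apply: IH => x /H [V [Vx [_ /(_ i) [_ df]]]]; exists V.
Qed.

Lemma Cinfty_local U f :
  (forall x, U x -> exists V, V x /\ Cinfty V f) -> Cinfty U f.
Proof. by move=> H k; apply: Ck_local => x /H [V [Vx /(_ k)]]; exists V. Qed.

Lemma Ck_sum k U (I : Type) (r : seq I) (F : I -> 'rV[R]_n -> R) : open U ->
  (forall i, Ck k U (F i)) -> Ck k U (fun x => \sum_(i <- r) F i x).
Proof.
move=> oU CF; elim: r => [|i r IH].
  apply: (Ck_ext oU _ (Ck_cst k 0 oU)) => x _; by rewrite big_nil.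
apply: (Ck_ext oU _ (CkD oU (CF i) IH)) => x _; by rewrite big_cons.
Qed.

Lemma CkV k U f : open U -> (forall x, U x -> f x != 0) -> Ck k U f ->
  Ck k U (fun x => (f x)^-1).
Proof.
move=> oU f0; elim: k => [|k IH] Cf; have [cf df] := Cf; split=> //.
- by move=> x Ux; exact: (cvgV (f0 _ Ux) (cf _ Ux)).
- by move=> x Ux; exact: (cvgV (f0 _ Ux) (cf _ Ux)).
move=> i; have [di dki] := df i; split=> [x Ux|].
  exact: (derivableV (f0 _ Ux) (di _ Ux)).
have CV := IH (CkW Cf).
have C := CkM oU (Ck_cst k (-1) oU) (CkM oU (CkM oU CV CV) dki).
apply: (Ck_ext oU _ C) => x Ux.
by rewrite deriveV ?f0 //; [rewrite !fctE /cst mulN1r expr2 invfM scaleNr|exact: di].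
Qed.

Lemma Ck1_differentiable U f x : open U -> Ck 1 U f -> U x ->
  differentiable f x /\
  forall w, 'd f x w = \sum_i w 0 i * 'D_(delta_mx 0 i) f x.
Proof.
move=> oU [_ df] Ux; apply: partials_diff => [|i].
  have : nbhs x U by apply: open_nbhs_nbhs.
  by apply: filterS => y Uy i; have [+ _] := df i; apply.
by have [_ [+ _]] := df i; apply.
Qed.

End CkFacts.

Lemma rV_continuous (R : realType) (T : topologicalType) n (h : T -> 'rV[R]_n) (x : T) :
  (forall i, {for x, continuous (fun y => h y 0 i)}) -> {for x, continuous h}.
Proof.
move=> ch; apply/cvgrPdist_lt => e e0.
have : \forall y \near x, forall i, `|h x 0 i - h y 0 i| < e.
  apply: filter_forall => i; have := ch i.
  by rewrite /prop_for /continuous_at => /cvgrPdist_lt /(_ e e0).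
apply: filterS => y hy.
rewrite [ltLHS]/Num.Def.normr/= mx_normrE; apply/bigmax_ltP; split=> // -[a i] _ /=.
by rewrite !mxE ord1.
Qed.

(** The chain rule writes a partial derivative of the composite as a sum of
    products of functions of class C^k, so induction on [k] applies.  Charts
    enter only through this lemma: it makes smoothness independent of them. *)
Lemma Ck_comp (R : realType) m n k (U : set 'rV[R]_m) (V : set 'rV[R]_n)
    (f : 'rV[R]_n -> R) (h : 'rV[R]_m -> 'rV[R]_n) :
  open U -> open V -> (forall x, U x -> V (h x)) ->
  Ck k V f -> (forall j, Ck k U (fun x => h x 0 j)) -> Ck k U (f \o h).
Proof.
move=> oU oV UV; have ch k' x : U x -> (forall j, Ck k' U (fun x => h x 0 j)) ->
    {for x, continuous h}.
  by move=> Ux Ch; apply: rV_continuous => i; apply: Ck_continuous (Ch i) Ux.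
have cc k' f' x : Ck k' V f' -> (forall j, Ck k' U (fun x => h x 0 j)) -> U x ->
    {for x, continuous (f' \o h)}.
  move=> Cf' Ch Ux; apply: continuous_comp; first exact: ch Ux Ch.
  exact: Ck_continuous Cf' (UV _ Ux).
elim: k f => [|k IH] f Cf Ch; split=> //; try by move=> x; apply: cc Cf Ch.
move=> i.
have H x : U x -> is_derive x (delta_mx 0 i) (f \o h)
    (\sum_j 'D_(delta_mx 0 i) (fun y => h y 0 j) x * 'D_(delta_mx 0 j) f (h x)).
  move=> Ux.
  have dh : derivable h x (delta_mx 0 i).
    apply/derivable_mxP => a j; rewrite ord1.
    by have [_ /(_ i) [+ _]] := Ch j; apply.
  have C1 : Ck 1 V f.
    have [c d] := Cf; split=> // j; have [dj Dj] := d j; split=> //.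
    by split=> // y Vy; apply: Ck_continuous Dj Vy.
  have [df Df] := Ck1_differentiable oV C1 (UV _ Ux).
  have := is_derive_diff_comp dh df; rewrite Df derive_mx //.
  by under eq_bigr do rewrite mxE.
split=> [x /H []//|].
have C : Ck k U (fun x =>
   \sum_j 'D_(delta_mx 0 i) (fun y => h y 0 j) x * 'D_(delta_mx 0 j) f (h x)).
  apply: Ck_sum => // j; apply: CkM => //.
    by have [_ /(_ i) []] := Ch j.
  apply: (IH ('D_(delta_mx 0 j) f)) => [|j']; last exact: CkW.
  by have [_ /(_ j) []] := Cf.
by apply: (Ck_ext oU _ C) => x /H [_ ->].
Qed.

(** * Smooth functions that vanish on a half-line *)

Section Flat.
Variable R : realType.
Implicit Types (p : {poly R}) (t : R).

(** The derivative of [p(1/t) exp(-1/t)] is [q(1/t) exp(-1/t)] with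
    [q = X^2 (p - p')], so this family, unlike the single function [exp(-1/t)],
    is closed under differentiation. *)
Definition flat p t : R := if 0 < t then p.[t^-1] * expR (- t^-1) else 0.

(** With [x = 1/t], compare [x^i exp(-x)] with the term of degree [i + 1] of the
    exponential series. *)
Lemma flat_bound p : exists C : R, forall t, 0 < t -> `|flat p t| <= C * t.
Proof.
exists (\sum_(i < size p) `|p`_i| * i.+1`!%:R) => t t0.
rewrite /flat t0 horner_coef mulr_suml mulr_suml.
apply: le_trans (ler_norm_sum _ _ _) _; apply: ler_sum => i _.
rewrite -!mulrA normrM ler_wpM2l //.
have x0 : 0 <= t^-1 by rewrite invr_ge0 ltW.
rewrite ger0_norm ?mulr_ge0 ?exprn_ge0 ?expR_ge0 // expRN.
rewrite ler_pdivrMr ?expR_gt0 //.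
have f0 : 0 < i.+1`!%:R :> R by rewrite ltr0n fact_gt0.
have := expR_ge1Dxn i x0; move/(le_trans (ler_wpDl ler01 (lexx _))).
rewrite ler_pdivrMr // exprS => H.
rewrite -(ler_pM2l (_ : 0 < t^-1)) ?invr_gt0 // (le_trans H) //.
by rewrite [leRHS](_ : _ = expR t^-1 * i.+1`!%:R) //; field; rewrite gt_eqF.
Qed.

(** At the origin the difference quotient of [flat p] is [flat ('X * p)], which
    tends to [0] by [flat_bound]. *)
Lemma flat_derive p t : is_derive t 1 (flat p) (flat ('X^2 * (p - p^`())) t).
Proof.
have [t0|t0|->] := ltgtP t 0.
- have E : {near t, cst 0 =1 flat p}.
    near=> s; rewrite /flat /cst; case: ifPn => // s0.
    have : s < 0 by near: s; apply: lt_nbhsl.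
    by move/lt_trans => /(_ _ s0); rewrite ltxx.
  have -> : flat ('X^2 * (p - p^`())) t = 0 by rewrite /flat ltNge (ltW t0).
  exact: (near_eq_is_derive E).
- pose F s : R := (horner p \o GRing.inv) s * (expR \o (fun s => - s^-1)) s.
  have E : {near t, F =1 flat p}.
    near=> s; rewrite /flat /F ifT //; near: s; exact: lt_nbhsr.
  have tn0 : t != 0 by rewrite gt_eqF.
  apply: (near_eq_is_derive E).
  have dI : is_derive t 1 GRing.inv (- (t ^- 2)).
    have di : derivable (id : R -> R) t 1 by exact: derivable_id.
    apply: DeriveDef; first exact: (@derivableV R R id t 1 tn0 di).
    have := @deriveV R R id t 1 tn0 di.
    by rewrite derive_id => ->; rewrite [LHS]mulr1.
  have dp : is_derive (t^-1) 1 (horner p) (p^`()).[t^-1].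
    apply: DeriveDef; first exact: derivable_horner.
    by rewrite -derive1E -derivE.
  have d1 := is_derive1_comp (f := horner p) (g := GRing.inv) dp dI.
  have d2 := is_derive1_comp (f := expR) (g := fun s => - s^-1)
    (is_derive_expR _) (is_deriveN dI).
  have [dM DM] := is_deriveM d1 d2.
  apply: DeriveDef; first exact: dM.
  rewrite [LHS]DM /flat t0 /GRing.scale /= !hornerE /=.
  by field.
rewrite /flat ltxx.
have H : h^-1 *: (flat p (h *: 1 + 0) - flat p 0) @[h --> (0 : R)^'] --> (0 : R).
  have [C HC] := flat_bound ('X * p).
  apply/cvgr0Pnorm_le => e e0; near=> h.
  have h0 : h != 0 by near: h; exact: nbhs_dnbhs_neq.
  rewrite {2}/flat ltxx subr0 addr0 [h *: 1]mulr1.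
  have [hp|hn] := ltP 0 h; last first.
    by rewrite /flat ltNge hn /= scaler0 normr0 ltW.
  have -> : h^-1 *: flat p h = flat ('X * p) h.
    by rewrite /flat hp !hornerE [LHS]mulrA.
  apply: le_trans (HC _ hp) _.
  have : `|h| < e / (`|C| + 1).
    by near: h; apply: dnbhs0_lt; rewrite divr_gt0 // ltr_wpDl.
  rewrite gtr0_norm // ltr_pdivlMr ?ltr_wpDl // => /ltW; apply: le_trans.
  by rewrite mulrC ler_wpM2l ?(ltW hp) // (le_trans (ler_norm _)) // lerDl.
apply: DeriveDef; last by apply/cvg_lim.
by apply/cvg_ex; exists 0.
Unshelve. all: by end_near. Qed.

Lemma flat_ge0 t : 0 <= flat 1 t.
Proof. by rewrite /flat; case: ifP => // _; rewrite hornerC mul1r expR_ge0. Qed.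

Lemma flat_gt0 t : (0 < flat 1 t) = (0 < t).
Proof. by rewrite /flat; case: ifP; rewrite ?ltxx // hornerC mul1r expR_gt0. Qed.

Lemma Ck_flat n k (U : set 'rV[R]_n) (h : 'rV[R]_n -> R) p :
  open U -> Ck k U h -> Ck k U (flat p \o h).
Proof.
move=> oU.
have cc k' q x : Ck k' U h -> U x -> {for x, continuous (flat q \o h)}.
  move=> Ch Ux; apply: continuous_comp; first exact: Ck_continuous Ch Ux.
  apply: differentiable_continuous; apply/derivable1_diffP.
  by have [] := flat_derive q (h x).
elim: k p => [|k IH] p Ch; split=> //; try by move=> x; apply: cc Ch.
move=> i.
have H x : U x -> is_derive x (delta_mx 0 i) (flat p \o h)
    (flat ('X^2 * (p - p^`())) (h x) * 'D_(delta_mx 0 i) h x).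
  move=> Ux; have [_ /(_ i) [/(_ x Ux) dh _]] := Ch.
  have [df Df] := flat_derive p (h x).
  have df' : differentiable (flat p) (h x) by apply/derivable1_diffP.
  have := is_derive_diff_comp dh df'.
  have -> : 'd (flat p) (h x) ('D_(delta_mx 0 i) h x) =
      flat ('X^2 * (p - p^`())) (h x) * 'D_(delta_mx 0 i) h x; last by [].
  rewrite (deriv1E df) derive1E Df; exact: mulrC.
split=> [x /H []//|].
have C := CkM oU (IH ('X^2 * (p - p^`())) (CkW Ch)) ((Ch.2 i).2).
by apply: (Ck_ext oU _ C) => x /H [_ ->].
Qed.

End Flat.

(** * Hadamard's lemma *)

Section RayIntegral.
Variables (R : realType) (n : nat) (x0 : 'rV[R]_n) (r : R).
Local Notation B := (ball x0 r).
Local Notation mu := (@lebesgue_measure R).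
Local Notation I01 := (`[(0:R), 1]%classic).
Implicit Types (F : 'rV[R]_n -> R) (y : 'rV[R]_n) (t : R).

Definition ray y t : 'rV[R]_n := x0 + t *: (y - x0).

Lemma ray_ball y t : B y -> I01 t -> B (ray y t).
Proof.
rewrite /= in_itv /= => + /andP[t0 t1].
rewrite -ball_normE /= /ray opprD addrA subrr add0r normrN normrZ distrC ger0_norm //.
by apply: le_lt_trans; rewrite ler_piMl.
Qed.

Lemma ray_continuous (t : R) y :
  ray z.2 z.1 @[z --> (nbhs t, nbhs y)] --> ray y t.
Proof.
apply: cvgD; first exact: cvg_cst.
apply: cvgZ; first exact: cvg_fst.
by apply: cvgB; [exact: cvg_snd|exact: cvg_cst].
Qed.

Lemma ray_continuousl y (t : R) : {for t, continuous (ray y)}.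
Proof.
apply: cvgD; first exact: cvg_cst.
by apply: cvgZr_tmp; exact: cvg_id.
Qed.

(** Compactness of the unit interval upgrades continuity of [F] along the rays
    to uniformity in the parameter of the ray; this provides both the limit and
    the domination needed under the integral sign. *)
Lemma ray_unif F y e : (forall z, B z -> {for z, continuous F}) -> B y -> 0 < e ->
  \forall y' \near y, I01 `<=` [set t | `|F (ray y t) - F (ray y' t)| < e].
Proof.
move=> cF By e0.
have C := (compact_near_coveringP _).1 (@segment_compact R 0 1).
apply: (C _ (nbhs y) (fun y' t => `|F (ray y t) - F (ray y' t)| < e) _) => t It.
have cFt : F z @[z --> ray y t] --> F (ray y t) := cF _ (ray_ball By It).
have e2 : 0 < e / 2 by rewrite divr_gt0.
have c1 : F (ray z.2 z.1) @[z --> (nbhs t, nbhs y)] --> F (ray y t).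
  exact: (cvg_comp _ _ (@ray_continuous t y) cFt).
have c2 : F (ray y z.1) @[z --> (nbhs t, nbhs y)] --> F (ray y t).
  apply: (cvg_comp _ _ _ cFt).
  have cl : ray y s @[s --> t] --> ray y t := @ray_continuousl y t.
  exact: (cvg_comp (fun z : R * 'rV[R]_n => z.1) _ cvg_fst cl).
move/cvgrPdist_lt : c1 => /(_ _ e2) c1.
move/cvgrPdist_lt : c2 => /(_ _ e2) c2.
move: c1 c2; apply: filterS2 => -[s z] /= h1 h2.
rewrite -(subrKA (F (ray y t))) (le_lt_trans (ler_normD _ _)) //.
by rewrite (splitr e) ltrD // distrC.
Qed.

Lemma ray_integrable F y m : (forall z, B z -> {for z, continuous F}) -> B y ->
  mu.-integrable I01 (EFin \o (fun t => t ^+ m * F (ray y t))).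
Proof.
move=> cF By; apply: (@continuous_compact_integrable R); first exact: segment_compact.
apply: continuous_in_subspaceT => t /set_mem It.
apply: cvgM; first exact: exprn_continuous.
exact: (cvg_comp _ _ (@ray_continuousl y t) (cF _ (ray_ball By It))).
Qed.

(** The weight [t^m] is there because each derivative in [y] brings out a factor
    [t]: with it, the family is stable under partial derivatives. *)
Definition rayint m F y : R := \int[mu]_(t in I01) (t ^+ m * F (ray y t)).

Lemma mI01 : @measurable _ (measurableTypeR R) I01.
Proof. exact: measurable_itv. Qed.

Lemma mu01 : fine (mu I01) = 1.
Proof. by rewrite lebesgue_measure_itv /= lte01 oppr0 addr0. Qed.

Lemma rayint_continuous m F y : (forall z, B z -> {for z, continuous F}) -> B y ->
  {for y, continuous (rayint m F)}.
Proof.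
move=> cF By; apply/(@cvgrPdist_le _ _ _ _ (nbhs_filter y)) => e e0.
have oB : nbhs y B by apply: open_nbhs_nbhs; split=> //; exact: ball_open.
have U := ray_unif cF By e0.
apply: (filterS _ (filterI oB U)) => y' [By' Uy'].
have i1 := ray_integrable m cF By.
have i2 := ray_integrable m cF By'.
have iB : mu.-integrable I01
    (EFin \o (fun t => t ^+ m * F (ray y t) - t ^+ m * F (ray y' t))).
  have /(eq_integrable mI01) := integrableB mI01 i1 i2.
  by apply => t _.
have iN : mu.-integrable I01
    (EFin \o (fun t => `|t ^+ m * F (ray y t) - t ^+ m * F (ray y' t)|)).
  by have /(eq_integrable mI01) := integrable_norm iB; apply => t _.
rewrite /rayint -RintegralB //.
apply: le_trans (le_normr_Rintegral mI01 iB) _.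
have -> : e = \int[mu]_(_ in I01) e by rewrite Rintegral_cst // mu01 mulr1.

apply: le_Rintegral; first exact: mI01.
- exact: iN.
- apply: (@continuous_compact_integrable R (cst e)); first exact: segment_compact.
  by apply: continuous_subspaceT => ?; exact: cvg_cst.
move=> t It; rewrite -mulrBr normrM.
have := Uy' _ It => /= /ltW; apply: le_trans.
rewrite ler_piMl // normrX exprn_ile1 //; move: It; rewrite /= in_itv /= => /andP[t0 t1];
  by rewrite ?ger0_norm.
Qed.

Lemma rayint_derive m F y j : Ck 1 B F -> B y ->
  is_derive y (delta_mx 0 j) (rayint m F)
    (rayint m.+1 ('D_(delta_mx 0 j) F) y).
Proof.
move=> CF By; set e := delta_mx 0 j.
have oB : open B by exact: ball_open.
have [cF /(_ j) [dF [cdF _]]] := CF; rewrite -/e in dF cdF.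
have nB : nbhs y B by apply: open_nbhs_nbhs.
have Q : \forall s \near (0 : R), B (s *: e + y) /\
    I01 `<=` [set t | `|'D_e F (ray y t) - 'D_e F (ray (s *: e + y) t)| < 1].
  have cs : s *: e + y @[s --> (0 : R)] --> y.
    have : s *: e + y @[s --> (0 : R)] --> 0 *: e + y.
      by apply: cvgD; [apply: cvgZr_tmp; exact: cvg_id|exact: cvg_cst].
    by rewrite scale0r add0r.
  have H1 := cs _ (ray_unif cdF By ltr01).
  have H2 := cs _ nB.
  exact: (filterI H2 H1).
have [d /= d0 Hd] := (nbhs_ballP _ _).1 Q.
pose f (s t : R) : R := t ^+ m * F (ray (s *: e + y) t).
have Hs s : `]-d, d[%classic s -> B (s *: e + y) /\
    I01 `<=` [set t | `|'D_e F (ray y t) - 'D_e F (ray (s *: e + y) t)| < 1].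
  move=> /=; rewrite in_itv /= => sd; apply: Hd.
  by rewrite -ball_normE /= sub0r normrN ltr_norml.
have I0 : `]-d, d[%classic (0 : R) by rewrite /= in_itv /= oppr_lt0 d0.
have rE s t : ray (s *: e + y) t = ray y t + (s * t) *: e.
  by rewrite /ray -!addrA scalerDr scalerA mulrC [X in x0 + X]addrC.
have der s t : `]-d, d[%classic s -> I01 t ->
    is_derive s 1 (f^~ t) (t ^+ m.+1 * 'D_e F (ray (s *: e + y) t)).
  move=> /Hs [Bs _] It.
  have dFs : derivable F (ray y t + (s * t) *: e) e by rewrite -rE; apply: dF; exact: ray_ball.
  have [D1 D2] := is_derive_lineM dFs.
  have fE : f^~ t = (t ^+ m) *: (fun s => F (ray y t + (s * t) *: e)).
    by apply/funext => s'; rewrite /f rE.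
  rewrite fE; apply: DeriveDef; first exact: derivableZ.
  rewrite deriveZ // D2 /GRing.scale /= rE mulrA; congr (_ * _).
  by rewrite exprSr.
have dcF : forall z, B z -> {for z, continuous ('D_e F)} by [].
have [M HM] : exists M, forall t, I01 t -> `|'D_e F (ray y t)| <= M.
  have : compact ((fun t => 'D_e F (ray y t)) @` I01).
    apply: continuous_compact; last exact: segment_compact.
    apply: continuous_in_subspaceT => t /set_mem It.
    exact: (cvg_comp _ _ (@ray_continuousl y t) (cdF _ (ray_ball By It))).
  move=> /compact_bounded [M [_ HM]]; exists (M + 1) => t It.
  by apply: (HM (M + 1)); rewrite ?ltrDl //; exists t.
have M0 : 0 <= M + 1.
  rewrite addr_ge0 // (le_trans _ (HM 0 _)) //.
  by rewrite /= in_itv /= lexx ler01.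
have P1 : forall s, `]-d, d[%classic s -> mu.-integrable I01 (EFin \o f s).
  by move=> s /Hs [Bs _]; exact: ray_integrable.
have P2 : forall s t, `]-d, d[%classic s -> I01 t -> derivable (f^~ t) s 1.
  by move=> s t Is It; have [] := der _ _ Is It.
have P3 : mu.-integrable I01 (EFin \o (cst (M + 1))).
  apply: (@continuous_compact_integrable R (cst (M + 1))); first exact: segment_compact.
  by apply: continuous_subspaceT => ?; exact: cvg_cst.
have P4 : forall s t, `]-d, d[%classic s -> I01 t -> `|partial1of2 f s t| <= cst (M + 1) t.
  move=> s t Is It; rewrite partial1of2E; have [_ ->] := der _ _ Is It.
  rewrite normrM; have [_ /(_ t It) /= H] := Hs _ Is.
  have H' : `|'D_e F (ray (s *: e + y) t)| <= M + 1.
    rewrite -(subKr ('D_e F (ray y t)) ('D_e F _)) (le_trans (ler_normB _ _)) //.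
    by rewrite lerD ?HM // ltW.
  apply: le_trans H'; rewrite ler_piMl // normrX exprn_ile1 //;
    move: It; rewrite /= in_itv /= => /andP[t0 t1]; by rewrite ?ger0_norm.
have D1 := @derivable_under_integral R _ _ mu f I01 mI01 0 (-d) d I0 P1 P2 (cst (M+1)) (fun=> M0) P3 P4.
have D2 := @differentiation_under_integral R _ _ mu f I01 mI01 0 (-d) d I0 P1 P2 (cst (M+1)) (fun=> M0) P3 P4.
apply: DeriveDef; first by apply/derivable1P; exact: D1.
rewrite -(derive_line0 (rayint m F)) -derive1E [LHS]D2.
apply: eq_Rintegral => t /set_mem It.
by rewrite partial1of2E; have [_ ->] := der _ _ I0 It; rewrite scale0r add0r.
Qed.

Lemma rayint_Ck k m F : (forall k, Ck k B F) -> Ck k B (rayint m F).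
Proof.
have oB : open B by exact: ball_open.
elim: k m F => [|k IH] m F CF; split=> //; try by
  move=> y By; apply: rayint_continuous => // z Bz; apply: Ck_continuous (CF 0%N) Bz.
move=> i; have H y := @rayint_derive m F y i (CF 1%N).
split=> [y /H []//|].
have C : Ck k B (rayint m.+1 ('D_(delta_mx 0 i) F)).
  by apply: IH => k'; have [_ /(_ i) []] := CF k'.+1.
by apply: (Ck_ext oB _ C) => y /H [_ ->].
Qed.

Lemma rayint_sum y (c : 'I_n -> R) (F : 'I_n -> 'rV[R]_n -> R) :
  (forall i z, B z -> {for z, continuous (F i)}) -> B y ->
  \int[mu]_(t in I01) (\sum_i c i * F i (ray y t)) = \sum_i c i * rayint 0 (F i) y.
Proof.
move=> cF By.
have iF i : mu.-integrable I01 (EFin \o (fun t => F i (ray y t))).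
  have /(eq_integrable mI01) := ray_integrable 0 (cF i) By.
  by apply => t _ /=; rewrite mul1r.
have iZ i : mu.-integrable I01 (EFin \o (fun t => c i * F i (ray y t))).
  by have /(eq_integrable mI01) := integrableZl mI01 (c i) (iF i); apply => t _.
have E : forall s : seq 'I_n,
   mu.-integrable I01 (EFin \o (fun t => \sum_(i <- s) c i * F i (ray y t))) /\
   \int[mu]_(t in I01) (\sum_(i <- s) c i * F i (ray y t)) =
   \sum_(i <- s) c i * rayint 0 (F i) y.
  elim=> [|i s [IH1 IH2]].
    have E0 : (fun t => \sum_(i <- [::]) c i * F i (ray y t)) = cst 0.
      by apply/funext => t; rewrite big_nil.
    rewrite E0 big_nil; split; last by rewrite Rintegral_cst ?mul0r //; exact: mI01.
    apply: (@continuous_compact_integrable R (cst 0)); first exact: segment_compact.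
    by apply: continuous_subspaceT => ?; exact: cvg_cst.
  have ES : (fun t => \sum_(j <- i :: s) c j * F j (ray y t)) =
     (fun t => c i * F i (ray y t) + \sum_(j <- s) c j * F j (ray y t)).
    by apply/funext => t; rewrite big_cons.
  rewrite ES big_cons; split.
    by have /(eq_integrable mI01) := integrableD mI01 (iZ i) IH1; apply => t _.
  rewrite RintegralD ?IH2 //.
  rewrite RintegralZl //.
  congr (_ * _ + _); apply: eq_Rintegral => t _; by rewrite mul1r.
by have [_ ->] := E (index_enum _).
Qed.

(** Integrate the derivative of [t |-> f (x0 + t (y - x0))] from [0] to [1]; the
    coefficients of [y - x0] are [rayint 0] of the partial derivatives of [f]. *)
Theorem hadamard (f : 'rV[R]_n -> R) : 0 < r -> Cinfty B f ->
  exists g : 'I_n -> 'rV[R]_n -> R,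
  [/\ forall i, Cinfty B (g i),
      forall i, g i x0 = 'D_(delta_mx 0 i) f x0 &
      forall y, B y -> f y = f x0 + \sum_i (y - x0) 0 i * g i y].
Proof.
move=> r0 Cf; have oB : open B by exact: ball_open.
have Bx0 : B x0 by exact: ballxx.
have CD i k : Ck k B ('D_(delta_mx 0 i) f) by have [_ /(_ i) []] := Cf k.+1.
exists (fun i => rayint 0 ('D_(delta_mx 0 i) f)); split.
- by move=> i k; apply: rayint_Ck.
- move=> i; rewrite /rayint.
  transitivity (\int[mu]_(t in I01) ('D_(delta_mx 0 i) f x0)).
    by apply: eq_Rintegral => t _; rewrite mul1r /ray subrr scaler0 addr0.
  by rewrite Rintegral_cst ?mu01 ?mulr1 //; exact: mI01.
move=> y By.
have cD i z : B z -> {for z, continuous ('D_(delta_mx 0 i) f)}.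
  by move=> Bz; apply: Ck_continuous (CD i 0%N) Bz.
rewrite -rayint_sum //.
pose phi' t := \sum_i (y - x0) 0 i * 'D_(delta_mx 0 i) f (ray y t).
have dphi t : I01 t -> is_derive t 1 (f \o ray y) (phi' t).
  move=> It; have [df Df] := Ck1_differentiable oB (Cf 1%N) (ray_ball By It).
  have dr : is_derive t 1 (ray y) (y - x0).
    have d1 : differentiable (fun t : R => t *: (y - x0)) t by exact: differentiableZl.
    apply: DeriveDef.
      by apply: derivableD; [exact: derivable_cst|exact: diff_derivable].
    rewrite deriveD ?derive_cst ?add0r //; last exact: diff_derivable.
    by rewrite deriveE // diffZl // diff_val scale1r.
  have [dr1 dr2] := dr.
  by have := is_derive_diff_comp dr1 df; rewrite Df dr2.
have cphi' : {within I01, continuous phi'}.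
  apply: continuous_in_subspaceT => t /set_mem It.
  have : {for t, continuous (\sum_(i < n) (fun t => (y - x0) 0 i * 'D_(delta_mx 0 i) f (ray y t)))}.
    elim/big_ind : _ => [|g h cg ch|i _].
    - exact: cvg_cst.
    - exact: continuousD.
    - apply: cvgM; first exact: cvg_cst.
      exact: (cvg_comp _ _ (@ray_continuousl y t) (cD i _ (ray_ball By It))).
  by congr (continuous_at _ _); apply/funext => s; rewrite fct_sumE.
have cphi t : I01 t -> {for t, continuous (f \o ray y)}.
  move=> /dphi [d _]; apply: differentiable_continuous.
  exact/derivable1_diffP.
have I0 : I01 0 by rewrite /= in_itv /= lexx ler01.
have I1 : I01 1 by rewrite /= in_itv /= lexx ler01.
have LR : derivable_oo_LRcontinuous (f \o ray y) 0 1.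
  split.
  - move=> t; rewrite in_itv /= => /andP[t0 t1].
    by have [] : is_derive t 1 (f \o ray y) (phi' t) by apply: dphi; rewrite /= in_itv /= !ltW.
  - exact: (cvg_at_right_filter (cphi 0 I0)).
  - exact: (cvg_at_left_filter (cphi 1 I1)).
have E' : {in `]0, 1[, ((f \o ray y)^`())%classic =1 phi'}.
  move=> t; rewrite in_itv /= => /andP[t0 t1].
  by rewrite derive1E; have [_ ->] : is_derive t 1 (f \o ray y) (phi' t) by apply: dphi; rewrite /= in_itv /= !ltW.
have := continuous_FTC2 ltr01 cphi' LR E'.
rewrite /Rintegral -/phi' => ->; rewrite -EFinB /= /ray scale1r scale0r addr0.
by rewrite subrKC addrC subrK.
Qed.

End RayIntegral.

(** * Gluing and bump functions on a manifold *)

Section SmoothOn.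
Variables (R : realType) (n : nat) (M : manifold R n).
Implicit Types (U V : set M) (f g : M -> R) (c d : chart M) (p q : M).

Lemma smooth_on_local U f :
  (forall p, U p -> exists V, V p /\ smooth_on V f) -> smooth_on U f.
Proof.
move=> H c; apply: Cinfty_local => _ [p [cp Up] <-].
have [V [Vp sf]] := H p Up.
by exists (cmap c @` (cdom c `&` V)); split; [exists p|exact: sf].
Qed.

Lemma smooth_on_near U f :
  (forall p, U p -> exists V, [/\ open V, V p &
     exists2 g, smooth_on V g & forall q, V q -> g q = f q]) -> smooth_on U f.
Proof.
move=> H; apply: smooth_on_local => p /H [V [oV Vp [g sg gf]]].
by exists V; split=> //; apply: smooth_on_ext sg.
Qed.

Lemma open_chart_preimage c (W : set 'rV[R]_n) :
  open W -> open (cdom c `&` cmap c @^-1` W).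
Proof.
move=> oW; rewrite openE => p [cp Wp]; rewrite /interior.
have n1 : nbhs p (cdom c) by apply: open_nbhs_nbhs; split=> //; exact: cdom_open.
have n2 : nbhs (cmap c p) W by apply: open_nbhs_nbhs.
exact: (filterI n1 (cmap_continuous cp n2)).
Qed.

(** Smoothness of the transition maps, with the chain rule, makes a function that
    is smooth in one chart smooth in all of them. *)
Lemma smooth_on_pullback c (W : set 'rV[R]_n) (g : 'rV[R]_n -> R) :
  open W -> Cinfty W g -> smooth_on (cdom c `&` cmap c @^-1` W) (g \o cmap c).
Proof.
move=> oW Cg d k; have oU := @cimageI_open _ _ M d _ (open_chart_preimage c oW).
apply: (@Ck_comp _ _ _ k _ W g (fun y => cmap c (cinv d y))) => //.
  by move=> _ [p [dp [cp Wp]] <-]; rewrite cmapK.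
move=> j; apply: CkS (@transition_smooth _ _ M d c j k).
by apply: image_subset => p [dp [cp _]].
Qed.

Lemma smooth_on_chart c (f : M -> R) : smooth_on (cdom c) f ->
  Cinfty (cmap c @` cdom c) (f \o cinv c).
Proof. by move=> /(_ c); rewrite setIid. Qed.

Lemma smooth_on_continuous U f p : open U -> smooth_on U f -> U p -> {for p, continuous f}.
Proof.
move=> oU sf Up; have [c cp] := cdom_cover p.
have oI : nbhs p (cdom c `&` U).
  by apply: open_nbhs_nbhs; split=> //; apply: openI => //; exact: cdom_open.
have cf : {for p, continuous ((f \o cinv c) \o cmap c)}.
  apply: continuous_comp; first exact: cmap_continuous.
  by apply: (Ck_continuous (sf c 0%N)); exists p.
have E : {near p, (f \o cinv c) \o cmap c =1 f}.
  by move: oI; apply: filterS => q [cq Uq] /=; rewrite cmapK.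
rewrite /prop_for /continuous_at in cf *.
rewrite -[f p](nbhs_singleton E).
apply: cvg_trans cf; exact: (near_eq_cvg E).
Qed.

Lemma cinf_continuous (f : cinf M) : continuous f.
Proof. by move=> p; apply: (smooth_on_continuous openT (cinfP f)). Qed.

Lemma cinf_open (f : cinf M) (A : set R) : open A -> open (f @^-1` A).
Proof. by move=> oA; apply: open_comp => // p _; exact: cinf_continuous. Qed.

Lemma cinf_neq0_open (f : cinf M) : open [set q | f q != 0].
Proof. exact: (cinf_open f (@open_neq R 0)). Qed.

Lemma smooth_onV U f : open U -> (forall p, U p -> f p != 0) ->
  smooth_on U f -> smooth_on U (fun p => (f p)^-1).
Proof.
move=> oU f0 sf c k; apply: (CkV (@cimageI_open _ _ M c _ oU) _ (sf c k)).
by move=> _ [p [cp Up] <-] /=; rewrite cmapK // f0.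
Qed.

Lemma smooth_on_flat U f P : open U -> smooth_on U f -> smooth_on U (flat P \o f).
Proof. by move=> oU sf c k; apply: (Ck_flat P (@cimageI_open _ _ M c _ oU) (sf c k)). Qed.

Lemma smooth_on_sum U (I : Type) (r : seq I) (P : pred I) (F : I -> M -> R) : open U ->
  (forall i, P i -> smooth_on U (F i)) -> smooth_on U (fun p => \sum_(i <- r | P i) F i p).
Proof.
move=> oU sF; have -> : (fun p => \sum_(i <- r | P i) F i p) = \sum_(i <- r | P i) F i.
  by apply/funext => p; rewrite fct_sumE.
elim/big_ind : _ => //; first exact: (smooth_on_cst 0 oU).
by move=> f g; exact: smooth_onD.
Qed.

Lemma smooth_on_prod U (I : Type) (r : seq I) (P : pred I) (F : I -> M -> R) : open U ->
  (forall i, P i -> smooth_on U (F i)) -> smooth_on U (fun p => \prod_(i <- r | P i) F i p).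
Proof.
move=> oU sF; elim: r => [|i r IH].
  have -> : (fun p => \prod_(i <- [::] | P i) F i p) = cst 1.
    by apply/funext => p; rewrite big_nil.
  exact: smooth_on_cst.
have [Pi|Pi] := boolP (P i).
  have -> : (fun p => \prod_(j <- i :: r | P j) F j p) =
     F i * (fun p => \prod_(j <- r | P j) F j p).
    by apply/funext => p; rewrite big_cons Pi.
  exact: smooth_onM (sF _ Pi) IH.
have -> // : (fun p => \prod_(j <- i :: r | P j) F j p) =
     (fun p => \prod_(j <- r | P j) F j p).
by apply/funext => p; rewrite big_cons (negbTE Pi).
Qed.

Lemma smooth_onN U f : open U -> smooth_on U f -> smooth_on U (fun p => - f p).
Proof.
move=> oU sf; have -> : (fun p => - f p) = cst (-1) * f.
  by apply/funext => p; rewrite !fctE /cst mulN1r.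
by apply: smooth_onM => //; exact: smooth_on_cst.
Qed.

Lemma smooth_onB U f g : open U -> smooth_on U f -> smooth_on U g ->
  smooth_on U (fun p => f p - g p).
Proof.
move=> oU sf sg; exact: (smooth_onD oU sf (smooth_onN oU sg)).
Qed.

(** Extension by zero: [U] and the complement of [K] cover the manifold. *)
Lemma smooth_off_closed (U K : set M) f : open U -> closed K -> K `<=` U ->
  (forall p, ~ K p -> f p = 0) -> smooth_on U f -> smooth_on setT f.
Proof.
move=> oU cK KU f0 sf; apply: smooth_on_near => p _.
have [Kp|nKp] := pselect (K p).
  by exists U; split=> //; [exact: KU|exists f].
exists (~` K); split=> //; first exact: closed_openC.
exists (cst 0) => [|q /f0 -> //]; apply: smooth_on_cst; exact: closed_openC.
Qed.

End SmoothOn.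

Section Bump.
Variables (R : realType) (n : nat) (M : manifold R n).
Implicit Types (U V : set M) (f g : cinf M) (p q : M).

(** A product of one-variable bumps in a chart, supported in a closed box.  The
    box is compact and the manifold Hausdorff, so its image [K] is closed, which
    is what allows the extension by zero. *)
Lemma box_bump p U : open U -> U p -> exists h : cinf M, exists K,
  [/\ closed K, K `<=` U, forall q, ~ K q -> h q = 0, forall q, 0 <= h q & 0 < h p].
Proof.
move=> oU Up; have [c cp] := cdom_cover p.
pose y0 := cmap c p; have oW := @cimageI_open _ _ M c _ oU.
have Wy0 : (cmap c @` (cdom c `&` U)) y0 by exists p.
have /nbhs_ballP [e /= e0 eW] : nbhs y0 (cmap c @` (cdom c `&` U)) by apply: open_nbhs_nbhs.
pose r := e / 2; have r0 : 0 < r by rewrite divr_gt0.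
pose C : set 'rV[R]_n := [set y | forall i, `[y0 0 i - r, y0 0 i + r]%classic (y 0 i)].
have cC : compact C.
  by apply: (@rV_compact _ _ (fun i => `[y0 0 i - r, y0 0 i + r]%classic)) => i; exact: segment_compact.
have CW : C `<=` cmap c @` (cdom c `&` U).
  move=> y Cy; apply: eW; rewrite -ball_normE /=.
  rewrite [ltLHS]/Num.Def.normr/= mx_normrE; apply/bigmax_ltP; split=> // -[a i] _ /=.
  rewrite !mxE ord1; have := Cy i; rewrite /= in_itv /= => /andP[h1 h2].
  rewrite (@le_lt_trans _ _ r) //; first by rewrite ler_norml; lra.
  by rewrite /r; lra.
pose K := cinv c @` C.
have cK : closed K.
  apply: (compact_closed (@manifold_hausdorff _ _ M)).
  apply: continuous_compact => //; apply: continuous_in_subspaceT => y /set_mem /CW [q [cq _] <-].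
  by apply: cinv_continuous; exists q.
have KU : K `<=` cdom c `&` U.
  by move=> _ [y /CW [q [cq Uq] <-] <-]; rewrite cmapK.
pose b (y : 'rV[R]_n) : R := \prod_i flat 1 (r ^+ 2 - (y 0 i - y0 0 i) ^+ 2).
have sb : smooth_on (cdom c) (b \o cmap c).
  apply: smooth_on_prod; first exact: cdom_open.
  move=> i _; apply: (@smooth_on_flat _ _ _ _ (fun q => r ^+ 2 - (cmap c q 0 i - y0 0 i) ^+ 2)).
    exact: cdom_open.
  have oc := @cdom_open _ _ M c.
  have sx : smooth_on (cdom c) (fun q => cmap c q 0 i - y0 0 i).
    apply: smooth_onB => //; last exact: smooth_on_cst.
    by move=> d k; exact: (@transition_smooth _ _ M d c i k).
  apply: smooth_onB => //; first exact: smooth_on_cst.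
  by have := smooth_onM oc sx sx; congr (smooth_on _ _); apply/funext => q; rewrite expr2.
pose h0 (q : M) : R := if q \in cdom c then b (cmap c q) else 0.
have h00 q : ~ K q -> h0 q = 0.
  move=> nK; rewrite /h0; case: ifPn => // /set_mem cq.
  apply: contrapT => bq; apply: nK; exists (cmap c q); last by rewrite cmapK.
  move=> i; rewrite /= in_itv /=.
  have : 0 < flat 1 (r ^+ 2 - (cmap c q 0 i - y0 0 i) ^+ 2).
    rewrite lt_neqAle flat_ge0 andbT eq_sym; apply/eqP => fi; apply: bq.
    by rewrite /b (bigD1 i) //= fi mul0r.
  rewrite flat_gt0 subr_gt0 => H.
  have : `|cmap c q 0 i - y0 0 i| < r.
    by rewrite -(ltr_pXn2r (n := 2)) ?nnegrE // ?(ltW r0) // real_normK ?num_real.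
  rewrite ltr_norml => /andP[h1 h2]; apply/andP; split; lra.
have sh0 : smooth_on setT h0.
  apply: (@smooth_off_closed _ _ _ (cdom c) K) => //; first exact: cdom_open.
    by move=> q /KU [].
  apply: (smooth_on_ext (cdom_open c) _ sb) => q cq /=.
  by rewrite /h0 mem_set.
exists (mkcinf sh0), K; split=> //.
- by move=> q /KU [].
- move=> q /=; rewrite /h0; case: ifP => // _; apply: prodr_ge0 => i _; exact: flat_ge0.
- rewrite /= /h0 mem_set //; apply: prodr_gt0 => i _.
  by rewrite flat_gt0 subrr expr0n /= subr0 exprn_gt0.
Qed.

(** The smooth step [N / (N + flat 1 (b - h0))] turns the bump [h0] of
    [box_bump], at the levels [a < b < h0 p], into a function equal to [1] near
    [p]. *)
Lemma plateau_bump p U : open U -> U p -> exists h : cinf M, exists K V,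
  [/\ closed K, K `<=` U & forall q, ~ K q -> h q = 0] /\
  [/\ open V, V p, V `<=` K, (forall q, V q -> h q = 1) & forall q, 0 <= h q].
Proof.
move=> oU Up; have [h0 [K [cK KU hK h0ge h0p]]] := box_bump oU Up.
pose a := h0 p / 3; pose b := 2 * h0 p / 3.
pose N q := flat 1 (h0 q - a); pose D q := N q + flat 1 (b - h0 q).
have D0 q : 0 < D q.
  rewrite /D /N; have [ha|ha] := ltP a (h0 q).
    by apply: ltr_wpDr; [exact: flat_ge0|rewrite flat_gt0; lra].
  apply: ltr_wpDl; first exact: flat_ge0.
  by rewrite flat_gt0; rewrite /a /b in ha *; lra.
have sN : smooth_on setT N.
  apply: (@smooth_on_flat _ _ _ _ (fun q => h0 q - a)); first exact: openT.
  by apply: smooth_onB; [exact: openT|exact: cinfP|exact/smooth_on_cst/openT].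
have sD : smooth_on setT D.
  apply: smooth_onD => //; first exact: openT.
  apply: (@smooth_on_flat _ _ _ _ (fun q => b - h0 q)); first exact: openT.
  by apply: smooth_onB; [exact: openT|exact/smooth_on_cst/openT|exact: cinfP].
have sV : smooth_on setT (fun q => (D q)^-1).
  by apply: smooth_onV => // [|q _]; [exact: openT|rewrite gt_eqF].
have sh := smooth_onM openT sN sV.
exists (mkcinf sh), K, [set q | b < h0 q]; split; split=> //.
- move=> q nK; rewrite /= !fctE /N (hK _ nK).
  by rewrite [flat _ _](_ : _ = 0) ?mul0r // /flat ifF //; apply/negbTE; rewrite -leNgt /a; lra.
- exact: (cinf_open h0 (@open_gt R b)).
- by rewrite /= /b; lra.
- move=> q /= bq; apply: contrapT => /hK h; move: bq; rewrite h /b; lra.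
- move=> q /= bq; rewrite !fctE /D [flat 1 (b - _)](_ : _ = 0) ?addr0.
    rewrite mulfV // gt_eqF // /N flat_gt0; rewrite /a /b in bq *; lra.
  by rewrite /flat ifF //; apply/negbTE; rewrite -leNgt; lra.
- by move=> q; rewrite /= !fctE mulr_ge0 ?invr_ge0 ?(ltW (D0 q)) //; exact: flat_ge0.
Qed.

Lemma smooth_extend p U (f : M -> R) : open U -> U p -> smooth_on U f ->
  exists g : cinf M, exists V, [/\ open V, V p, V `<=` U & forall q, V q -> g q = f q].
Proof.
move=> oU Up sf; have [h [K [V [[cK KU hK] [oV Vp VK h1 _]]]]] := plateau_bump oU Up.
have shf : smooth_on setT (fun q => h q * f q).
  apply: (smooth_off_closed oU cK KU); first by move=> q /hK ->; rewrite mul0r.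
  apply: smooth_onM => //; apply: smooth_onS (cinfP h) => //.
exists (mkcinf shf), V; split=> //; first by move=> q /VK /KU.
by move=> q Vq /=; rewrite h1 // mul1r.
Qed.

Lemma tangentD p (v : tangent p) f g : v (f + g) = v f + v g.
Proof. by have [l _] := tangentP v; rewrite -[f]scale1r l mul1r scale1r. Qed.
Lemma tangent0 p (v : tangent p) : v 0 = 0.
Proof. by apply: (addrI (v 0)); rewrite -tangentD !addr0. Qed.
Lemma tangentZ p (v : tangent p) (r : R) f : v (r *: f) = r * v f.
Proof. by have [l _] := tangentP v; rewrite -[r *: f]addr0 l tangent0 addr0. Qed.
Lemma tangentN p (v : tangent p) f : v (- f) = - v f.
Proof. by rewrite -scaleN1r tangentZ mulN1r. Qed.
Lemma tangentB p (v : tangent p) f g : v (f - g) = v f - v g.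
Proof. by rewrite tangentD tangentN. Qed.
Lemma tangentM p (v : tangent p) f g : v (f * g) = f p * v g + g p * v f.
Proof. by have [_ ->] := tangentP v. Qed.
Lemma tangent_sum p (v : tangent p) (I : Type) (s : seq I) (P : pred I) (F : I -> cinf M) :
  v (\sum_(i <- s | P i) F i) = \sum_(i <- s | P i) v (F i).
Proof. exact: (big_morph v (tangentD v) (tangent0 v)). Qed.

Lemma cinf_eq f g : (forall q, f q = g q) -> f = g.
Proof. by move=> fg; apply/val_inj/funext. Qed.

Lemma cinfD f g q : (f + g) q = f q + g q. Proof. by []. Qed.
Lemma cinfB f g q : (f - g) q = f q - g q. Proof. by []. Qed.
Lemma cinfN f q : (- f) q = - f q. Proof. by []. Qed.
Lemma cinfM f g q : (f * g) q = f q * g q. Proof. by []. Qed.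
Lemma cinfZ (r : R) f q : (r *: f) q = r * f q. Proof. by []. Qed.
Lemma cinf0 q : (0 : cinf M) q = 0. Proof. by []. Qed.
Lemma cinf1 q : (1 : cinf M) q = 1. Proof. by []. Qed.
Lemma cinf_sum (I : Type) (s : seq I) (P : pred I) (F : I -> cinf M) q :
  (\sum_(i <- s | P i) F i) q = \sum_(i <- s | P i) F i q.
Proof. exact: (big_morph (fun f : cinf M => f q) (fun f g => cinfD f g q) (cinf0 q)). Qed.

Lemma tangent_eq p (v w : tangent p) : (forall f, v f = w f) -> v = w.
Proof. by move=> vw; apply/val_inj/funext. Qed.

(** A derivation kills the product of [f - g] with a bump supported where
    [f = g]. *)
Lemma tangent_local p (v : tangent p) V f g : open V -> V p ->
  (forall q, V q -> f q = g q) -> v f = v g.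
Proof.
move=> oV Vp fg; have [h [K [W [[cK KV hK] [oW Wp WK h1 _]]]]] := plateau_bump oV Vp.
have E : h * (f - g) = 0.
  apply: cinf_eq => q; rewrite cinfM cinfB.
  have [Kq|/hK ->] := pselect (K q); last by rewrite mul0r.
  by rewrite fg ?subrr ?mulr0 //; exact: KV.
have := congr1 v E; rewrite tangentM tangent0 cinfB fg // subrr mul0r addr0 h1 // mul1r.
by rewrite tangentB => /eqP; rewrite subr_eq0 => /eqP.
Qed.

Lemma tangent_cst p (v : tangent p) (r : R) : v (ccst M r) = 0.
Proof.
have -> : ccst M r = r *: (1 : cinf M) by apply: cinf_eq => q; rewrite cinfZ cinf1 mulr1.
rewrite tangentZ; have := tangentM v (1 : cinf M) 1.
rewrite mulr1 cinf1 mul1r => /eqP; rewrite -subr_eq0 opprD addrA subrr add0r oppr_eq0.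
by move=> /eqP ->; rewrite mulr0.
Qed.

End Bump.

(** * Local frames of the tangent bundle *)

Section Coordinates.
Variables (R : realType) (n : nat) (M : manifold R n).
Implicit Types (f g : cinf M) (p q : M).

Lemma tangent_near p (v : tangent p) f g : (\forall q \near p, f q = g q) -> v f = v g.
Proof.
rewrite /prop_near1 nbhsE => -[V [oV Vp] fg]; exact: (tangent_local v oV Vp fg).
Qed.

Section Chart.
Variable c : chart M.
Local Notation W := (cmap c @` cdom c).
Let oW : open W. Proof. exact: cimage_open. Qed.

Lemma cinf_chart f : Cinfty W (f \o cinv c).
Proof. by apply: smooth_on_chart; apply: smooth_onS (cinfP f). Qed.

Lemma cinf_chart_partial f i : Cinfty W ('D_(delta_mx 0 i) (f \o cinv c)).
Proof. by move=> k; have [_ /(_ i) []] := cinf_chart f k.+1. Qed.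

Lemma partial_derivation q i : cdom c q ->
  derivation_at q (fun f => 'D_(delta_mx 0 i) (f \o cinv c) (cmap c q)).
Proof.
move=> cq; have Wq : W (cmap c q) by exists q.
have d f : derivable (f \o cinv c) (cmap c q) (delta_mx 0 i).
  by have [_ /(_ i) [+ _]] := cinf_chart f 1%N; apply.
split=> [r f g|f g].
  have -> : cinf_fun (r *: f + g) \o cinv c = r *: (f \o cinv c) + (g \o cinv c) by [].
  by rewrite deriveD ?deriveZ //; exact: derivableZ.
have -> : cinf_fun (f * g) \o cinv c = (f \o cinv c) * (g \o cinv c) by [].
by rewrite deriveM //= cmapK.
Qed.

(** Here the tangent vectors, defined as derivations, are seen to be determined by
    their values on coordinates: Hadamard's lemma writes [f] near [q] as [f q]
    plus the sum of [(x i - x i q) * h i], and the Leibniz rule does the rest. *)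
Lemma coord_formula q (x : 'I_n -> cinf M) (v : tangent q) f : cdom c q ->
  (\forall q' \near q, forall i, x i q' = cmap c q' 0 i) ->
  v f = \sum_i v (x i) * 'D_(delta_mx 0 i) (f \o cinv c) (cmap c q).
Proof.
move=> cq xE; have Wq : W (cmap c q) by exists q.
have /nbhs_ballP [e /= e0 eW] : nbhs (cmap c q) W by apply: open_nbhs_nbhs.
have CB : Cinfty (ball (cmap c q) e) (f \o cinv c).
  by move=> k; apply: CkS (cinf_chart f k).
have [g [Cg g0 gE]] := hadamard e0 CB.
have oB : open (ball (cmap c q) e) by exact: ball_open.
have oV := open_chart_preimage c oB.
have Vq : (cdom c `&` cmap c @^-1` ball (cmap c q) e) q.
  by split=> //; exact: ballxx.
have /choice [h hE] i : exists h : cinf M, \forall q' \near q, h q' = g i (cmap c q').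
  have [h [V [oV' V'q _ hE]]] := smooth_extend oV Vq (smooth_on_pullback c oB (Cg i)).
  by exists h; rewrite /prop_near1 nbhsE; exists V.
have E : v f = v (ccst M (f q) + \sum_i (x i - ccst M (x i q)) * h i).
  apply: tangent_near.
  have n1 : nbhs q (cdom c `&` cmap c @^-1` ball (cmap c q) e) by apply: open_nbhs_nbhs.
  have n2 : \forall q' \near q, forall i, h i q' = g i (cmap c q') by exact: filter_forall.
  apply: (filterS _ (filterI n1 (filterI n2 xE))) => q' [[cq' Bq'] [hE' xE']].
  have gE' := gE _ Bq'; rewrite /= !cmapK // in gE'.
  rewrite cinfD cinf_sum gE'.
  congr (_ + _); apply: eq_bigr => i _.
  by rewrite cinfM cinfB hE' xE' /= (nbhs_singleton xE) !mxE.
rewrite E tangentD tangent_cst add0r tangent_sum; apply: eq_bigr => i _.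
rewrite tangentM cinfB /= subrr mul0r add0r tangentB tangent_cst subr0 mulrC.
by rewrite (nbhs_singleton (hE i)) g0.
Qed.

End Chart.

(** The vector fields [E i] and the functions [x i] are dual up to the factor
    [phi].  Everything is defined on the whole manifold, and both identities hold
    at all points, so that charts are no longer needed: [E i] is [phi] times the
    i-th coordinate field, and [x i] is a coordinate cut off outside the support
    of [phi]. *)
Record frame := Frame {
  fr_phi : cinf M;
  fr_x : 'I_n -> cinf M;
  fr_E : 'I_n -> vfield M;
  fr_decomp : forall q (v : tangent q),
    fr_phi q *: v = \sum_i v (fr_x i) *: (fr_E i q : tangent q);
  fr_dual : forall i j q, fr_E i q (fr_x j) = fr_phi q *+ (i == j)
}.

Lemma tangent_addE p (v w : tangent p) f : (v + w) f = v f + w f. Proof. by []. Qed.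
Lemma tangent_oppE p (v : tangent p) f : (- v) f = - v f. Proof. by []. Qed.
Lemma tangent_scaleE p (r : R) (v : tangent p) f : (r *: v) f = r * v f. Proof. by []. Qed.
Lemma tangent_zeroE p f : (0 : tangent p) f = 0. Proof. by []. Qed.
Lemma tangent_sumE p (I : Type) (s : seq I) (P : pred I) (F : I -> tangent p) f :
  (\sum_(i <- s | P i) F i) f = \sum_(i <- s | P i) F i f.
Proof.
exact: (big_morph (fun v : tangent p => v f) (fun v w => tangent_addE v w f) (tangent_zeroE p f)).
Qed.

Lemma frame_at p : exists F : frame, fr_phi F p = 1.
Proof.
have [c cp] := cdom_cover p.
have [b [K [V [[cK KU bK] [oV Vp VK b1 _]]]]] := plateau_bump (@cdom_open _ _ M c) cp.
have [phi [K2 [V2 [[cK2 K2V phiK] [oV2 V2p V2K phi1 _]]]]] := plateau_bump oV Vp.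
have oc := @cdom_open _ _ M c.
have sx i : smooth_on setT (fun q => b q * cmap c q 0 i).
  apply: (smooth_off_closed oc cK KU); first by move=> q /bK ->; rewrite mul0r.
  apply: smooth_onM => //; first by apply: smooth_onS (cinfP b).
  by move=> d k; exact: (@transition_smooth _ _ M d c i k).
pose x i := mkcinf (sx i).
have Vc : V `<=` cdom c by move=> q /VK /KU.
have xE q : V q -> \forall q' \near q, forall i, x i q' = cmap c q' 0 i.
  move=> Vq; rewrite /prop_near1 nbhsE; exists V => // q' Vq' i.
  by rewrite /= b1 // mul1r.
have dE i q : derivation_at q (fun f => phi q * 'D_(delta_mx 0 i) (f \o cinv c) (cmap c q)).
  have [cq|nc] := pselect (cdom c q).
    have [l d] := partial_derivation i cq.
    by split=> [r f g|f g]; [rewrite l; ring|rewrite d; ring].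
  have -> : phi q = 0 by apply: phiK => /K2V /Vc.
  by split=> [r f g|f g]; rewrite !mul0r ?mulr0 addr0.
have sE i f : smooth_on setT (fun q => mktangent (dE i q) f).
  have cK2c : K2 `<=` cdom c by move=> q /K2V /Vc.
  apply: (smooth_off_closed oc cK2 cK2c); first by move=> q /phiK /= ->; rewrite mul0r.
  apply: (@smooth_onM _ _ _ _ phi) => //; first by apply: smooth_onS (cinfP phi).
  apply: smooth_onS (smooth_on_pullback c (@cimage_open _ _ M c) (cinf_chart_partial c f i)).
  by move=> q cq; split=> //; exists q.
pose E i := VField (sE i).
have F1 q (v : tangent q) : phi q *: v = \sum_i v (x i) *: (E i q : tangent q).
  apply: tangent_eq => f; rewrite tangent_sumE tangent_scaleE.
  have [Vq|nV] := pselect (V q).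
    rewrite (coord_formula v f (Vc _ Vq) (xE _ Vq)) mulr_sumr; apply: eq_bigr => i _.
    by rewrite tangent_scaleE /= mulrCA.
  have p0 : phi q = 0 by apply: phiK => /K2V.
  rewrite p0 mul0r big1 // => i _; by rewrite tangent_scaleE /= p0 mul0r mulr0.
have F2 i j q : E i q (x j) = phi q *+ (i == j).
  have [Vq|nV] := pselect (V q); last first.
    have p0 : phi q = 0 by apply: phiK => /K2V.
    by rewrite /= p0 mul0r mul0rn.
  rewrite /= -mulr_natr; congr (_ * _).
  have [_ <-] : is_derive (cmap c q) (delta_mx 0 i) ((x j : M -> R) \o cinv c) (i == j)%:R.
    apply: (@near_eq_is_derive _ _ _ (fun y : 'rV[R]_n => y 0 j)).
      have := cinv_continuous (ex_intro2 _ _ q (Vc _ Vq) erefl); rewrite /prop_for /continuous_at.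
      have nI : nbhs (cmap c q) (cmap c @` cdom c).
        by apply: open_nbhs_nbhs; split; [exact: cimage_open|exists q => //; exact: Vc].
      rewrite cmapK; last exact: Vc.
      move=> /(_ _ (xE _ Vq)) nx.
      have {}nx : nbhs (cmap c q) [set y : 'rV[R]_n | forall i, x i (cinv c y) = cmap c (cinv c y) 0 i].
        exact: nx.
      have H : nbhs (cmap c q) [set y : 'rV[R]_n | y 0 j = x j (cinv c y)].
        apply: (filterS _ (filterI nx nI)) => y [xy [q' cq' q'y]].
        by have := xy j; rewrite -q'y /= cmapK.
      exact: H.
    have dc : differentiable (fun y : 'rV[R]_n => y 0 j) (cmap c q) by exact: differentiable_coord.
    apply: DeriveDef; first exact: diff_derivable.
    have did : derivable id (cmap c q) (delta_mx 0 i : 'rV[R]_n) by exact: derivable_id.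
    have := derive_mx did.
    rewrite derive_id => /matrixP /(_ 0 j); rewrite !mxE eqxx /= => <-.
    by rewrite eq_sym.
  by [].
by exists (Frame F1 F2); rewrite /= phi1.
Qed.

End Coordinates.

(** * Sections of a vector bundle *)

Section Evaluation.
Variables (R : realType) (n : nat) (M : manifold R n) (q : M).

Definition cinf_eval (f : cinf M) : R := f q.

Lemma cinf_eval_zmod_morphism : zmod_morphism cinf_eval. Proof. by []. Qed.
Lemma cinf_eval_monoid_morphism : monoid_morphism cinf_eval. Proof. by []. Qed.
HB.instance Definition _ :=
  GRing.isZmodMorphism.Build _ _ cinf_eval cinf_eval_zmod_morphism.
HB.instance Definition _ :=
  GRing.isMonoidMorphism.Build _ _ cinf_eval cinf_eval_monoid_morphism.
End Evaluation.

Section Bundle.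
Variables (R : realType) (n : nat) (M : manifold R n) (E : vbundle M).
Implicit Types (f : cinf M) (p q : M) (t u : triv E) (a b : section E).

Lemma smooth_on_off_closed (O U K : set M) (f : M -> R) : open O -> open U ->
  closed K -> K `<=` U -> (forall p, ~ K p -> f p = 0) ->
  smooth_on (O `&` U) f -> smooth_on O f.
Proof.
move=> oO oU cK KU f0 sf; apply: smooth_on_near => p Op.
have [Kp|nKp] := pselect (K p).
  exists (O `&` U); split; [exact: openI|split=> //; exact: KU|by exists f].
exists (~` K); split=> //; first exact: closed_openC.
exists (cst 0) => [|q /f0 -> //]; apply: smooth_on_cst; exact: closed_openC.
Qed.

Lemma tmapD t p (e e' : E p) : tdom t p -> tmap t (e + e') = tmap t e + tmap t e'.
Proof. by move=> tp; rewrite -[e in LHS]scale1r (tmap_linear tp) scale1r. Qed.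
Lemma tmap0 t p : tdom t p -> tmap t (0 : E p) = 0.
Proof. by move=> tp; apply: (addrI (tmap t (0 : E p))); rewrite -tmapD // !addr0. Qed.
Lemma tmapZ t p (r : R) (e : E p) : tdom t p -> tmap t (r *: e) = r *: tmap t e.
Proof. by move=> tp; rewrite -[r *: e]addr0 (tmap_linear tp) tmap0 // addr0. Qed.

Definition tinv t p (y : 'rV[R]_(rk E)) : E p := xget 0 [set e | tmap t e = y].

Lemma tinvK t p y : tdom t p -> tmap t (tinv t p y) = y.
Proof.
move=> tp; have [g gK Kg] := tmap_bij tp; rewrite /tinv.
by case: xgetP => [e _ //|/(_ (g y))]; rewrite /= Kg.
Qed.

Lemma tmap_inj t p (e e' : E p) : tdom t p -> tmap t e = tmap t e' -> e = e'.
Proof. by move=> tp; exact: (bij_inj (tmap_bij tp)). Qed.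

Lemma tinv_sum t p (e : E p) : tdom t p ->
  e = \sum_j tmap t e 0 j *: tinv t p (delta_mx 0 j).
Proof.
move=> tp; apply: (tmap_inj tp).
rewrite (big_morph _ (fun e e' => tmapD e e' tp) (tmap0 tp)).
rewrite [LHS]row_sum_delta; apply: eq_bigr => j _.
by rewrite tmapZ // tinvK.
Qed.

Lemma section_sumE (I : Type) (s : seq I) (P : pred I) (F : I -> section E) p :
  (\sum_(i <- s | P i) F i) p = \sum_(i <- s | P i) F i p.
Proof.
apply: (big_morph (fun a : section E => a p)) => [a b|]; first exact: sectionDE.
by [].
Qed.

Lemma sectionNE a p : (- a) p = - a p.
Proof. by apply: (addrI (a p)); rewrite -sectionDE !subrr. Qed.
Lemma sectionBE a b p : (a - b) p = a p - b p.
Proof. by rewrite sectionDE sectionNE. Qed.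

(** The sections [e j] are the basis sections of the trivialisation [t] cut off
    by [h], hence globally defined. *)
Lemma local_frame t p : tdom t p -> exists h : cinf M, exists V,
  exists e : 'I_(rk E) -> section E,
  [/\ [/\ open V, V p, V `<=` tdom t & forall q, V q -> h q = 1],
      (forall j q, e j q = h q *: tinv t q (delta_mx 0 j)) &
      (forall q, h q != 0 -> tdom t q)].
Proof.
move=> tp; have [h [K [V [[cK KU hK] [oV Vp VK h1 _]]]]] := plateau_bump (@tdom_open _ _ _ E t) tp.
have hd q : h q != 0 -> tdom t q.
  by move=> hq; apply: KU; apply: contrapT => /hK hq0; rewrite hq0 eqxx in hq.
have se j u i : smooth_on (tdom u) (fun q => tmap u (h q *: tinv t q (delta_mx 0 j)) 0 i).
  have [g [sg gE]] := tmap_smooth t u.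
  have ou := @tdom_open _ _ _ E u; have ot := @tdom_open _ _ _ E t.
  have E0 q : tdom u q -> tmap u (h q *: tinv t q (delta_mx 0 j)) 0 i = h q * g q j i.
    move=> uq; have [h0|/hd tq] := eqVneq (h q) 0.
      by rewrite h0 scale0r mul0r tmap0 // mxE.
    by rewrite tmapZ // gE // tinvK // -rowE !mxE.
  apply: (@smooth_on_ext _ _ _ _ (fun q => h q * g q j i)) => // [q uq|]; first by rewrite E0.
  apply: (smooth_on_off_closed ou ot cK KU); first by move=> q /hK ->; rewrite mul0r.
  apply: smooth_onM; first exact: openI.
    exact: smooth_onS (cinfP h).
  by rewrite setIC; exact: sg.
exists h, V, (fun j => Section_ (se j)); split=> //; split=> // q /VK; exact: KU.
Qed.

Lemma section_frame p : exists (h : cinf M) (e : 'I_(rk E) -> section E)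
  (co : section E -> 'I_(rk E) -> cinf M),
  [/\ h p = 1, (forall a, h *: a = \sum_j co a j *: e j) &
      (forall a, a p = 0 -> forall j, co a j p = 0)].
Proof.
have [t tp] := tdom_cover E p.
have [h [K [V [[cK KU hK] [oV Vp VK h1 _]]]]] := plateau_bump (@tdom_open _ _ _ E t) tp.
have [h' [V' [e [[oV' V'p V't h'1] eE h'0]]]] := local_frame tp.
have sco a j : smooth_on setT (fun q => h q * tmap t (a q) 0 j).
  have ot := @tdom_open _ _ _ E t.
  apply: (smooth_off_closed ot cK KU); first by move=> q /hK ->; rewrite mul0r.
  apply: smooth_onM => //; last exact: section_smooth.
  exact: smooth_onS (cinfP h).
exists (h * h'), e, (fun a j => mkcinf (sco a j)); split.
- by rewrite cinfM h1 // h'1 // mulr1.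
- move=> a; apply: section_eq => q; rewrite sectionZE section_sumE.
  under eq_bigr do rewrite sectionZE eE.
  rewrite cinfM; have [h0|/h'0 tq] := eqVneq (h' q) 0.
    by rewrite h0 mulr0 scale0r big1 // => j _; rewrite scale0r scaler0.
  rewrite [a q in LHS](tinv_sum _ tq) scaler_sumr; apply: eq_bigr => j _.
  by rewrite !scalerA /= mulrAC.
- move=> a a0 j /=; by rewrite a0 tmap0 // mxE mulr0.
Qed.

Lemma section_through p (v : E p) : exists a : section E, a p = v.
Proof.
have [t tp] := tdom_cover E p.
have [h' [V' [e [[oV' V'p V't h'1] eE h'0]]]] := local_frame tp.
exists (\sum_j ccst M (tmap t v 0 j) *: e j).
rewrite section_sumE [RHS](tinv_sum _ tp); apply: eq_bigr => j _.
by rewrite sectionZE eE h'1 // scale1r.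
Qed.

(** By [section_frame], a section that vanishes at [p] is, up to a factor that is
    [1] at [p], a combination of sections whose coefficients vanish at [p]. *)
Lemma tensorial (L : section E -> cinf M) p a b :
  (forall f a b, L (f *: a + b) = f * L a + L b) -> a p = b p -> L a p = L b p.
Proof.
move=> linL ab; have L0 : L 0 = 0.
  by have := linL (-1) 0 0; rewrite scaler0 addr0 mulN1r addNr.
have LD x y : L (x + y) = L x + L y by rewrite -[x in LHS]scale1r linL mul1r.
have LZ f x : L (f *: x) = f * L x by rewrite -[f *: x]addr0 linL L0 addr0.
suff H (c : section E) : c p = 0 -> L c p = 0.
  have := H (a - b); rewrite sectionBE ab subrr LD -scaleN1r LZ mulN1r cinfB => /(_ erefl).
  by move=> /eqP; rewrite subr_eq0 => /eqP.
move=> c0; have [h [e [co [h1 hE co0]]]] := section_frame p.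
have := congr1 (fun f : cinf M => f p) (congr1 L (hE c)).
rewrite LZ cinfM h1 mul1r => ->.
rewrite (big_morph L LD L0) cinf_sum big1 // => j _.
by rewrite LZ cinfM co0 // mul0r.
Qed.

End Bundle.

(** * The Riesz isomorphism of a non-degenerate pairing *)

Section Pairing.
Variables (R : realType) (n : nat) (M : manifold R n) (A : algebroid_data M).
Implicit Types (f : cinf M) (p q : M) (a b c : section A).

Lemma pairingDr p (e u v : A p) : pairing e (u + v) = pairing e u + pairing e v.
Proof. by rewrite -[u in LHS]scale1r pairing_linear mul1r. Qed.
Lemma pairing0r p (e : A p) : pairing e 0 = 0.
Proof. by apply: (addrI (pairing e 0)); rewrite -pairingDr !addr0. Qed.
Lemma pairingZr p (e : A p) r u : pairing e (r *: u) = r * pairing e u.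
Proof. by rewrite -[r *: u]addr0 pairing_linear pairing0r addr0. Qed.
Lemma pairingNr p (e u : A p) : pairing e (- u) = - pairing e u.
Proof. by rewrite -scaleN1r pairingZr mulN1r. Qed.
Lemma pairingBr p (e u v : A p) : pairing e (u - v) = pairing e u - pairing e v.
Proof. by rewrite pairingDr pairingNr. Qed.
Lemma pairingDl p (e u v : A p) : pairing (u + v) e = pairing u e + pairing v e.
Proof. by rewrite pairing_sym pairingDr !(pairing_sym e). Qed.
Lemma pairingZl p (e : A p) r u : pairing (r *: u) e = r * pairing u e.
Proof. by rewrite pairing_sym pairingZr pairing_sym. Qed.
Lemma pairing0l p (e : A p) : pairing 0 e = 0.
Proof. by rewrite pairing_sym pairing0r. Qed.
Lemma pairingNl p (e u : A p) : pairing (- u) e = - pairing u e.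
Proof. by rewrite pairing_sym pairingNr pairing_sym. Qed.
Lemma pairingBl p (e u v : A p) : pairing (u - v) e = pairing u e - pairing v e.
Proof. by rewrite pairingDl pairingNl. Qed.
Lemma pairing_sumr p (e : A p) (I : Type) (s : seq I) (P : pred I) (F : I -> A p) :
  pairing e (\sum_(i <- s | P i) F i) = \sum_(i <- s | P i) pairing e (F i).
Proof. exact: (big_morph _ (pairingDr e) (pairing0r e)). Qed.
Lemma pairing_suml p (e : A p) (I : Type) (s : seq I) (P : pred I) (F : I -> A p) :
  pairing (\sum_(i <- s | P i) F i) e = \sum_(i <- s | P i) pairing (F i) e.
Proof. by rewrite pairing_sym pairing_sumr; under eq_bigr do rewrite pairing_sym. Qed.

Lemma pairing_inj p (e e' : A p) : (forall u, pairing e u = pairing e' u) -> e = e'.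
Proof.
move=> ee'; apply/eqP; rewrite -subr_eq0; apply/eqP; apply: pairing_nondeg => u.
by rewrite pairingBl ee' subrr.
Qed.

Lemma spairing_inj a b : (forall c, spairing a c = spairing b c) -> a = b.
Proof.
move=> ab; apply: section_eq => p; apply: pairing_inj => u.
by have [c <-] := section_through u; exact: (congr1 (fun f : cinf M => f p) (ab c)).
Qed.

Definition gram t p : 'M[R]_(rk A) :=
  \matrix_(i, j) pairing (tinv t p (delta_mx 0 i) : A p) (tinv t p (delta_mx 0 j)).

Lemma pairing_tinv t p (e : A p) j : tdom t p ->
  pairing e (tinv t p (delta_mx 0 j)) = (tmap t e *m gram t p) 0 j.
Proof.
move=> tp; rewrite {1}(tinv_sum e tp) pairing_suml mxE; apply: eq_bigr => i _.
by rewrite pairingZl mxE.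
Qed.

(** A row vector in the kernel of the Gram matrix gives a vector orthogonal to the
    whole fibre. *)
Lemma gram_unit t p : tdom t p -> gram t p \in unitmx.
Proof.
move=> tp; rewrite -row_free_unit -kermx_eq0; apply/eqP/row_matrixP => i; rewrite row0.
set y := row i _; have yG : y *m gram t p = 0 by rewrite /y -row_mul mulmx_ker row0.
suff e0 : tinv t p y = 0 :> A p by rewrite -(tinvK (E := A) y tp) e0 tmap0.
apply: pairing_nondeg => u; rewrite (tinv_sum u tp) pairing_sumr big1 // => j _.
by rewrite pairingZr pairing_tinv // tinvK // yG mxE mulr0.
Qed.

Lemma riesz_pointwise p (l : A p -> R) : linear_for *%R l ->
  exists e : A p, forall u, pairing e u = l u.
Proof.
move=> ll; have lD u v : l (u + v) = l u + l v by rewrite -[u in LHS]scale1r ll mul1r.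
have l0 : l 0 = 0 by apply: (addrI (l 0)); rewrite -lD !addr0.
have lZ r u : l (r *: u) = r * l u by rewrite -[r *: u]addr0 ll l0 addr0.
have [t tp] := tdom_cover A p.
pose y := \row_j l (tinv t p (delta_mx 0 j)) *m invmx (gram t p).
exists (tinv t p y) => u; rewrite (tinv_sum u tp) pairing_sumr (big_morph l lD l0).
apply: eq_bigr => j _; rewrite pairingZr pairing_tinv // tinvK // /y mulmxKV ?gram_unit //.
by rewrite lZ mxE.
Qed.

Lemma coanchorP p (alpha : tangent p -> R) : linear_for *%R alpha ->
  forall e, pairing (coanchor A alpha) e = alpha (anchor A p e).
Proof.
move=> la; rewrite /coanchor; case: xgetP => [e _ //|].
have [e eE] : exists e : A p, forall u, pairing e u = alpha (anchor A p u).
  by apply: riesz_pointwise => r u v; rewrite linearP la.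
by move=> /(_ e).
Qed.

(** The coordinates of [e] are the pairings of [e] with a local frame multiplied
    by the inverse of the Gram matrix, which is smooth by Cramer. *)
Lemma weak_smooth (e : forall p, A p) :
  (forall b : section A, smooth_on setT (fun p => pairing (e p) (b p))) ->
  forall t j, smooth_on (tdom t) (fun p => tmap t (e p) 0 j).
Proof.
move=> se t j; apply: smooth_on_near => p tp.
have [h [V [b [[oV Vp Vt h1] bE _]]]] := local_frame tp.
exists V; split=> //.
have bV i q : V q -> b i q = tinv t q (delta_mx 0 i) by move=> Vq; rewrite bE h1 // scale1r.
pose G : 'M[cinf M]_(rk A) := \matrix_(i, k) spairing (b i) (b k).
have GE q : V q -> map_mx (cinf_eval q) G = gram t q.
  by move=> Vq; apply/matrixP => i k; rewrite !mxE /cinf_eval /= !bV.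
have dE q : V q -> (\det G) q = \det (gram t q).
  by move=> Vq; rewrite -GE // det_map_mx.
have d0 q : V q -> (\det G) q != 0.
  by move=> Vq; rewrite dE // -unitfE -unitmxE gram_unit //; exact: Vt.
exists (fun q => (\sum_i mkcinf (se (b i)) * (\adj G) i j) q * ((\det G) q)^-1).
  apply: smooth_onM => //; first exact: smooth_onS (cinfP _).
  by apply: smooth_onV => //; exact: smooth_onS (cinfP _).
move=> q Vq; have tq := Vt q Vq.
rewrite cinf_sum dE //.
transitivity ((tmap t (e q) *m gram t q *m \adj (gram t q)) 0 j * (\det (gram t q))^-1).
  congr (_ * _); rewrite [RHS]mxE; apply: eq_bigr => i _.
  rewrite cinfM -pairing_tinv //= bV //; congr (_ * _).
  by rewrite -(GE q Vq) -(map_mx_adj (cinf_eval q)) [RHS]mxE.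
rewrite -mulmxA mul_mx_adj mul_mx_scalar mxE mulrC mulKf //.
by rewrite -dE // d0.
Qed.

Definition weak_section e (se : forall b : section A, smooth_on setT (fun p => pairing (e p) (b p))) :
  section A := Section_ (weak_smooth se).

(** All brackets below are defined through this theorem, by prescribing
    [<[a, b], c>] as a function-linear expression in [c]. *)
Theorem riesz (L : section A -> cinf M) :
  (forall f a b, L (f *: a + b) = f * L a + L b) ->
  exists e : section A, forall b, spairing e b = L b.
Proof.
move=> linL.
have /choice [ext extE] : forall pv : {p : M & A p}, exists a : section A, a (tag pv) = tagged pv.
  by move=> pv; exact: section_through.
pose x p (v : A p) := ext (Tagged (fun p => A p : Type) v).
have xE p (v : A p) : x p v p = v by exact: (extE (Tagged (fun p => A p : Type) v)).
pose l p (v : A p) : R := L (x p v) p.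
have ll p : linear_for *%R (l p).
  move=> r u v; rewrite /l.
  have -> : L (x p (r *: u + v)) p = L (ccst M r *: x p u + x p v) p.
    by apply: tensorial => //; rewrite sectionDE sectionZE !xE.
  by rewrite linL.
pose e p := sval (cid (riesz_pointwise (ll p))).
have eE p u : pairing (e p) u = l p u := svalP (cid (riesz_pointwise (ll p))) u.
have eb b p : pairing (e p) (b p) = L b p.
  by rewrite eE /l; apply: tensorial => //; rewrite xE.
have se b : smooth_on setT (fun p => pairing (e p) (b p)).
  have -> : (fun p => pairing (e p) (b p)) = L b by apply/funext => p; exact: eb.
  exact: cinfP.
by exists (weak_section se) => b; apply: cinf_eq => p; exact: eb.
Qed.

End Pairing.

(** * Vector fields and the axioms tested on functions *)

Section VectorFields.
Variables (R : realType) (n : nat) (M : manifold R n).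
Implicit Types (f g : cinf M) (p q : M) (X Y Z : vfield M).

Lemma vfield_eq X Y : (forall p, X p = Y p) -> X = Y.
Proof.
case: X Y => [X sX] [Y sY] /= XY.
have {}XY : X = Y by exact/functional_extensionality_dep.
by subst Y; congr VField; exact: Prop_irrelevance.
Qed.

Lemma vcomb_smooth f X Y g : smooth_on setT (fun p => (f p *: X p + Y p : tangent p) g).
Proof. exact: (cinfP (f * vapp X g + vapp Y g)). Qed.
Definition vcomb f X Y : vfield M := VField (vcomb_smooth f X Y).

Lemma vcombE f X Y p g : vcomb f X Y p g = f p * X p g + Y p g.
Proof. by []. Qed.

Lemma vapp_vcomb f X Y g : vapp (vcomb f X Y) g = f * vapp X g + vapp Y g.
Proof. exact: cinf_eq. Qed.

Lemma vappD X f g : vapp X (f + g) = vapp X f + vapp X g.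
Proof. by apply: cinf_eq => p; rewrite vappE tangentD. Qed.
Lemma vapp0 X : vapp X 0 = 0.
Proof. by apply: cinf_eq => p; rewrite vappE tangent0. Qed.
Lemma vapp_cst X r : vapp X (ccst M r) = 0.
Proof. by apply: cinf_eq => p; rewrite vappE tangent_cst. Qed.

Lemma vzero_smooth f : smooth_on setT (fun p : M => (0 : tangent p) f).
Proof. exact: (smooth_on_cst 0 openT). Qed.
Definition vzero : vfield M := VField vzero_smooth.

Section Curved.
Variable T : tform2 M.

Lemma tform2Dr p (x y z : tangent p) : tform2_fun T x (y + z) = tform2_fun T x y + tform2_fun T x z.
Proof. by have := tform2_linear T x 1 y z; rewrite !scale1r. Qed.
Lemma tform20r p (x : tangent p) : tform2_fun T x 0 = 0.
Proof. by apply: (addrI (tform2_fun T x 0)); rewrite -tform2Dr !addr0. Qed.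
Lemma tform2Zr p (x : tangent p) r y : tform2_fun T x (r *: y) = r *: tform2_fun T x y.
Proof. by have := tform2_linear T x r y 0; rewrite tform20r !addr0. Qed.
Lemma tform20l p (x : tangent p) : tform2_fun T 0 x = 0.
Proof. by rewrite tform2_skew tform20r oppr0. Qed.
Lemma tform2Dl p (x y z : tangent p) : tform2_fun T (x + y) z = tform2_fun T x z + tform2_fun T y z.
Proof. by rewrite tform2_skew tform2Dr opprD -!(tform2_skew T _ z). Qed.
Lemma tform2Zl p (x : tangent p) r y : tform2_fun T (r *: y) x = r *: tform2_fun T y x.
Proof. by rewrite tform2_skew tform2Zr -scalerN -tform2_skew. Qed.


Lemma tbracket_smooth X Y f :
  smooth_on setT (fun p => (lie_bracket X Y p + tform2_fun T (X p) (Y p) : tangent p) f).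
Proof.
exact: (cinfP (vapp X (vapp Y f) - vapp Y (vapp X f) + mkcinf (tform2_smooth T X Y f))).
Qed.
(** Being the bracket of the anchors in an algebroid with curvature [T], it takes
    over the role of the Lie bracket. *)
Definition tbracket X Y : vfield M := VField (tbracket_smooth X Y).

Lemma tbracketE X Y p f : tbracket X Y p f =
  X p (vapp Y f) - Y p (vapp X f) + tform2_fun T (X p) (Y p) f.
Proof. by []. Qed.

Lemma tbracket_skew X Y : tbracket X Y = vcomb (-1) (tbracket Y X) vzero.
Proof.
apply: vfield_eq => p; apply: tangent_eq => f.
rewrite vcombE addr0 [_ * _]mulN1r.
by rewrite !tbracketE tform2_skew tangent_oppE opprD opprB.
Qed.

Lemma tbracket_vcombr f X Y Z : tbracket X (vcomb f Y Z) =
  vcomb f (tbracket X Y) (vcomb (vapp X f) Y (tbracket X Z)).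
Proof.
apply: vfield_eq => p; apply: tangent_eq => g.
rewrite !(vcombE, tbracketE) vapp_vcomb tangentD tangentM.
by rewrite tform2Dr tform2Zr tangent_addE tangent_scaleE !vappE; ring.
Qed.

Lemma tbracket_zerol Y p : tbracket vzero Y p = 0.
Proof.
apply: tangent_eq => f; rewrite tbracketE tform20l addr0.
have -> : vapp vzero f = 0 by apply: cinf_eq.
by rewrite tangent0 subr0.
Qed.

End Curved.
End VectorFields.

Section Algebroid.
Variables (R : realType) (n : nat) (M : manifold R n) (A : algebroid_data M).
Implicit Types (f : cinf M) (p q : M) (a b c : section A).

Lemma sanchorE a p : sanchor a p = anchor A p (a p). Proof. by []. Qed.
Lemma spairingE a b p : spairing a b p = pairing (a p) (b p). Proof. by []. Qed.

Lemma sanchor_comb f a b : sanchor (f *: a + b) = vcomb f (sanchor a) (sanchor b).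
Proof.
by apply: vfield_eq => p; rewrite sanchorE sectionDE sectionZE linearP.
Qed.

Lemma spairingC a b : spairing a b = spairing b a.
Proof. by apply: cinf_eq => p; rewrite spairingE pairing_sym. Qed.
Lemma spairingDl a b c : spairing (a + b) c = spairing a c + spairing b c.
Proof. by apply: cinf_eq => p; rewrite spairingE sectionDE pairingDl. Qed.
Lemma spairingDr a b c : spairing a (b + c) = spairing a b + spairing a c.
Proof. by apply: cinf_eq => p; rewrite spairingE sectionDE pairingDr. Qed.
Lemma spairingZl f a b : spairing (f *: a) b = f * spairing a b.
Proof. by apply: cinf_eq => p; rewrite spairingE sectionZE pairingZl. Qed.
Lemma spairingZr f a b : spairing a (f *: b) = f * spairing a b.
Proof. by apply: cinf_eq => p; rewrite spairingE sectionZE pairingZr. Qed.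

Lemma differential_linear f p : linear_for *%R (differential f (p := p)).
Proof. by move=> r u v; rewrite /differential tangent_addE tangent_scaleE. Qed.

(** The first axiom paired with a third section: [<rho^* d f, c> = rho(c) f]. *)
Lemma metric_algebroidP : metric_algebroid A <->
  (forall a b c, spairing (bracket a b) c + spairing (bracket b a) c =
     vapp (sanchor c) (spairing a b)) /\
  (forall a b c, vapp (sanchor a) (spairing b c) =
     spairing (bracket a b) c + spairing b (bracket a c)).
Proof.
split=> -[H1 H2]; split=> //.
  move=> a b c; rewrite -spairingDl; apply: cinf_eq => p; rewrite spairingE.
  by rewrite H1 coanchorP //; exact: differential_linear.
move=> a b p; apply: pairing_inj => u; rewrite coanchorP; last exact: differential_linear.
have [c <-] := section_through u.
by have := congr1 (fun f : cinf M => f p) (H1 a b c); rewrite -spairingDl /= => ->.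
Qed.

Lemma has_curvatureP (T : tform2 M) : has_curvature A T <->
  (forall a b, sanchor (bracket a b) = tbracket T (sanchor a) (sanchor b)).
Proof.
split=> H a b.
  apply: vfield_eq => p; have := H a b p; rewrite /anchor_defect => /eqP.
  by rewrite subr_eq addrC => /eqP.
move=> p; rewrite /anchor_defect; have := congr1 (fun X : vfield M => X p) (H a b).
by rewrite /= => ->; rewrite addrC addrA addNr add0r.
Qed.

(** The conditions on the defect [F] say that it is a tensor factoring through the
    anchor, which holds for [T(rho a, rho b)]. *)
Lemma curvature_cca (T : tform2 M) : metric_algebroid A -> has_curvature A T ->
  curved_courant_algebroid A.
Proof.
move=> mA cT; split=> //.
- by move=> f a a' b p; rewrite !cT sectionDE sectionZE linearP /= tform2Dl tform2Zl.
- by move=> f a b b' p; rewrite !cT sectionDE sectionZE linearP /= tform2Dr tform2Zr.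
- by move=> a b p; rewrite !cT tform2_skew.
- by move=> a b p a0; rewrite cT a0 tform20l.
Qed.

End Algebroid.

Section SetBracket.
Variables (R : realType) (n : nat) (M : manifold R n) (A : algebroid_data M).
Variables (br : section A -> section A -> section A).
Hypothesis brl : forall b (r : R) a a',
    br (ccst M r *: a + a') b = ccst M r *: br a b + br a' b.
Hypothesis brr : forall b (r : R) a a',
    br b (ccst M r *: a + a') = ccst M r *: br b a + br b a'.

Definition set_bracket : algebroid_data M :=
  AlgebroidData (@pairing_linear _ _ _ A) (@pairing_sym _ _ _ A)
    (@pairing_nondeg _ _ _ A) (@pairing_smooth _ _ _ A) (@anchor_smooth _ _ _ A) brl brr.

End SetBracket.

(** * The bundle TM + T*M *)

Section Covectors.
Variables (R : realType) (n : nat) (M : manifold R n).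

Definition covectorp (p : M) : {pred tangent p -> R} := fun w => `[< linear_for *%R w >].

Arguments covectorp : clear implicits.

Lemma covectorpP p (w : tangent p -> R) :
  reflect (linear_for *%R w) (w \in covectorp p).
Proof. exact: asboolP. Qed.

Lemma covectorp_submod p : submod_closed (covectorp p).
Proof.
split=> [|r u v /covectorpP lu /covectorpP lv]; apply/covectorpP.
  by move=> r u v; rewrite mulr0 addr0.
have E h : (r *: u + v) h = r * u h + v h by [].
by move=> s x y; rewrite !E lu lv; ring.
Qed.

HB.instance Definition _ p :=
  GRing.isSubmodClosed.Build _ _ (covectorp p) (covectorp_submod p).

Record covector (p : M) := Covector {
  covector_fun :> tangent p -> R;
  _ : covector_fun \in covectorp p
}.

HB.instance Definition _ p := [isSub for @covector_fun p].
HB.instance Definition _ p := [Choice of covector p by <:].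
HB.instance Definition _ p := [SubChoice_isSubLmodule of covector p by <:].

Lemma covector_linear p (w : covector p) : linear_for *%R w.
Proof. exact/covectorpP/(valP w). Qed.

Definition mkcovector p (w : tangent p -> R) (lw : linear_for *%R w) : covector p :=
  Covector (introT (covectorpP w) lw).

Lemma covectorD p (w : covector p) u v : w (u + v) = w u + w v.
Proof. by rewrite -[u in LHS]scale1r covector_linear mul1r. Qed.
Lemma covector0 p (w : covector p) : w 0 = 0.
Proof. by apply: (addrI (w 0)); rewrite -covectorD !addr0. Qed.
Lemma covectorZ p (w : covector p) r u : w (r *: u) = r * w u.
Proof. by rewrite -[r *: u]addr0 covector_linear covector0 addr0. Qed.
Lemma covector_sum p (w : covector p) (I : Type) (s : seq I) (P : pred I) F :
  w (\sum_(i <- s | P i) F i) = \sum_(i <- s | P i) w (F i).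
Proof. exact: (big_morph _ (covectorD w) (covector0 w)). Qed.

Lemma covector_eq p (v w : covector p) : (forall x, v x = w x) -> v = w.
Proof. by move=> vw; apply/val_inj/funext. Qed.
Lemma covector_addE p (v w : covector p) x : (v + w) x = v x + w x. Proof. by []. Qed.
Lemma covector_scaleE p r (w : covector p) x : (r *: w) x = r * w x. Proof. by []. Qed.

End Covectors.

Section StandardBundle.
Variables (R : realType) (n : nat) (M : manifold R n).
Implicit Types (F G : frame M) (f : cinf M).

Definition std_fibre (p : M) : lmodType R := (tangent p * covector p)%type.
Definition std_dom F : set M := [set q | fr_phi F q != 0].
(** Up to the factor [fr_phi F], the coordinates of a vector and a covector in
    the frame [F] and its dual. *)
Definition std_map F (p : M) (e : std_fibre p) : 'rV[R]_(n + n) :=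
  row_mx (\row_i e.1 (fr_x F i)) (\row_i e.2 (fr_E F i p)).

Lemma std_dom_open F : open (std_dom F). Proof. exact: cinf_neq0_open. Qed.
Lemma std_dom_cover p : exists F, std_dom F p.
Proof. by have [F Fp] := frame_at p; exists F; rewrite /std_dom /= Fp oner_neq0. Qed.

Lemma std_fibre_fst p (r : R) (u v : std_fibre p) : (r *: u + v).1 = r *: u.1 + v.1.
Proof. exact: (linearP (fst : {linear (tangent p * covector p)%type -> tangent p})). Qed.
Lemma std_fibre_snd p (r : R) (u v : std_fibre p) : (r *: u + v).2 = r *: u.2 + v.2.
Proof. exact: (linearP (snd : {linear (tangent p * covector p)%type -> covector p})). Qed.

Lemma std_map_linear F p : std_dom F p -> linear (@std_map F p).
Proof.
move=> _ r u v; rewrite /std_map scale_row_mx add_row_mx.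
congr row_mx; apply/rowP => i; rewrite !mxE.
  by rewrite std_fibre_fst tangent_addE tangent_scaleE.
by rewrite std_fibre_snd covector_addE covector_scaleE.
Qed.

Lemma frame_tangent F q (v : tangent q) : std_dom F q ->
  v = \sum_i (v (fr_x F i) / fr_phi F q) *: (fr_E F i q : tangent q).
Proof.
move=> Fq; apply: (scalerI Fq); rewrite fr_decomp scaler_sumr; apply: eq_bigr => i _.
by rewrite scalerA mulrCA mulfV // mulr1.
Qed.

Lemma frame_tangent_app F q (v : tangent q) f : std_dom F q ->
  v f = \sum_i v (fr_x F i) * vapp (fr_E F i) f q / fr_phi F q.
Proof.
move=> Fq; rewrite {1}(frame_tangent v Fq) tangent_sumE; apply: eq_bigr => i _.
by rewrite tangent_scaleE mulrAC.
Qed.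

Lemma std_map_bij F p : std_dom F p -> bijective (@std_map F p).
Proof.
move=> Fp.
have lw (y : 'rV[R]_(n + n)) : linear_for *%R (fun v : tangent p =>
    \sum_i rsubmx y 0 i * v (fr_x F i) / fr_phi F p).
  move=> r u v; rewrite mulr_sumr -big_split; apply: eq_bigr => i _.
  rewrite tangent_addE tangent_scaleE; move: (u _) (v _) => a b /=.
  by rewrite mulrDr mulrDl mulrCA !mulrA.
pose inv (y : 'rV[R]_(n + n)) : std_fibre p :=
  (\sum_i (lsubmx y 0 i / fr_phi F p) *: (fr_E F i p : tangent p), mkcovector (lw y)).
exists inv => [[v w]|y].
  rewrite /inv /std_map; congr pair.
    rewrite [RHS](frame_tangent v Fp); apply: eq_bigr => i _.
    by rewrite row_mxKl mxE.
  apply: covector_eq => u /=; rewrite {2}(frame_tangent u Fp) covector_sum.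
  apply: eq_bigr => i _; rewrite row_mxKr mxE covectorZ /=.
  by rewrite -mulrA mulrC.
rewrite /inv /std_map -[RHS]hsubmxK; congr row_mx; apply/rowP => j; rewrite mxE.
  rewrite [LHS]tangent_sumE (bigD1 j) // tangent_scaleE fr_dual eqxx mulr1n divfK //.
  rewrite big1 => [|i ij]; first exact: addr0.
  by rewrite tangent_scaleE fr_dual (negbTE ij) mulr0.
rewrite /= (bigD1 j) //= fr_dual eqxx mulr1n mulfK //.
by rewrite big1 ?addr0 // => i ij; rewrite fr_dual eq_sym (negbTE ij) mulr0 mul0r.
Qed.

Lemma std_map_smooth F G : exists g : M -> 'M[R]_(n + n),
    (forall i j, smooth_on (std_dom F `&` std_dom G) (fun p => g p i j)) /\
    (forall p (e : std_fibre p), (std_dom F `&` std_dom G) p ->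
       std_map G e = std_map F e *m g p).
Proof.
have oFG : open (std_dom F `&` std_dom G) by apply: openI; exact: std_dom_open.
have sV : smooth_on (std_dom F `&` std_dom G) (fun q => (fr_phi F q)^-1).
  apply: smooth_onV => // [q [] //|]; exact: smooth_onS (cinfP _).
have sc (f : cinf M) : smooth_on (std_dom F `&` std_dom G) (fun q => f q / fr_phi F q).
  by apply: (smooth_onM oFG _ sV); exact: smooth_onS (cinfP f).
exists (fun p => block_mx
  (\matrix_(i, j) (vapp (fr_E F i) (fr_x G j) p / fr_phi F p)) 0
  0 (\matrix_(i, j) (vapp (fr_E G j) (fr_x F i) p / fr_phi F p))).
split=> [i j|p [v w] [Fp Gp]].
  case: (split_ordP i) => i' ->; case: (split_ordP j) => j' ->.
  - apply: (smooth_on_ext oFG _ (sc (vapp (fr_E F i') (fr_x G j')))) => p _.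
    by rewrite block_mxEul mxE.
  - apply: (smooth_on_ext oFG _ (smooth_on_cst 0 oFG)) => p _.
    by rewrite block_mxEur mxE.
  - apply: (smooth_on_ext oFG _ (smooth_on_cst 0 oFG)) => p _.
    by rewrite block_mxEdl mxE.
  - apply: (smooth_on_ext oFG _ (sc (vapp (fr_E G j') (fr_x F i')))) => p _.
    by rewrite block_mxEdr mxE.
rewrite /std_map mul_row_block !mulmx0 addr0 add0r; congr row_mx; apply/rowP => j; rewrite !mxE.
  rewrite (frame_tangent_app v _ Fp); apply: eq_bigr => i _.
  by rewrite !mxE mulrA.
rewrite /= {1}(frame_tangent (fr_E G j p) Fp) covector_sum; apply: eq_bigr => i _.
by rewrite !mxE covectorZ mulrC.
Qed.

Definition std_bundle : vbundle M :=
  VBundle std_dom_open std_dom_cover std_map_linear std_map_bij std_map_smooth.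

Lemma std_tangent_smooth (a : section std_bundle) f :
  smooth_on setT (fun p => (a p : std_fibre p).1 f).
Proof.
apply: smooth_on_local => p _; have [F Fp] := std_dom_cover p.
exists (std_dom F); split=> //; have oF := std_dom_open F.
apply: (@smooth_on_ext _ _ _ _ (fun q => \sum_i (@std_map F q (a q)) 0 (lshift n i) *
   vapp (fr_E F i) f q / fr_phi F q)) => // [q Fq|].
  by rewrite (frame_tangent_app _ f Fq); apply: eq_bigr => i _; rewrite row_mxEl mxE.
apply: smooth_on_sum => // i _; apply: smooth_onM => //.
  apply: smooth_onM => //; last exact: smooth_onS (cinfP _).
  exact: (@section_smooth _ _ _ _ a F (lshift n i)).
by apply: smooth_onV => //; exact: smooth_onS (cinfP _).
Qed.

Lemma std_covector_smooth (a : section std_bundle) (X : vfield M) :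
  smooth_on setT (fun p => (a p : std_fibre p).2 (X p)).
Proof.
apply: smooth_on_local => p _; have [F Fp] := std_dom_cover p.
exists (std_dom F); split=> //; have oF := std_dom_open F.
apply: (@smooth_on_ext _ _ _ _ (fun q => \sum_i (@std_map F q (a q)) 0 (rshift n i) *
   vapp X (fr_x F i) q / fr_phi F q)) => // [q Fq|].
  rewrite (frame_tangent (X q) Fq) covector_sum; apply: eq_bigr => i _.
  by rewrite row_mxEr mxE covectorZ -mulrA mulrC.
apply: smooth_on_sum => // i _; apply: smooth_onM => //.
  apply: smooth_onM => //; last exact: smooth_onS (cinfP _).
  exact: (@section_smooth _ _ _ _ a F (rshift n i)).
by apply: smooth_onV => //; exact: smooth_onS (cinfP _).
Qed.

Lemma std_section_smooth (X : vfield M) (w : forall p, covector p) :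
  (forall Y : vfield M, smooth_on setT (fun p => w p (Y p))) ->
  forall (F : triv std_bundle) (j : 'I_(rk std_bundle)),
    smooth_on (tdom F) (fun p => tmap F ((X p, w p) : std_bundle p) 0 j).
Proof.
move=> sw F j; have oF := std_dom_open F; case: (split_ordP j) => i ->.
  apply: (@smooth_on_ext _ _ _ _ (vapp X (fr_x F i))) => // [q Fq|].
    by rewrite /= row_mxEl mxE.
  exact: smooth_onS (cinfP _).
apply: (@smooth_on_ext _ _ _ _ (mkcinf (sw (fr_E F i)))) => // [q Fq|].
  by rewrite /= row_mxEr mxE.
exact: smooth_onS (cinfP _).
Qed.

End StandardBundle.

(** * The standard algebroid with a given curvature *)

Section StandardData.
Variables (R : realType) (n : nat) (M : manifold R n).
Implicit Types (f : cinf M) (p : M) (a b c : section (std_bundle M)).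

Definition std_pairing p (e e' : std_bundle M p) : R :=
  (e : std_fibre p).2 (e' : std_fibre p).1 + (e' : std_fibre p).2 (e : std_fibre p).1.

Lemma std_anchor_linear p : linear (fun e : std_bundle M p => (e : std_fibre p).1).
Proof. exact: (@std_fibre_fst _ _ M p). Qed.

Definition std_anchor p : {linear std_bundle M p -> tangent p} :=
  HB.pack (fun e : std_bundle M p => (e : std_fibre p).1)
    (GRing.isLinear.Build _ _ _ _ _ (@std_anchor_linear p)).

Lemma std_pairing_linear p (e : std_bundle M p) : linear_for *%R (std_pairing e).
Proof.
move=> r u v; rewrite /std_pairing.
rewrite [(r *: u + v).1]std_fibre_fst [(r *: u + v).2]std_fibre_snd.
rewrite covector_linear covector_addE covector_scaleE.
by ring.
Qed.

Lemma std_pairing_sym p (e e' : std_bundle M p) : std_pairing e e' = std_pairing e' e.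
Proof. by rewrite /std_pairing addrC. Qed.

Lemma tangent_app_linear p f : linear_for *%R (fun v : tangent p => v f).
Proof. by move=> r u v; rewrite tangent_addE tangent_scaleE. Qed.

Lemma std_pairing_nondeg p (e : std_bundle M p) : (forall e', std_pairing e e' = 0) -> e = 0.
Proof.
case: e => v w H.
have w0 : w = 0.
  apply: covector_eq => u; have := H (u, 0).
  by rewrite /std_pairing /= addr0.
have v0 : v = 0.
  apply: tangent_eq => f; have := H (0, mkcovector (@tangent_app_linear p f)).
  by rewrite /std_pairing /= covector0 add0r.
by rewrite v0 w0.
Qed.

Definition std_vf a : vfield M := VField (std_tangent_smooth a).
Definition cov a (X : vfield M) : cinf M := mkcinf (std_covector_smooth a X).

Lemma std_pairing_smooth a b : smooth_on setT (fun p => std_pairing (a p) (b p)).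
Proof. exact: (cinfP (cov a (std_vf b) + cov b (std_vf a))). Qed.

Lemma zero_bracketl b (r : R) a a' :
  (0 : section (std_bundle M)) = ccst M r *: 0 + 0.
Proof. by rewrite scaler0 addr0. Qed.

(** The zero bracket is a stopgap: the Riesz isomorphism, needed to define the
    Dorfman bracket, only involves the pairing and the anchor. *)
Definition std_data0 : algebroid_data M :=
  @AlgebroidData _ _ M (std_bundle M) std_pairing std_anchor (fun _ _ => 0)
    std_pairing_linear std_pairing_sym std_pairing_nondeg std_pairing_smooth
    (@std_tangent_smooth _ _ M) zero_bracketl zero_bracketl.

Lemma dsection_smooth f (Y : vfield M) :
  smooth_on setT (fun p => mkcovector (@tangent_app_linear p f) (Y p)).
Proof. exact: (cinfP (vapp Y f)). Qed.
(** Pairing with [df] reads off the vector part of a section, see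
    [spairing_dsection]. *)
Definition dsection f : section (std_bundle M) :=
  Section_ (std_section_smooth (vzero M) (dsection_smooth f)).

Lemma spairing_dsection f (a : section std_data0) :
  spairing a (dsection f : section std_data0) = vapp (sanchor a) f.
Proof.
apply: cinf_eq => p; rewrite spairingE /pairing /= /std_pairing /=.
by rewrite covector0 add0r.
Qed.

Section Curved.
Variable T : tform2 M.
Local Notation A := std_data0.
Local Notation "[[ X , Y ]]" := (tbracket T X Y).

Lemma covE a X p : cov a X p = (a p : std_fibre p).2 (X p). Proof. by []. Qed.

Lemma cov_vcomb a f X Y : cov a (vcomb f X Y) = f * cov a X + cov a Y.
Proof.
apply: cinf_eq => p; rewrite covE.
have -> : vcomb f X Y p = f p *: X p + Y p by [].
by rewrite covector_linear.
Qed.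

Lemma cov_comb f (a b : section A) X : cov (f *: a + b) X = f * cov a X + cov b X.
Proof.
apply: cinf_eq => p; rewrite covE sectionDE sectionZE std_fibre_snd.
by rewrite covector_addE covector_scaleE.
Qed.

Lemma cov_skew a X Y : cov a [[X, Y]] = - cov a [[Y, X]].
Proof.
rewrite [in LHS]tbracket_skew cov_vcomb mulN1r.
have -> : cov a (vzero M) = 0 by apply: cinf_eq => p; rewrite covE covector0.
by rewrite addr0.
Qed.

Lemma cov_zero a (X : vfield M) : (forall p, X p = 0) -> cov a X = 0.
Proof. by move=> X0; apply: cinf_eq => p; rewrite covE X0 covector0. Qed.

Lemma spairing_cov (a b : section A) :
  spairing a b = cov a (sanchor b) + cov b (sanchor a).
Proof. by apply: cinf_eq. Qed.

(** [<[a, b], c>] for the bracket of [X + alpha] and [Y + beta] with vector part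
    [[X, Y]] and covector part
    [L_X beta - L_Y alpha + d (alpha Y)], where [L_X beta] maps [Z] to
    [X (beta Z) - beta [[X, Z]]].  No form of degree three enters: those come
    from twisting. *)
Definition dorfman (a b c : section A) : cinf M :=
  let X := sanchor a in let Y := sanchor b in let Z := sanchor c in
  cov c [[X, Y]] + vapp X (cov b Z) - cov b [[X, Z]]
  - vapp Y (cov a Z) + cov a [[Y, Z]] + vapp Z (cov a Y).

(** The derivatives of [f] coming from [vapp X (cov b Z)] and from
    [[[X, Z]]] cancel, and so do the others. *)
Lemma dorfman_linear (a b : section A) f (c c' : section A) :
  dorfman a b (f *: c + c') = f * dorfman a b c + dorfman a b c'.
Proof.
rewrite /dorfman sanchor_comb !tbracket_vcombr !cov_vcomb cov_comb vapp_vcomb.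
rewrite !vappD !vappM.
by ring.
Qed.

Definition dorfman_bracket (a b : section A) : section A :=
  sval (cid (riesz (dorfman_linear a b))).

Lemma dorfman_bracketE a b c : spairing (dorfman_bracket a b) c = dorfman a b c.
Proof. exact: (svalP (cid (riesz (dorfman_linear a b)))). Qed.

Lemma dorfman_bracketl (b : section A) (r : R) (a a' : section A) :
  dorfman_bracket (ccst M r *: a + a') b =
  ccst M r *: dorfman_bracket a b + dorfman_bracket a' b.
Proof.
apply: spairing_inj => c; rewrite spairingDl spairingZl !dorfman_bracketE /dorfman.
rewrite sanchor_comb !cov_comb (cov_skew c (vcomb _ _ _)) (cov_skew b (vcomb _ _ _)).
rewrite !tbracket_vcombr !cov_vcomb !vapp_vcomb !vappD !vappM !vapp_cst.
rewrite (cov_skew c (sanchor a)) (cov_skew c (sanchor a')).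
rewrite (cov_skew b (sanchor a)) (cov_skew b (sanchor a')).
by ring.
Qed.

Lemma dorfman_bracketr (b : section A) (r : R) (a a' : section A) :
  dorfman_bracket b (ccst M r *: a + a') =
  ccst M r *: dorfman_bracket b a + dorfman_bracket b a'.
Proof.
apply: spairing_inj => c; rewrite spairingDl spairingZl !dorfman_bracketE /dorfman.
rewrite sanchor_comb !cov_comb (cov_skew b (vcomb _ _ _)).
rewrite !tbracket_vcombr !cov_vcomb !vapp_vcomb !vappD !vappM !vapp_cst.
rewrite (cov_skew b (sanchor a)) (cov_skew b (sanchor a')).
by ring.
Qed.

Definition std_data : algebroid_data M := set_bracket dorfman_bracketl dorfman_bracketr.

Lemma std_metric : metric_algebroid std_data.
Proof.
apply/metric_algebroidP; split=> [a b c|a b c].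
  rewrite [X in X + _](dorfman_bracketE a b c) [X in _ + X](dorfman_bracketE b a c).
  rewrite /dorfman (cov_skew c (sanchor b)).
  rewrite [in RHS](_ : spairing a b = cov a (sanchor (b : section A)) + cov b (sanchor (a : section A)));
    last exact: spairing_cov.
  rewrite vappD; ring.
rewrite [X in _ = _ + X]spairingC [X in X + _](dorfman_bracketE a b c) [X in _ + X](dorfman_bracketE a c b).
rewrite /dorfman (cov_skew a (sanchor c)).
rewrite (_ : spairing b c = cov b (sanchor (c : section A)) + cov c (sanchor (b : section A)));
  last exact: spairing_cov.
by rewrite vappD; ring.
Qed.

Lemma std_curvature : has_curvature std_data T.
Proof.
apply/has_curvatureP => a b.
apply: vfield_eq => p; apply: tangent_eq => f.
have := congr1 (fun f : cinf M => f p) (dorfman_bracketE a b (dsection f)).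
rewrite spairing_dsection /dorfman.
have zE : sanchor (dsection f : section A) = vzero M by exact: vfield_eq.
have z (q : M) : vzero M q = 0 by [].
rewrite zE.
have z1 (X : vfield M) : cov b [[X, vzero M]] = 0.
  apply: cinf_eq => q; rewrite cov_skew cinfN cov_zero ?oppr0 // => q'.
  exact: tbracket_zerol.
have z2 (X : vfield M) : cov a [[X, vzero M]] = 0.
  apply: cinf_eq => q; rewrite cov_skew cinfN cov_zero ?oppr0 // => q'.
  exact: tbracket_zerol.
rewrite z1 z2 !(cov_zero _ z) !vapp0 !subr0 !addr0.
have -> : vapp (vzero M) (cov a (sanchor (b : section A))) = 0.
  exact: cinf_eq.
by rewrite addr0; apply.
Qed.

Lemma std_coanchor p (w : tangent p -> R) (lw : linear_for *%R w) :
  coanchor std_data w = (0, mkcovector lw) :> std_fibre p.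
Proof.
apply: (@pairing_inj _ _ _ std_data) => u; rewrite coanchorP //.
by rewrite /pairing /= /std_pairing /= covector0 addr0.
Qed.

Lemma std_exact : exact_algebroid std_data.
Proof.
move=> p; split=> [al be ab v|e|v].
- have := ab; rewrite (std_coanchor (fun r u v => linearP al r u v)).
  rewrite (std_coanchor (fun r u v => linearP be r u v)) => -[] abv.
  by rewrite abv.
- case: e => v w; split=> [v0|[al ->] ]; last first.
    by rewrite (std_coanchor (fun r u v => linearP al r u v)).
  have lw : linear (w : tangent p -> R^o) by move=> r x y; exact: covector_linear.
  pose al : {linear tangent p -> R^o} := HB.pack (w : tangent p -> R^o)
    (GRing.isLinear.Build _ _ _ _ _ lw).
  have {}v0 : v = 0 := v0.
  exists al; rewrite v0 (std_coanchor (fun r u v => linearP al r u v)); congr pair.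
  exact: covector_eq.
- by exists ((v, 0) : std_fibre p).
Qed.

End Curved.
End StandardData.

(** * Values of two-forms and three-forms *)

Section Tuples.
Variable V : Type.
Definition duo (x y : V) : 'I_2 -> V := fun i => if val i == 0%N then x else y.
Definition tri (x y z : V) : 'I_3 -> V :=
  fun i => if val i == 0%N then x else if val i == 1%N then y else z.

Lemma forall_ord2 (P : 'I_2 -> Prop) : P (@Ordinal 2 0 isT) -> P (@Ordinal 2 1 isT) -> forall i, P i.
Proof.
move=> P0 P1 [[|[|//]] i].
- by rewrite (_ : Ordinal i = @Ordinal 2 0 isT) //; apply: val_inj.
- by rewrite (_ : Ordinal i = @Ordinal 2 1 isT) //; apply: val_inj.
Qed.

Lemma forall_ord3 (P : 'I_3 -> Prop) : P (@Ordinal 3 0 isT) -> P (@Ordinal 3 1 isT) ->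
  P (@Ordinal 3 2 isT) -> forall i, P i.
Proof.
move=> P0 P1 P2 [[|[|[|//]]] i].
- by rewrite (_ : Ordinal i = @Ordinal 3 0 isT) //; apply: val_inj.
- by rewrite (_ : Ordinal i = @Ordinal 3 1 isT) //; apply: val_inj.
- by rewrite (_ : Ordinal i = @Ordinal 3 2 isT) //; apply: val_inj.
Qed.

Lemma duo_eta (v : 'I_2 -> V) : v = duo (v (@Ordinal 2 0 isT)) (v (@Ordinal 2 1 isT)).
Proof. by apply/funext; elim/forall_ord2. Qed.
Lemma tri_eta (v : 'I_3 -> V) :
  v = tri (v (@Ordinal 3 0 isT)) (v (@Ordinal 3 1 isT)) (v (@Ordinal 3 2 isT)).
Proof. by apply/funext; elim/forall_ord3. Qed.
End Tuples.

Section FormValues.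
Variables (R : realType) (n : nat) (M : manifold R n).
Implicit Types (p : M).

Lemma tri_vfield (X Y Z : vfield M) p :
  (fun i => tri X Y Z i p) = tri (X p) (Y p) (Z p).
Proof. by apply/funext; elim/forall_ord3. Qed.
Lemma duo_vfield (X Y : vfield M) p : (fun i => duo X Y i p) = duo (X p) (Y p).
Proof. by apply/funext; elim/forall_ord2. Qed.

Section Three.
Variables (w : dform M 3) (p : M).
Implicit Types x y z : tangent p.

Lemma form3_linear1 r x x' y z :
  w p (tri (r *: x + x') y z) = r * w p (tri x y z) + w p (tri x' y z).
Proof.
have E u : update (tri x y z) (@Ordinal 3 0 isT) u = tri u y z.
  by apply/funext; elim/forall_ord3.
by have := form_multilinear w (tri x y z) (@Ordinal 3 0 isT) r x x'; rewrite !E.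
Qed.
Lemma form3_linear2 r x y y' z :
  w p (tri x (r *: y + y') z) = r * w p (tri x y z) + w p (tri x y' z).
Proof.
have E u : update (tri x y z) (@Ordinal 3 1 isT) u = tri x u z.
  by apply/funext; elim/forall_ord3.
by have := form_multilinear w (tri x y z) (@Ordinal 3 1 isT) r y y'; rewrite !E.
Qed.
Lemma form3_linear3 r x y z z' :
  w p (tri x y (r *: z + z')) = r * w p (tri x y z) + w p (tri x y z').
Proof.
have E u : update (tri x y z) (@Ordinal 3 2 isT) u = tri x y u.
  by apply/funext; elim/forall_ord3.
by have := form_multilinear w (tri x y z) (@Ordinal 3 2 isT) r z z'; rewrite !E.
Qed.
Lemma form3_alt12 x z : w p (tri x x z) = 0.
Proof. exact: (@form_alternating _ _ _ _ w p (tri x x z) (@Ordinal 3 0 isT) (@Ordinal 3 1 isT)). Qed.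
Lemma form3_alt23 x z : w p (tri x z z) = 0.
Proof. exact: (@form_alternating _ _ _ _ w p (tri x z z) (@Ordinal 3 1 isT) (@Ordinal 3 2 isT)). Qed.
Lemma form3_skew12 x y z : w p (tri x y z) = - w p (tri y x z).
Proof.
have := form3_alt12 (1 *: x + y) z.
rewrite form3_linear1 !form3_linear2 !form3_alt12 !mul1r add0r addr0 => /eqP.
by rewrite addr_eq0 => /eqP.
Qed.
Lemma form3_skew23 x y z : w p (tri x y z) = - w p (tri x z y).
Proof.
have := form3_alt23 x (1 *: y + z).
rewrite form3_linear2 !form3_linear3 !form3_alt23 !mul1r add0r addr0 => /eqP.
by rewrite addr_eq0 => /eqP.
Qed.
End Three.

Section Two.
Variables (w : dform M 2) (p : M).
Implicit Types x y : tangent p.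
Lemma form2_linear1 r x x' y :
  w p (duo (r *: x + x') y) = r * w p (duo x y) + w p (duo x' y).
Proof.
have E u : update (duo x y) (@Ordinal 2 0 isT) u = duo u y.
  by apply/funext; elim/forall_ord2.
by have := form_multilinear w (duo x y) (@Ordinal 2 0 isT) r x x'; rewrite !E.
Qed.
Lemma form2_linear2 r x y y' :
  w p (duo x (r *: y + y')) = r * w p (duo x y) + w p (duo x y').
Proof.
have E u : update (duo x y) (@Ordinal 2 1 isT) u = duo x u.
  by apply/funext; elim/forall_ord2.
by have := form_multilinear w (duo x y) (@Ordinal 2 1 isT) r y y'; rewrite !E.
Qed.
Lemma form2_alt x : w p (duo x x) = 0.
Proof. exact: (@form_alternating _ _ _ _ w p (duo x x) (@Ordinal 2 0 isT) (@Ordinal 2 1 isT)). Qed.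
Lemma form2_skew x y : w p (duo x y) = - w p (duo y x).
Proof.
have := form2_alt (1 *: x + y).
rewrite form2_linear1 !form2_linear2 !form2_alt !mul1r add0r addr0 => /eqP.
by rewrite addr_eq0 => /eqP.
Qed.
Lemma form2_0l x : w p (duo 0 x) = 0.
Proof.
by have := form2_linear1 (-1) 0 0 x; rewrite scaler0 addr0 mulN1r addNr.
Qed.
Lemma form2_0r x : w p (duo x 0) = 0.
Proof. by rewrite form2_skew form2_0l oppr0. Qed.
End Two.

Definition ev3 (w : dform M 3) (X Y Z : vfield M) : cinf M := form_app w (tri X Y Z).
Definition ev2 (w : dform M 2) (X Y : vfield M) : cinf M := form_app w (duo X Y).
Lemma ev3E w X Y Z p : ev3 w X Y Z p = w p (tri (X p) (Y p) (Z p)).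
Proof. by rewrite -tri_vfield. Qed.
Lemma ev2E w X Y p : ev2 w X Y p = w p (duo (X p) (Y p)).
Proof. by rewrite -duo_vfield. Qed.

Lemma ev3_skew12 w X Y Z : ev3 w X Y Z = - ev3 w Y X Z.
Proof. by apply: cinf_eq => p; rewrite cinfN !ev3E form3_skew12. Qed.
Lemma ev3_skew23 w X Y Z : ev3 w X Y Z = - ev3 w X Z Y.
Proof. by apply: cinf_eq => p; rewrite cinfN !ev3E form3_skew23. Qed.
Lemma ev3_vcomb3 w X Y f Z Z' : ev3 w X Y (vcomb f Z Z') = f * ev3 w X Y Z + ev3 w X Y Z'.
Proof. by apply: cinf_eq => p; rewrite cinfD cinfM !ev3E -form3_linear3. Qed.
Lemma ev3_vcomb1 w f X X' Y Z : ev3 w (vcomb f X X') Y Z = f * ev3 w X Y Z + ev3 w X' Y Z.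
Proof. by apply: cinf_eq => p; rewrite cinfD cinfM !ev3E -form3_linear1. Qed.
Lemma ev3_vcomb2 w f X Y Y' Z : ev3 w X (vcomb f Y Y') Z = f * ev3 w X Y Z + ev3 w X Y' Z.
Proof. by apply: cinf_eq => p; rewrite cinfD cinfM !ev3E -form3_linear2. Qed.
Lemma ev2_skew w X Y : ev2 w X Y = - ev2 w Y X.
Proof. by apply: cinf_eq => p; rewrite cinfN !ev2E form2_skew. Qed.
Lemma ev2_0r w (X Y : vfield M) : (forall p, Y p = 0) -> ev2 w X Y = 0.
Proof. by move=> X0; apply: cinf_eq => p; rewrite ev2E X0 form2_0r. Qed.

End FormValues.

(** * Exact algebroids and descent of tensors to the base *)

Section Exact.
Variables (R : realType) (n : nat) (M : manifold R n) (A : algebroid_data M).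
Hypothesis eA : exact_algebroid A.
Implicit Types (f : cinf M) (p : M) (a b c : section A).

Lemma anchor_lift p (v : tangent p) : exists a, sanchor a p = v.
Proof.
have [_ _ /(_ v) [e <-]] := eA p; have [a <-] := section_through e.
by exists a.
Qed.

(** An element of the kernel of the anchor is some [rho^* alpha]. *)
Lemma ker_pairing p (e u u' : A p) : anchor A p e = 0 ->
  anchor A p u = anchor A p u' -> pairing e u = pairing e u'.
Proof.
have [_ /(_ e) [H _] _] := eA p => /H [al ->] uu'.
have la : linear_for *%R al by move=> r x y; rewrite linearP.
by rewrite !coanchorP // uu'.
Qed.

Lemma ker_isotropic p (e u : A p) : anchor A p e = 0 -> anchor A p u = 0 -> pairing e u = 0.
Proof. by move=> e0 u0; rewrite (@ker_pairing _ e u 0) ?pairing0r // u0 linear0. Qed.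

Lemma anchor_coanchor p (w : tangent p -> R) : linear_for *%R w ->
  anchor A p (coanchor A w) = 0.
Proof.
move=> lw; have [_ /(_ (coanchor A w)) [_ H] _] := eA p; apply: H.
have lw' : linear (w : tangent p -> R^o) by move=> r x y; exact: lw.
pose al : {linear tangent p -> R^o} := HB.pack (w : tangent p -> R^o)
  (GRing.isLinear.Build _ _ _ _ _ lw').
by exists al.
Qed.

Lemma coanchor_unique p (e : A p) (w : tangent p -> R) : linear_for *%R w ->
  (forall u, pairing e u = w (anchor A p u)) -> e = coanchor A w.
Proof. by move=> lw H; apply: pairing_inj => u; rewrite H coanchorP. Qed.

(** The converse of [ker_pairing]: pairing through the anchor forces
    [e = rho^* w]. *)
Lemma anchor_of_pairing p (e : A p) (w : tangent p -> R) : linear_for *%R w ->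
  (forall u, pairing e u = w (anchor A p u)) -> anchor A p e = 0.
Proof. by move=> lw H; rewrite (coanchor_unique lw H) anchor_coanchor. Qed.

Section Descent.
Hypothesis lift : forall X : vfield M, exists a, sanchor a = X.

Definition upd k (a : 'I_k -> section A) (i : 'I_k) (x : section A) : 'I_k -> section A :=
  fun j => if j == i then x else a j.

Variables (k : nat) (Phi : ('I_k -> section A) -> cinf M).
Hypothesis Phi_lin : forall (a : 'I_k -> section A) i f x y,
  Phi (upd a i (f *: x + y)) = f * Phi (upd a i x) + Phi (upd a i y).
Hypothesis Phi_alt : forall (a : 'I_k -> section A) i j, i != j -> a i = a j -> Phi a = 0.
Hypothesis Phi_ker : forall (a : 'I_k -> section A) i p, sanchor (a i) p = 0 -> Phi a p = 0.

(** The arguments are changed one at a time; [mix m] has the first [m] of them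
    replaced. *)
Lemma descent_local (a b : 'I_k -> section A) p : (forall i, sanchor (a i) p = sanchor (b i) p) ->
  Phi a p = Phi b p.
Proof.
have one d i x y : sanchor x p = sanchor y p -> Phi (upd d i x) p = Phi (upd d i y) p.
  move=> xy; have -> : x = 1 *: y + (x - y) by rewrite scale1r subrKC.
  rewrite Phi_lin mul1r cinfD (_ : Phi (upd d i (x - y)) p = 0) ?addr0 //.
  apply: (Phi_ker (i := i)); rewrite /upd eqxx sanchorE sectionBE linearB.
  by move: xy; rewrite !sanchorE => ->; rewrite subrr.
move=> ab; pose mix m (i : 'I_k) := if (i < m)%N then b i else a i.
have -> : a = mix 0%N by apply/funext => i; rewrite /mix.
have -> : b = mix k by apply/funext => i; rewrite /mix ltn_ord.
have H m : (m <= k)%N -> Phi (mix 0%N) p = Phi (mix m) p.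
  elim: m => // m IH mk; rewrite (IH (ltnW mk)).
  pose i := Ordinal mk.
  have -> : mix m = upd (mix m) i (a i).
    by apply/funext => j; rewrite /upd; case: eqP => // ->; rewrite /mix ltnn.
  have -> : mix m.+1 = upd (mix m) i (b i).
    apply/funext => j; rewrite /upd /mix ltnS leq_eqVlt.
    rewrite -[(j : nat) == m]/(j == i).
    by case: (eqVneq j i) => [->|ji]; rewrite ?eqxx.
  exact: one.
exact: H.
Qed.

Lemma descend : exists w : dform M k, forall (a : 'I_k -> section A) p, w p (fun i => sanchor (a i) p) = Phi a p.
Proof.
pose s p (v : tangent p) : section A := sval (cid (anchor_lift v)).
have sE p (v : tangent p) : sanchor (s p v) p = v := svalP (cid (anchor_lift v)).
pose w p (v : 'I_k -> tangent p) : R := Phi (fun i => s p (v i)) p.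
have wE (a : 'I_k -> section A) p : w p (fun i => sanchor (a i) p) = Phi a p.
  by apply: descent_local => i; rewrite sE.
have wm p : multilinear (@w p).
  move=> v i r x y; rewrite /w.
  have E z t : sanchor t p = z -> Phi (fun j => s p (update v i z j)) p =
      Phi (upd (fun j => s p (v j)) i t) p.
    move=> tz; apply: descent_local => j; rewrite sE /update /upd.
    by case: eqP => // _; rewrite sE.
  rewrite (E x (s p x)) ?sE // (E y (s p y)) ?sE //.
  rewrite (E (r *: x + y) (ccst M r *: s p x + s p y)).
    by rewrite Phi_lin.
  rewrite sanchor_comb -[RHS]/(r *: x + y) -{2}(sE p x) -{2}(sE p y).
  by [].
have wa p : is_alternating (@w p).
  by move=> v i j ij vij; rewrite /w (Phi_alt (i := i) (j := j)) // vij.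
have ws (X : 'I_k -> vfield M) : smooth_on setT (fun p => w p (fun i => X i p)).
  have [a aX] := choice lift.
  have -> : (fun p => w p (fun i => X i p)) = Phi (fun i => a (X i)).
    by apply/funext => p; rewrite -wE; congr (w p _); apply/funext => i; rewrite aX.
  exact: cinfP.
by exists (Form wm wa ws).
Qed.

End Descent.

Section Descent23.
Hypothesis lift : forall X : vfield M, exists a, sanchor a = X.

(** Function-linearity in the last argument spreads to the others by
    skew-symmetry, and so does vanishing on the kernel of the anchor. *)
Lemma descend3 (F : section A -> section A -> section A -> cinf M) :
  (forall a b f c c', F a b (f *: c + c') = f * F a b c + F a b c') ->
  (forall a b c, F a b c = - F b a c) -> (forall a b c, F a b c = - F a c b) ->
  (forall a b c p, sanchor c p = 0 -> F a b c p = 0) ->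
  exists w : dform M 3, forall a b c, ev3 w (sanchor a) (sanchor b) (sanchor c) = F a b c.
Proof.
move=> F3 s12 s23 Fk.
pose Phi (a : 'I_3 -> section A) :=
  F (a (@Ordinal 3 0 isT)) (a (@Ordinal 3 1 isT)) (a (@Ordinal 3 2 isT)).
have F2 a f b b' c : F a (f *: b + b') c = f * F a b c + F a b' c.
  by rewrite s23 F3 opprD -mulrN -!(s23 a _ c).
have F1 f a a' b c : F (f *: a + a') b c = f * F a b c + F a' b c.
  by rewrite s12 F2 opprD -mulrN -!(s12 _ b).
have a23 a b : F a b b = 0.
  have /eqP := s23 a b b; rewrite -addr_eq0 -mulr2n => /eqP H.
  apply: cinf_eq => p; have := congr1 (fun f : cinf M => f p) H; rewrite mulr2n cinfD cinf0.
  by move=> /eqP; rewrite -mulr2n mulrn_eq0 /= => /eqP.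
have a12 a b : F a a b = 0 by rewrite s23 s12 a23 !oppr0.
have a13 a b : F a b a = 0 by rewrite s12 a23 oppr0.
have k2 a b c p : sanchor b p = 0 -> F a b c p = 0.
  by move=> b0; rewrite s23 cinfN Fk ?oppr0.
have k1 a b c p : sanchor a p = 0 -> F a b c p = 0.
  by move=> b0; rewrite s12 cinfN k2 ?oppr0.
have [||| w wE] := @descend lift 3 Phi.
- by move=> a i f x y; move: i; elim/forall_ord3; rewrite /Phi /upd /= ?F1 ?F2 ?F3.
- move=> a i j; move: i j; elim/forall_ord3; elim/forall_ord3 => //= _ E; rewrite /Phi.
  + by rewrite E a12.
  + by rewrite E a13.
  + by rewrite E a12.
  + by rewrite E a23.
  + by rewrite E a13.
  + by rewrite E a23.
- by move=> a i p; move: i; elim/forall_ord3 => a0; rewrite /Phi; [exact: k1|exact: k2|exact: Fk].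
exists w => a b c; apply: cinf_eq => p; rewrite ev3E.
have := wE (tri a b c) p; rewrite /Phi /= => <-.
by congr (w p _); apply/funext; elim/forall_ord3.
Qed.

Lemma descend2 (F : section A -> section A -> cinf M) :
  (forall a f c c', F a (f *: c + c') = f * F a c + F a c') ->
  (forall a b, F a b = - F b a) ->
  (forall a c p, sanchor c p = 0 -> F a c p = 0) ->
  exists w : dform M 2, forall a b, ev2 w (sanchor a) (sanchor b) = F a b.
Proof.
move=> F2 s12 k2.
pose Phi (a : 'I_2 -> section A) := F (a (@Ordinal 2 0 isT)) (a (@Ordinal 2 1 isT)).
have F1 f a a' b : F (f *: a + a') b = f * F a b + F a' b.
  by rewrite s12 F2 opprD -mulrN -!(s12 _ b).
have a12 a : F a a = 0.
  have /eqP := s12 a a; rewrite -addr_eq0 -mulr2n => /eqP H.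
  apply: cinf_eq => p; have := congr1 (fun f : cinf M => f p) H; rewrite mulr2n cinfD cinf0.
  by move=> /eqP; rewrite -mulr2n mulrn_eq0 /= => /eqP.
have k1 a b p : sanchor a p = 0 -> F a b p = 0.
  by move=> b0; rewrite s12 cinfN k2 ?oppr0.
have [||| w wE] := @descend lift 2 Phi.
- by move=> a i f x y; move: i; elim/forall_ord2; rewrite /Phi /upd /= ?F1 ?F2.
- by move=> a i j; move: i j; elim/forall_ord2; elim/forall_ord2 => //= _ E; rewrite /Phi E a12.
- by move=> a i p; move: i; elim/forall_ord2 => a0; rewrite /Phi; [exact: k1|exact: k2].
exists w => a b; apply: cinf_eq => p; rewrite ev2E.
have := wE (duo a b) p; rewrite /Phi /= => <-.
by congr (w p _); apply/funext; elim/forall_ord2.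
Qed.

End Descent23.
End Exact.

(** * Twisting by a three-form, and comparison of brackets *)

Section BracketCalculus.
Variables (R : realType) (n : nat) (M : manifold R n) (A : algebroid_data M).
Implicit Types (f : cinf M) (p : M) (a b c : section A).

Lemma ccst1 : ccst M 1 = 1. Proof. exact: cinf_eq. Qed.

Lemma bracketDl a a' b : bracket (a + a') b = bracket a b + bracket a' b.
Proof. by have := bracket_linearl b 1 a a'; rewrite ccst1 !scale1r. Qed.
Lemma bracketDr a b b' : bracket a (b + b') = bracket a b + bracket a b'.
Proof. by have := bracket_linearr a 1 b b'; rewrite ccst1 !scale1r. Qed.

Hypothesis mA : metric_algebroid A.

Lemma bracket_symm a b c :
  spairing (bracket a b) c = vapp (sanchor c) (spairing a b) - spairing (bracket b a) c.
Proof. by have [H _] := (metric_algebroidP A).1 mA; rewrite -H addrK. Qed.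

Lemma bracket_deriv a b c :
  spairing (bracket a b) c = vapp (sanchor a) (spairing b c) - spairing b (bracket a c).
Proof. by have [_ H] := (metric_algebroidP A).1 mA; rewrite H addrK. Qed.

End BracketCalculus.

Section Twist.
Variables (R : realType) (n : nat) (M : manifold R n) (T : tform2 M) (A : algebroid_data M).
Hypotheses (mA : metric_algebroid A) (eA : exact_algebroid A) (cT : has_curvature A T).
Variable H : dform M 3.
Implicit Types (f : cinf M) (p : M) (a b c : section A).

Lemma twist_term_linear a b f c c' :
  ev3 H (sanchor a) (sanchor b) (sanchor (f *: c + c')) =
  f * ev3 H (sanchor a) (sanchor b) (sanchor c) + ev3 H (sanchor a) (sanchor b) (sanchor c').
Proof. by rewrite sanchor_comb ev3_vcomb3. Qed.

Definition twist_term a b : section A := sval (cid (riesz (twist_term_linear a b))).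
Lemma twist_termE a b c :
  spairing (twist_term a b) c = ev3 H (sanchor a) (sanchor b) (sanchor c).
Proof. exact: (svalP (cid (riesz (twist_term_linear a b)))). Qed.

Definition twist_bracket a b := bracket a b + twist_term a b.

Lemma twist_bracketE a b c : spairing (twist_bracket a b) c =
  spairing (bracket a b) c + ev3 H (sanchor a) (sanchor b) (sanchor c).
Proof. by rewrite spairingDl twist_termE. Qed.

Lemma twist_bracketl b (r : R) a a' :
  twist_bracket (ccst M r *: a + a') b = ccst M r *: twist_bracket a b + twist_bracket a' b.
Proof.
apply: spairing_inj => c; rewrite [RHS]spairingDl [X in _ = X + _]spairingZl !twist_bracketE bracket_linearl.
by rewrite sanchor_comb ev3_vcomb1 spairingDl !spairingZl; ring.
Qed.
Lemma twist_bracketr b (r : R) a a' :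
  twist_bracket b (ccst M r *: a + a') = ccst M r *: twist_bracket b a + twist_bracket b a'.
Proof.
apply: spairing_inj => c; rewrite [RHS]spairingDl [X in _ = X + _]spairingZl !twist_bracketE bracket_linearr.
by rewrite sanchor_comb ev3_vcomb2 spairingDl !spairingZl; ring.
Qed.

Definition twist : algebroid_data M := set_bracket twist_bracketl twist_bracketr.

Lemma twist_term_anchor a b p : anchor A p (twist_term a b p) = 0.
Proof.
have lw : linear_for *%R (fun v => H p (tri (sanchor a p) (sanchor b p) v)).
  by move=> r u v; rewrite form3_linear3.
apply: (anchor_of_pairing eA lw) => u; have [c <-] := section_through u.
have := congr1 (fun f : cinf M => f p) (twist_termE a b c); rewrite ev3E.
by [].
Qed.

Lemma twist_metric : metric_algebroid twist.
Proof.
have [H1 H2] := (metric_algebroidP A).1 mA.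
apply/metric_algebroidP; split=> a b c.
  rewrite [X in X + _](twist_bracketE a b c) [X in _ + X](twist_bracketE b a c).
  by rewrite ev3_skew12 addrACA [X in _ + X = _]addNr addr0 H1.
rewrite [X in X + _](twist_bracketE a b c) [X in _ + X]spairingC [X in _ + X](twist_bracketE a c b).
rewrite ev3_skew23 addrACA [X in _ + X]addNr addr0.
by rewrite [X in _ = _ + X]spairingC; exact: H2.
Qed.

Lemma twist_curvature : has_curvature twist T.
Proof.
move/has_curvatureP: cT => cT'; apply/has_curvatureP => a b.
rewrite -[RHS]cT'; apply: vfield_eq => p; rewrite !sanchorE.
rewrite -[LHS]/(anchor A p ((bracket (a : section A) b + twist_term a b) p)).
by rewrite sectionDE linearD [X in _ + X]twist_term_anchor addr0.
Qed.

Lemma twist_exact : exact_algebroid twist. Proof. exact: eA. Qed.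

Definition twist_ecca : exact_cca T :=
  ExactCCA (curvature_cca twist_metric twist_curvature) twist_exact twist_curvature.

End Twist.

Section Isometry.
Variables (R : realType) (n : nat) (M : manifold R n) (T : tform2 M) (A A' : algebroid_data M).
Hypotheses (mA : metric_algebroid A) (eA : exact_algebroid A) (cT : has_curvature A T).
Hypotheses (mA' : metric_algebroid A') (eA' : exact_algebroid A') (cT' : has_curvature A' T).
Hypothesis lift : forall X : vfield M, exists a : section A, sanchor a = X.
Variable phi : vbmorphism A A'.
Hypothesis phi_iso : forall p (e e' : A p), pairing (phi p e) (phi p e') = pairing e e'.
Hypothesis phi_anchor : forall p (e : A p), anchor A' p (phi p e) = anchor A p e.
Implicit Types (f : cinf M) (p : M) (a b c : section A).
Local Notation Phi := (vbm_app phi).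

Lemma vbm_appE a p : Phi a p = phi p (a p). Proof. by []. Qed.
Lemma vbm_spairing a b : spairing (Phi a) (Phi b) = spairing a b.
Proof. by apply: cinf_eq => p; rewrite !spairingE phi_iso. Qed.
Lemma vbm_sanchor a : sanchor (Phi a) = sanchor a.
Proof. by apply: vfield_eq => p; rewrite !sanchorE phi_anchor. Qed.
Lemma vbm_comb f a b : Phi (f *: a + b) = f *: Phi a + Phi b.
Proof.
by apply: section_eq => p; rewrite vbm_appE !sectionDE !sectionZE linearP.
Qed.

Definition bracket_diff a b c : cinf M :=
  spairing (bracket (Phi a) (Phi b)) (Phi c) - spairing (bracket a b) c.

(** The core of the classification.  The derivative terms of the metric axioms
    are the same for both brackets, so [bracket_diff] is skew in all arguments,
    whereas it is visibly function-linear in the last one.  It vanishes when [c]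
    lies in the kernel of the anchor because [[phi a, phi b]] and [phi [a, b]]
    have the same anchor, given by the common curvature. *)
Lemma bracket_diff_descends : exists w : dform M 3,
  forall a b c, ev3 w (sanchor a) (sanchor b) (sanchor c) = bracket_diff a b c.
Proof.
apply: (descend3 eA lift) => [a b f c c'|a b c|a b c|a b c p c0]; rewrite /bracket_diff.
- by rewrite vbm_comb !spairingDr !spairingZr; ring.
- rewrite (bracket_symm mA') (bracket_symm mA a) vbm_sanchor vbm_spairing; ring.
- rewrite (bracket_deriv mA') (bracket_deriv mA a) vbm_sanchor vbm_spairing.
  by rewrite (spairingC (Phi b) (bracket _ _)) (spairingC b (bracket _ _)); ring.
rewrite cinfB !spairingE [X in X - _]pairing_sym vbm_appE.
rewrite (@ker_pairing _ _ _ _ eA' p _ _ (phi p (bracket a b p))).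
- by rewrite phi_iso pairing_sym subrr.
- by rewrite phi_anchor.
- rewrite phi_anchor.
  have /has_curvatureP cE := cT; have /has_curvatureP cE' := cT'.
  have := congr1 (fun X : vfield M => X p) (cE' (Phi a) (Phi b)).
  rewrite !vbm_sanchor -cE !sanchorE.
  by [].
Qed.

End Isometry.

(** * B-fields and the exterior derivative of a two-form *)

Section CurvedDifferential.
Variables (R : realType) (n : nat) (M : manifold R n) (T : tform2 M) (B : dform M 2).

(** The invariant formula for [d^T B]: the one for [d B] with the Lie bracket
    corrected by [T(X, Y)]. *)
Definition curved_formula (X Y Z : vfield M) : cinf M :=
  vapp X (ev2 B Y Z) - vapp Y (ev2 B X Z) + vapp Z (ev2 B X Y)
  - ev2 B (tbracket T X Y) Z + ev2 B (tbracket T X Z) Y - ev2 B (tbracket T Y Z) X.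
End CurvedDifferential.

Section BField.
Variables (R : realType) (n : nat) (M : manifold R n) (T : tform2 M) (A : algebroid_data M).
Hypotheses (mA : metric_algebroid A) (eA : exact_algebroid A) (cT : has_curvature A T).
Variable B : dform M 2.
Implicit Types (f : cinf M) (p : M) (a b c : section A).

Lemma bfield_anchor (be : section A -> section A) :
  (forall a c, spairing (be a) c = ev2 B (sanchor a) (sanchor c)) ->
  forall a p, sanchor (be a) p = 0.
Proof.
move=> beE a p; rewrite sanchorE.
have lw : linear_for *%R (fun v => B p (duo (sanchor a p) v)).
  by move=> r u v; rewrite form2_linear2.
apply: (anchor_of_pairing eA lw) => u; have [c <-] := section_through u.
have := congr1 (fun f : cinf M => f p) (beE a c); rewrite ev2E.
by [].
Qed.

(** [be a = rho^* (B (rho a))] has anchor zero, so the terms of degree two and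
    three in [be] vanish: there the bracket lies in the kernel of the anchor.
    The terms linear in [be] are computed from the metric axioms. *)
Lemma bfield_expand (be : section A -> section A) :
  (forall a c, spairing (be a) c = ev2 B (sanchor a) (sanchor c)) ->
  forall a b c, spairing (bracket (a + be a) (b + be b)) (c + be c) - spairing (bracket a b) c =
    curved_formula T B (sanchor a) (sanchor b) (sanchor c).
Proof.
move=> beE a b c; have be0 := bfield_anchor beE.
have /has_curvatureP cE := cT.
have sv x : sanchor (be x) = vzero M by apply: vfield_eq => p; exact: be0.
have N0 X : ev2 B X (tbracket T (vzero M) (sanchor c)) = 0.
  by apply: ev2_0r => p; exact: tbracket_zerol.
have K1 x y : spairing (bracket x (be y)) (be c) = 0.
  rewrite spairingC beE cE sv; apply: ev2_0r => p.
  rewrite tbracket_skew; apply: tangent_eq => f.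
  by rewrite vcombE tbracket_zerol !tangent_zeroE mulr0 addr0.
have K2 x y : spairing (bracket (be x) y) (be c) = 0.
  by rewrite spairingC beE cE sv; apply: ev2_0r => p; exact: tbracket_zerol.
have K3 : spairing (bracket (be a) (be b)) c = 0.
  rewrite (bracket_deriv mA) beE beE cE sv N0 subr0.
  exact: cinf_eq.
have E1 : spairing (bracket a b) (be c) = ev2 B (sanchor c) (tbracket T (sanchor a) (sanchor b)).
  by rewrite spairingC beE cE.
have E2 : spairing (bracket a (be b)) c = vapp (sanchor a) (ev2 B (sanchor b) (sanchor c))
    - ev2 B (sanchor b) (tbracket T (sanchor a) (sanchor c)).
  by rewrite (bracket_deriv mA) !beE cE.
have E3 : spairing (bracket (be a) b) c = vapp (sanchor c) (ev2 B (sanchor a) (sanchor b))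
    - (vapp (sanchor b) (ev2 B (sanchor a) (sanchor c))
       - ev2 B (sanchor a) (tbracket T (sanchor b) (sanchor c))).
  by rewrite (bracket_symm mA) (bracket_deriv mA) !beE cE.
rewrite bracketDl !bracketDr !spairingDr !spairingDl K1 !K2 K3 E1 E2 E3 /curved_formula.
rewrite (ev2_skew B (sanchor c)) (ev2_skew B (sanchor b) (tbracket _ _ _)).
rewrite (ev2_skew B (sanchor a) (tbracket _ _ _)).
by ring.
Qed.

Definition bfield_covector p (u : A p) (v : tangent p) : R := B p (duo (anchor A p u) v).
Lemma bfield_covector_linear p (u : A p) : linear_for *%R (bfield_covector u).
Proof. by move=> r x y; rewrite /bfield_covector form2_linear2. Qed.

(** The isometry usually written [exp B]. *)
Definition bfield_map p (u : A p) : A p := u + coanchor A (bfield_covector u).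

Lemma bfield_pairing p (u v : A p) :
  pairing (bfield_map u) v = pairing u v + B p (duo (anchor A p u) (anchor A p v)).
Proof. by rewrite pairingDl coanchorP //; exact: bfield_covector_linear. Qed.

Lemma bfield_map_linear p : linear (@bfield_map p).
Proof.
move=> r u v; apply: pairing_inj => w.
rewrite bfield_pairing linearP form2_linear1 [X in X + _ = _]pairingDl pairingZl.
rewrite [RHS]pairingDl [X in _ = X + _]pairingZl !bfield_pairing.
by ring.
Qed.

Lemma bfield_map_anchor p (u : A p) : anchor A p (bfield_map u) = anchor A p u.
Proof.
rewrite linearD anchor_coanchor ?addr0 //; exact: bfield_covector_linear.
Qed.

Lemma bfield_map_iso p (u v : A p) : pairing (bfield_map u) (bfield_map v) = pairing u v.
Proof.
rewrite bfield_pairing bfield_map_anchor (pairing_sym u) bfield_pairing (pairing_sym v).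
by rewrite (form2_skew B (anchor A p u)) addrK.
Qed.

Definition bfield_lin p : {linear A p -> A p} :=
  HB.pack (@bfield_map p) (GRing.isLinear.Build _ _ _ _ _ (@bfield_map_linear p)).

Lemma bfield_smooth (a : section A) t j :
  smooth_on (tdom t) (fun p => tmap t (bfield_lin p (a p)) 0 j).
Proof.
apply: weak_smooth => b.
have -> : (fun p => pairing (bfield_lin p (a p)) (b p)) =
    spairing a b + ev2 B (sanchor a) (sanchor b).
  by apply/funext => p; rewrite cinfD ev2E -bfield_pairing.
exact: cinfP.
Qed.

Definition bfield : vbmorphism A A := VBMorphism bfield_smooth.

End BField.

Section BFieldInverse.
Variables (R : realType) (n : nat) (M : manifold R n) (A : algebroid_data M).
Hypothesis eA : exact_algebroid A.

Lemma bfieldK (B B' : dform M 2) p : B' = - B ->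
  cancel (@bfield_map _ _ _ A B p) (@bfield_map _ _ _ A B' p).
Proof.
move=> BB u; apply: pairing_inj => v; rewrite !bfield_pairing bfield_map_anchor //.
by rewrite BB formNE addrK.
Qed.
End BFieldInverse.

Section ExteriorDerivative.
Variables (R : realType) (n : nat) (M : manifold R n).

Lemma tform0_subproof (p : M) : forall x : tangent p, linear (fun _ : tangent p => 0 : tangent p).
Proof. by move=> x r u v; rewrite scaler0 addr0. Qed.
Lemma tform0_skew (p : M) (x y : tangent p) : (0 : tangent p) = - 0.
Proof. by rewrite oppr0. Qed.
(** With zero curvature, [curved_formula] is the formula for the exterior
    derivative. *)
Definition tform0 : tform2 M :=
  TForm2 tform0_subproof tform0_skew (fun _ _ f => smooth_on_cst 0 openT).

Lemma std_lift (X : vfield M) : exists a : section (@std_data0 _ _ M), sanchor a = X.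
Proof.
have s0 Y : smooth_on setT (fun p : M => (0 : covector p) (vfield_fun Y p)).
  exact: (smooth_on_cst 0 openT).
exists (Section_ (std_section_smooth X s0)).
exact: vfield_eq.
Qed.

(** The formula is the [bracket_diff] of a B-field on the standard algebroid, so
    its tensoriality needs no further computation. *)
Lemma curved_formula_form (T : tform2 M) (B : dform M 2) : exists w : dform M 3,
  forall X Y Z, ev3 w X Y Z = curved_formula T B X Y Z.
Proof.
pose A := std_data T; have mA := std_metric T; have eA := std_exact T.
have cA : has_curvature (std_data T) T by exact: std_curvature.
have lift (X : vfield M) : exists a : section A, sanchor a = X := std_lift X.
have [w wE] := @bracket_diff_descends _ _ _ T A A mA eA cA mA eA cA lift (bfield A B)
  (bfield_map_iso eA B) (bfield_map_anchor eA B).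
exists w => X Y Z; have [a <-] := lift X; have [b <-] := lift Y; have [c <-] := lift Z.
rewrite wE /bracket_diff.
pose be (a : section A) := vbm_app (bfield A B) a - a.
have beE x : vbm_app (bfield A B) x = x + be x by rewrite subrKC.
rewrite !beE; apply: bfield_expand => // x y.
apply: cinf_eq => p; rewrite ev2E spairingE sectionBE pairingBl.
by rewrite [X in X - _](bfield_pairing B) addrC addKr.
Qed.

Lemma form3_eq (w w' : dform M 3) : (forall X Y Z, ev3 w X Y Z = ev3 w' X Y Z) -> w = w'.
Proof.
move=> ww'; apply: form_eq => p v; rewrite (tri_eta v).
have eA := @std_exact _ _ M tform0.
have ext (x : tangent p) : exists X : vfield M, X p = x.
  by have [a <-] := anchor_lift eA x; exists (sanchor a).
have [X <-] := ext (v (@Ordinal 3 0 isT)); have [Y <-] := ext (v (@Ordinal 3 1 isT)).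
have [Z <-] := ext (v (@Ordinal 3 2 isT)).
by rewrite -!ev3E ww'.
Qed.

Lemma ext_deriv_formula2 (B : dform M 2) X p : ext_deriv_formula B X p =
  curved_formula tform0 B (X (@Ordinal 3 0 isT)) (X (@Ordinal 3 1 isT)) (X (@Ordinal 3 2 isT)) p.
Proof.
pose o0 := @Ordinal 3 0 isT; pose o1 := @Ordinal 3 1 isT; pose o2 := @Ordinal 3 2 isT.
have l1 : lift ord0 ord0 = o1 by exact: val_inj.
have l2 : lift ord0 (lift ord0 ord0) = o2 by exact: val_inj.
have l0 : ord0 = o0 by exact: val_inj.
have F0 : form_app B (fun m : 'I_2 => X (lift o0 m)) = ev2 B (X o1) (X o2).
  by congr form_app; apply/funext; elim/forall_ord2; congr X; apply: val_inj.
have F1 : form_app B (fun m : 'I_2 => X (lift o1 m)) = ev2 B (X o0) (X o2).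
  by congr form_app; apply/funext; elim/forall_ord2; congr X; apply: val_inj.
have F2 : form_app B (fun m : 'I_2 => X (lift o2 m)) = ev2 B (X o0) (X o1).
  by congr form_app; apply/funext; elim/forall_ord2; congr X; apply: val_inj.
have G (i j k : 'I_3) : bump i (bump j.-1 0) = k ->
    B p (fun m : 'I_2 => if m == 0%N :> nat then lie_bracket (X i) (X j) p
                 else X (inord (bump i (bump j.-1 m.-1))) p) =
    ev2 B (tbracket tform0 (X i) (X j)) (X k) p.
  move=> ijk; rewrite ev2E; congr (B p _); apply/funext; elim/forall_ord2 => /=.
    by rewrite /duo /= addr0.
  rewrite ijk /duo /=; congr (X _ p); apply: val_inj; rewrite /= inordK //.
rewrite /ext_deriv_formula; under [X in _ + X]eq_bigr do rewrite big_mkcond.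
rewrite !big_ord_recl !big_ord0 l1 l2 l0 F0 F1 F2.
rewrite (G o0 o1 o2 erefl) (G o0 o2 o1 erefl) (G o1 o2 o0 erefl).
rewrite /curved_formula !(cinfB, cinfD) !vappE.
move: (ev2 B (tbracket _ (X o0) (X o1)) _ p) (ev2 B (tbracket _ (X o0) (X o2)) _ p).
move: (ev2 B (tbracket _ (X o1) (X o2)) _ p) => e12 e01 e02.
move: (X o0 p _) (X o1 p _) (X o2 p _) => x y z.
rewrite /= /bump /= !addr0 !add0r.
by rewrite -[(0 + 1)%N]/1%N -[(0 + 2)%N]/2%N -[(1 + 2)%N]/3%N; ring.
Qed.

Lemma ext_deriv2 (B : dform M 2) X Y Z :
  ev3 (ext_deriv B) X Y Z = curved_formula tform0 B X Y Z.
Proof.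
have [w wE] := curved_formula_form tform0 B.
have iw : is_ext_deriv B w.
  by move=> V p; rewrite ext_deriv_formula2 -wE ev3E [X in w p X](tri_eta _).
have := xgetPex 0 (ex_intro _ w iw : exists w, is_ext_deriv B w).
rewrite -/(ext_deriv B) => H; apply: cinf_eq => p.
by have := H (tri X Y Z) p; rewrite ext_deriv_formula2 ev3E tri_vfield.
Qed.

End ExteriorDerivative.

(** * Derivations of the wedge product of alternating maps *)

Section Alternation.
Variables (R : realType) (V : lmodType R).

Definition alternation n (G : ('I_n -> V) -> R) (v : 'I_n -> V) : R :=
  \sum_(s : {perm 'I_n}) (-1) ^+ s * G (v \o s).

Lemma alternation_perm n (G : ('I_n -> V) -> R) (c : {perm 'I_n}) v :
  alternation (fun w => G (w \o c)) v = (-1) ^+ c * alternation G v.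
Proof.
rewrite /alternation mulr_sumr [RHS](reindex_inj (mulgI c)) /=.
apply: eq_bigr => s _; rewrite odd_permM signr_addb !mulrA -signr_addb addbb mul1r.
by congr (_ * G _); apply/funext => i /=; rewrite permM.
Qed.

(** A permutation of [n + 1] letters is the image of the first letter together
    with a permutation of the others. *)
Lemma sum_lift_perm n (F : {perm 'I_n.+1} -> R) :
  \sum_(s : {perm 'I_n.+1}) F s =
  \sum_(i < n.+1) \sum_(u : {perm 'I_n}) F (lift_perm ord0 i u).
Proof.
rewrite pair_bigA /=; pose h (x : 'I_n.+1 * {perm 'I_n}) := lift_perm ord0 x.1 x.2.
rewrite (reindex h) //; apply: onW_bij.
apply: inj_card_bij; last by rewrite card_prod card_ord !card_Sn factS.
move=> [i u] [j w]; rewrite /h /= => E.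
have ij : i = j by have := congr1 (fun s : {perm _} => s ord0) E; rewrite !lift_perm_id.
subst j; congr pair; apply/permP => m.
have := congr1 (fun s : {perm _} => s (lift ord0 m)) E; rewrite !lift_perm_lift.
exact: lift_inj.
Qed.

Lemma alternation_expand n (G : ('I_n.+1 -> V) -> R) v :
  alternation G v = \sum_(i < n.+1) (-1) ^+ i *
    \sum_(u : {perm 'I_n}) (-1) ^+ u * G (v \o lift_perm ord0 i u).
Proof.
rewrite /alternation sum_lift_perm; apply: eq_bigr => i _.
rewrite mulr_sumr; apply: eq_bigr => u _.
by rewrite odd_lift_perm /= signr_addb signr_odd mulrA.
Qed.

Lemma alternation_alternating n (G : ('I_n -> V) -> R) : is_alternating (alternation G).
Proof.
move=> v i j ij vij; set S := alternation G v.
suff SN : S = - S.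
  have /eqP : S *+ 2 = 0 by rewrite mulr2n {1}SN addNr.
  by rewrite mulrn_eq0 => /eqP.
rewrite {1}/S /alternation (reindex_inj (mulIg (tperm i j))) /= -sumrN.
apply: eq_bigr => s _; rewrite odd_permM odd_tperm ij addbT signrN mulNr.
congr (- (_ * G _)); apply/funext => x /=; rewrite permM.
by case: tpermP => // ->.
Qed.

Lemma update_id k (v : 'I_k -> V) i : update v i (v i) = v.
Proof. by apply/funext => j; rewrite /update; case: eqP => // ->. Qed.

Section Multilinear.
Variables (k : nat) (a : ('I_k -> V) -> R).
Hypotheses (ma : multilinear a) (aa : is_alternating a).

Lemma multilinearD v i x y : a (update v i (x + y)) = a (update v i x) + a (update v i y).
Proof. by have := ma v i 1 x y; rewrite scale1r mul1r. Qed.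
Lemma multilinear0 v i : a (update v i 0) = 0.
Proof. by apply: (addrI (a (update v i 0))); rewrite -multilinearD !addr0. Qed.
Lemma multilinearZ v i r x : a (update v i (r *: x)) = r * a (update v i x).
Proof. by have := ma v i r x 0; rewrite multilinear0 !addr0. Qed.

Lemma alternating_tperm v i j : i != j -> a (v \o tperm i j) = - a v.
Proof.
move=> ij; pose f x y := a (update (update v i x) j y).
have C x y : update (update v i x) j y = update (update v j y) i x.
  apply/funext => m; rewrite /update; case: (eqVneq m j) => [->|//].
  by rewrite eq_sym (negbTE ij).
have f2 x y y' : f x (y + y') = f x y + f x y' by rewrite /f multilinearD.
have f1 x x' y : f (x + x') y = f x y + f x' y by rewrite /f !C multilinearD.
have f0 x : f x x = 0.
  by apply: (aa ij); rewrite /update (negbTE ij) !eqxx.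
have := f0 (v i + v j); rewrite f1 !f2 !f0 add0r addr0 => /eqP.
rewrite addrC addr_eq0 => /eqP.
have -> : f (v i) (v j) = a v by rewrite /f update_id update_id.
have -> // : f (v j) (v i) = a (v \o tperm i j).
rewrite /f; congr a; apply/funext => m; rewrite /update /=.
case: tpermP => [->|->|/eqP mi /eqP mj].
- by rewrite (negbTE ij) eqxx.
- by rewrite eqxx.
- by rewrite (negbTE mi) (negbTE mj).
Qed.

Lemma alternating_perm v (s : {perm 'I_k}) : a (v \o s) = (-1) ^+ s * a v.
Proof.
have [ts -> dts] := prod_tpermP s.
elim: ts v dts => [|[i j] ts IH] v /=.
  move=> _; rewrite big_nil odd_perm1 mul1r; congr a; apply/funext => m.
  by rewrite /= perm1.
move=> /andP[ij dts]; rewrite big_cons odd_permM odd_tperm /= -/(i != j) ij signr_addb mulN1r.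
have -> : v \o (tperm i j * \prod_(t <- ts) tperm t.1 t.2)%g =
   (v \o (\prod_(t <- ts) tperm t.1 t.2)%g) \o tperm i j.
  by apply/funext => m; rewrite /= permM.
by rewrite alternating_tperm // IH // mulNr.
Qed.

End Multilinear.

(** For [B x = e x * a] with a linear form [e], this is the wedge product of [e]
    and [a]; in general it is the alternating map that a linear map with values
    in alternating maps induces. *)
Definition cobound k (B : V -> ('I_k -> V) -> R) (v : 'I_k.+1 -> V) : R :=
  \sum_(i < k.+1) (-1) ^+ i * B (v i) (v \o lift i).

Lemma cobound_multilinear k (B : V -> ('I_k -> V) -> R) :
  (forall x, multilinear (B x)) -> (forall v, linear_for *%R (B^~ v)) ->
  multilinear (cobound B).
Proof.
move=> mB lB v j r x y; rewrite /cobound mulr_sumr -big_split; apply: eq_bigr => i _ /=.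
rewrite mulrCA -mulrDr; congr (_ * _).
case: (unliftP i j) => [m ->|->].
  have E z : update v (lift i m) z \o lift i = update (v \o lift i) m z.
    by apply/funext => m'; rewrite /update /= (inj_eq lift_inj).
  have U z : update v (lift i m) z i = v i by rewrite /update (negbTE (neq_lift _ _)).
  by rewrite !E !U mB.
have E z : update v i z \o lift i = v \o lift i.
  by apply/funext => m; rewrite /update /= eq_sym (negbTE (neq_lift _ _)).
have U z : update v i z i = z by rewrite /update eqxx.
by rewrite !E !U lB.
Qed.

Lemma cobound_alternation k (B : V -> ('I_k -> V) -> R) v :
  (forall x, multilinear (B x)) -> (forall x, is_alternating (B x)) ->
  alternation (fun w => B (w ord0) (w \o lift ord0)) v = k`!%:R * cobound B v.
Proof.
move=> mB aB; rewrite alternation_expand /cobound mulr_sumr; apply: eq_bigr => i _.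
rewrite mulrCA; congr (_ * _).
rewrite (eq_bigr (fun=> B (v i) (v \o lift i))) => [|u _].
  by rewrite sumr_const card_Sn mulr_natl.
rewrite /= lift_perm_id.
have -> : (v \o lift_perm ord0 i u) \o lift ord0 = (v \o lift i) \o u.
  by apply/funext => m /=; rewrite lift_perm_lift.
by rewrite alternating_perm // mulrA -signr_addb addbb mul1r.
Qed.

Lemma cobound_alternating k (B : V -> ('I_k -> V) -> R) :
  (forall x, multilinear (B x)) -> (forall x, is_alternating (B x)) ->
  is_alternating (cobound B).
Proof.
move=> mB aB v i j ij vij; have := cobound_alternation v mB aB.
rewrite (alternation_alternating _ ij vij) => /esym/eqP; rewrite mulf_eq0 pnatr_eq0.
by rewrite -leqn0 leqNgt fact_gt0 /= => /eqP.
Qed.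

Lemma wedge_alternation k l (a : ('I_k -> V) -> R) (b : ('I_l -> V) -> R) v :
  wedge a b v = ((k`! * l`!)%N%:R)^-1 *
    alternation (fun w => a (w \o @lshift k l) * b (w \o @rshift k l)) v.
Proof. by []. Qed.

(** Both sides are multiples of the alternation of one function [G] of
    [k + l + 1] vectors.  On the left the index of [cobound] and the permutation
    of the wedge combine through [lift_perm]; on the right each of the [k + 1]
    indices contributes the same amount, because moving it to the front costs
    its own sign. *)
Lemma cobound_wedgel k l (B : V -> ('I_k -> V) -> R) (b : ('I_l -> V) -> R) v :
  cobound (fun x => wedge (B x) b) v = wedge (cobound B) b v.
Proof.
pose G (w : 'I_(k + l).+1 -> V) :=
  B (w ord0) (w \o lift ord0 \o @lshift k l) * b (w \o lift ord0 \o @rshift k l).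
have -> : cobound (fun x => wedge (B x) b) v = ((k`! * l`!)%N%:R)^-1 * alternation G v.
  rewrite alternation_expand mulr_sumr; apply: eq_bigr => i _.
  rewrite wedge_alternation mulrCA; congr (_ * (_ * _)).
  apply: eq_bigr => u _; rewrite /G /= lift_perm_id.
  have E : (v \o lift_perm ord0 i u) \o lift ord0 = (v \o lift i) \o u.
    by apply/funext => m /=; rewrite lift_perm_lift.
  by rewrite E.
rewrite (@wedge_alternation k.+1 l) /alternation.
transitivity (((k.+1`! * l`!)%N%:R)^-1 * \sum_(i < k.+1) alternation G v).
  rewrite sumr_const card_ord -[alternation G v *+ _]mulr_natl mulrA; congr (_ * _).
  have -> : (k.+1`! * l`!)%N%:R = k.+1%:R * (k`! * l`!)%N%:R :> R.
    by rewrite factS -mulnA natrM.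
  by rewrite invfM mulrAC mulVf ?mul1r // pnatr_eq0.
congr (_ * _); under [RHS]eq_bigr do rewrite /cobound mulr_suml mulr_sumr.
rewrite [RHS]exchange_big; apply: eq_bigr => i _.
pose c : {perm 'I_(k + l).+1} := lift_perm ord0 (lshift l i : 'I_(k.+1 + l)) 1.
have sc : (-1) ^+ c = (-1) ^+ i :> R.
  by rewrite /c odd_lift_perm odd_perm1 addbF /= signr_odd.
have -> : alternation G v = (-1) ^+ i * alternation (fun w => G (w \o c)) v.
  by rewrite alternation_perm sc mulrA -exprD addnn -signr_odd odd_double mul1r.
rewrite /alternation mulr_sumr; apply: eq_bigr => s _.
rewrite mulrCA -!mulrA; congr (_ * (_ * _)).
have cl m : c (lift ord0 m) = lift (lshift l i : 'I_(k.+1 + l)) m by rewrite lift_perm_lift perm1.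
rewrite /G /= lift_perm_id; congr (B _ _ * b _); apply/funext => m /=; rewrite cl; congr (v (s _)).
  by apply: val_inj.
apply: val_inj => /=; rewrite /bump (_ : (i <= k + m)%N) ?add1n //.
by rewrite (leq_trans _ (leq_addr _ _)) // -ltnS.
Qed.

Lemma alternation_cast N N' (e : N' = N) (G : ('I_N' -> V) -> R) (v : 'I_N -> V) :
  alternation G (v \o cast_ord e) = alternation (fun w => G (w \o cast_ord e)) v.
Proof.
subst N; have E (w : 'I_N' -> V) : w \o cast_ord erefl = w.
  by apply/funext => i /=; rewrite cast_ord_id.
rewrite E /alternation; apply: eq_bigr => s _; by rewrite E.
Qed.

(** As [cobound_wedgel], except that the index has to pass the [k] arguments of
    [a] on its way to the front. *)
Lemma cobound_wedger k l (a : ('I_k -> V) -> R) (B : V -> ('I_l -> V) -> R)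
    (v : 'I_(k + l).+1 -> V) :
  cobound (fun x => wedge a (B x)) v =
  (-1) ^+ k * wedge a (cobound B) (v \o cast_ord (addnS k l)).
Proof.
pose G (w : 'I_(k + l).+1 -> V) :=
  a (w \o lift ord0 \o @lshift k l) * B (w ord0) (w \o lift ord0 \o @rshift k l).
have -> : cobound (fun x => wedge a (B x)) v = ((k`! * l`!)%N%:R)^-1 * alternation G v.
  rewrite alternation_expand mulr_sumr; apply: eq_bigr => i _.
  rewrite wedge_alternation mulrCA; congr (_ * (_ * _)).
  apply: eq_bigr => u _; rewrite /G /= lift_perm_id.
  have E : (v \o lift_perm ord0 i u) \o lift ord0 = (v \o lift i) \o u.
    by apply/funext => m /=; rewrite lift_perm_lift.
  by rewrite E.
rewrite wedge_alternation alternation_cast /alternation.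
transitivity (((k`! * l.+1`!)%N%:R)^-1 * \sum_(i < l.+1) alternation G v).
  rewrite sumr_const card_ord -[alternation G v *+ _]mulr_natl mulrA; congr (_ * _).
  have -> : (k`! * l.+1`!)%N%:R = l.+1%:R * (k`! * l`!)%N%:R :> R.
    by rewrite factS mulnCA natrM.
  by rewrite invfM mulrAC mulVf ?mul1r // pnatr_eq0.
rewrite [RHS]mulrCA; congr (_ * _); rewrite mulr_sumr.
under [RHS]eq_bigr do rewrite /cobound !mulr_sumr.
rewrite [RHS]exchange_big; apply: eq_bigr => i _.
pose i' : 'I_(k + l).+1 := cast_ord (addnS k l) (rshift k i).
pose c : {perm 'I_(k + l).+1} := lift_perm ord0 i' 1.
have sc : (-1) ^+ c = (-1) ^+ (k + i)%N :> R.
  by rewrite /c odd_lift_perm odd_perm1 addbF /= signr_odd.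
have -> : alternation G v = (-1) ^+ (k + i)%N * alternation (fun w => G (w \o c)) v.
  by rewrite alternation_perm sc mulrA -exprD addnn -signr_odd odd_double mul1r.
rewrite /alternation mulr_sumr; apply: eq_bigr => s _.
rewrite exprD -!mulrA; congr (_ * _); rewrite mulrCA; congr (_ * _).
rewrite /G mulrCA.
have cl m : c (lift ord0 m) = lift i' m by rewrite lift_perm_lift perm1.
have c0 : c ord0 = i' by rewrite /c lift_perm_id.
congr (_ * _).
  congr a; apply/funext => m /=; rewrite cl; congr (v (s _)).
  apply: val_inj => /=; rewrite /bump leqNgt (_ : (m < k + i)%N) //.
  by rewrite (leq_trans (ltn_ord m)) // leq_addr.
rewrite /= c0; congr (_ * B _ _); apply/funext => m /=; rewrite cl; congr (v (s _)).
by apply: val_inj; rewrite /= /bump leq_add2l addnCA.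
Qed.

(** The derivation of degree zero of the alternating maps extending the transpose
    of the endomorphism [N]. *)
Definition endo_deriv k (N : V -> V) (a : ('I_k -> V) -> R) (v : 'I_k -> V) : R :=
  \sum_(m < k) a (update v m (N (v m))).

Lemma endo_deriv_wedge k l (N : V -> V) (a : ('I_k -> V) -> R) (b : ('I_l -> V) -> R) v :
  endo_deriv N (wedge a b) v = wedge (endo_deriv N a) b v + wedge a (endo_deriv N b) v.
Proof.
rewrite /endo_deriv /wedge -mulr_sumr -mulrDr; congr (_ * _).
rewrite exchange_big -big_split; apply: eq_bigr => s _ /=.
rewrite -mulr_sumr -mulrDr; congr (_ * _).
rewrite (reindex_inj (@perm_inj _ s)) big_split_ord /= mulr_suml mulr_sumr.
have E m z m' : update v (s m) z (s m') = update (v \o s) m z m'.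
  by rewrite /update (inj_eq perm_inj).
congr (_ + _); apply: eq_bigr => m _; congr (a _ * b _); apply/funext => m'; rewrite E /update //=.
- by rewrite eq_rlshift.
- by rewrite eq_lrshift.
- by rewrite (inj_eq (@rshift_inj _ _)).
Qed.

Lemma endo_deriv_multilinear k (N : V -> V) (a : ('I_k -> V) -> R) :
  linear N -> multilinear a -> multilinear (endo_deriv N a).
Proof.
move=> lN ma v j r x y; rewrite /endo_deriv mulr_sumr -big_split; apply: eq_bigr => m _ /=.
have [->|mj] := eqVneq m j.
  have E z : update (update v j z) j (N (update v j z j)) = update v j (N z).
    by apply/funext => i; rewrite /update !eqxx; case: (i == j).
  by rewrite !E lN ma.
have E z : update (update v j z) m (N (update v j z m)) = update (update v m (N (v m))) j z.
  apply/funext => i; rewrite /update (negbTE mj); case: (eqVneq i m) => [->|//].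
  by rewrite (negbTE mj).
by rewrite !E ma.
Qed.

Lemma endo_deriv_alternating k (N : V -> V) (a : ('I_k -> V) -> R) :
  multilinear a -> is_alternating a -> is_alternating (endo_deriv N a).
Proof.
move=> ma aa v i j ij vij; rewrite /endo_deriv (bigD1 i) //= (bigD1 j) /=; last by rewrite eq_sym.
rewrite big1 => [|m /andP[mi mj]]; last first.
  by apply: (aa _ _ _ ij); rewrite /update eq_sym (negbTE mi) eq_sym (negbTE mj).
rewrite addr0; have -> : update v i (N (v i)) = update v j (N (v j)) \o tperm i j.
  apply/funext => m; rewrite /update /=; case: tpermP => [->|->|/eqP mi /eqP mj].
  - by rewrite !eqxx vij.
  - by rewrite eq_sym (negbTE ij) vij.
  - by rewrite (negbTE mi) (negbTE mj).
by rewrite alternating_tperm // addNr.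
Qed.

End Alternation.

(** * The insertion operator of a vector-valued two-form *)

Section Insertion.
Variables (R : realType) (n : nat) (M : manifold R n) (T : tform2 M).
Implicit Types (p : M).

(** On a one-form [w], the alternating sum of [w (half_T x y)] over the two orders
    of [x] and [y] is [w (T x y)]. *)
Definition half_T p (x y : tangent p) : tangent p := 2^-1 *: tform2_fun T x y.

Lemma half_T_linear p (x : tangent p) : linear (half_T x).
Proof.
by move=> r u v; rewrite /half_T tform2Dr tform2Zr scalerDr !scalerA mulrC.
Qed.
Lemma half_T_linearl p (y : tangent p) : linear (@half_T p ^~ y).
Proof.
by move=> r u v; rewrite /half_T tform2Dl tform2Zl scalerDr !scalerA mulrC.
Qed.

Section Form.
Variables (k : nat) (w : dform M k).

(** If [e^i] is dual to the basis [e_i], then [iota_T] is the sum over [i] of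
    [e^i] wedge the derivation induced by [half_T e_i]; writing it with [cobound]
    avoids the choice of a basis and reduces the Leibniz rule to
    [endo_deriv_wedge] and the two lemmas on [cobound] and [wedge]. *)
Definition ins_val p (v : 'I_k.+1 -> tangent p) : R :=
  cobound (fun x => endo_deriv (half_T x) (w p)) v.

Lemma ins_multilinear p : multilinear (@ins_val p).
Proof.
apply: cobound_multilinear => [x|v].
  by apply: endo_deriv_multilinear; [exact: half_T_linear|exact: form_multilinear].
move=> r x y; rewrite /endo_deriv mulr_sumr -big_split; apply: eq_bigr => m _ /=.
by rewrite half_T_linearl form_multilinear.
Qed.

Lemma ins_alternating p : is_alternating (@ins_val p).
Proof.
apply: cobound_alternating => x.
  by apply: endo_deriv_multilinear; [exact: half_T_linear|exact: form_multilinear].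
by apply: endo_deriv_alternating; [exact: form_multilinear|exact: form_alternating].
Qed.

Lemma half_T_smooth (X Y : vfield M) f : smooth_on setT (fun p => half_T (X p) (Y p) f).
Proof. exact: (cinfP (2^-1 *: mkcinf (tform2_smooth T X Y f))). Qed.
Definition half_Tv X Y : vfield M := VField (half_T_smooth X Y).

Lemma ins_smooth (X : 'I_k.+1 -> vfield M) :
  smooth_on setT (fun p => ins_val (fun i => X i p)).
Proof.
pose Y i (m : 'I_k) (j : 'I_k) : vfield M :=
  if j == m then half_Tv (X i) (X (lift i m)) else X (lift i j).
have -> : (fun p => ins_val (fun i => X i p)) =
   \sum_(i < k.+1) (-1) ^+ i *: \sum_(m < k) form_app w (Y i m).
  apply/funext => p; rewrite cinf_sum; apply: eq_bigr => i _.
  rewrite cinfZ cinf_sum; congr (_ * _); apply: eq_bigr => m _.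
  congr (w p _); apply/funext => j; rewrite /update /Y /=; by case: eqP.
exact: cinfP.
Qed.

Definition form_ins : dform M k.+1 := Form ins_multilinear ins_alternating ins_smooth.
End Form.

Lemma form_insE k (w : dform M k) p v : form_ins w p v = ins_val w v. Proof. by []. Qed.

Lemma form_ins_linear k : linear (@form_ins k).
Proof.
move=> r u v; apply: form_eq => p x; rewrite formDE formZE !form_insE /ins_val /cobound.
rewrite mulr_sumr -big_split; apply: eq_bigr => i _.
rewrite [X in _ = X + _]mulrCA -[RHS]mulrDr; congr (_ * _).
rewrite /endo_deriv mulr_sumr -big_split.
by apply: eq_bigr => m _; rewrite formDE formZE.
Qed.

Lemma form_castE k k' (e : k = k') (w : dform M k) p v :
  (ecast m (dform M m) e w) p v = w p (v \o cast_ord e).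
Proof.
by subst k'; congr (w p _); apply/funext => i /=; rewrite cast_ord_id.
Qed.

Lemma form_wedgeE k l (w : dform M k) (w' : dform M l) p v :
  form_wedge w w' p v = wedge (w p) (w' p) v.
Proof. by []. Qed.

Lemma form_ins_derivation : graded_derivation form_ins.
Proof.
split=> [|k l w w']; first exact: form_ins_linear.
apply: form_eq => p v; rewrite formDE formZE form_castE !form_wedgeE form_insE /ins_val.
rewrite -[X in _ = X + _]/(wedge (cobound (fun x => endo_deriv (half_T x) (w p))) (w' p) v).
rewrite -[wedge _ (form_ins w' p) _]/(wedge (w p) (cobound (fun x => endo_deriv (half_T x) (w' p))) (v \o cast_ord (addnS k l))).
rewrite -cobound_wedgel -cobound_wedger /cobound -big_split; apply: eq_bigr => i _ /=.
by rewrite -mulrDr -endo_deriv_wedge.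
Qed.

Lemma form_insP : is_insertion T form_ins.
Proof.
split; first exact: form_ins_derivation.
- move=> w; apply: form_eq => p v; rewrite form_insE /ins_val /cobound /endo_deriv.
  by rewrite big1 // => i _; rewrite big_ord0 mulr0.
- move=> w p v; rewrite form_insE /ins_val /cobound /endo_deriv.
  rewrite !big_ord_recl !big_ord0 !addr0.
  have E x (u : 'I_1 -> tangent p) : w p (update u ord0 (half_T x (u ord0))) =
      2^-1 * w p (fun=> tform2_fun T x (u ord0)).
    have := @multilinearZ _ _ _ _ (form_multilinear w (p := p)) u ord0 2^-1 (tform2_fun T x (u ord0)).
    rewrite /half_T => ->; congr (_ * w p _); apply/funext => i.
    by rewrite /update ord1 eqxx.
  rewrite !E /= expr0 expr1 mul1r mulN1r.
  have -> : lift ord0 ord0 = 1 :> 'I_2 by exact: val_inj.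
  have -> : lift 1 ord0 = 0 :> 'I_2 by exact: val_inj.
  rewrite (tform2_skew T (v 1)).
  have -> : w p (fun=> - tform2_fun T (v 0) (v 1)) = - w p (fun=> tform2_fun T (v 0) (v 1)).
    have := @multilinearZ _ _ _ _ (form_multilinear w (p := p)) (fun=> 0) ord0 (-1) (tform2_fun T (v 0) (v 1)).
    have U z : update (fun=> 0 : tangent p) (ord0 : 'I_1) z = (fun=> z).
      by apply/funext => i; rewrite /update ord1 eqxx.
    by rewrite !U scaleN1r mulN1r.
  by rewrite mulrN opprK -mulrDl; field.
Qed.

Lemma insertionP : is_insertion T (insertion T).
Proof. exact: (xgetPex _ (ex_intro _ _ form_insP)). Qed.

End Insertion.

Section Uniqueness.
Variables (R : realType) (n : nat) (M : manifold R n) (T : tform2 M).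
Implicit Types (p : M) (f g : cinf M).

Lemma zform_multilinear f p : multilinear (fun _ : 'I_0 -> tangent p => f p).
Proof. by move=> v []. Qed.
Lemma zform_alternating f p : is_alternating (fun _ : 'I_0 -> tangent p => f p).
Proof. by move=> v []. Qed.
Definition zform f : dform M 0 :=
  Form (zform_multilinear f) (zform_alternating f) (fun=> cinfP f).

Lemma wedge_zform f k (w : dform M k) p v : form_wedge (zform f) w p v = f p * w p v.
Proof.
rewrite form_wedgeE wedge_alternation /alternation.
rewrite (eq_bigr (fun=> f p * w p v)) => [|s _].
  have -> : \sum_(s : {perm 'I_(0 + k)}) f p * w p v = k`!%:R * (f p * w p v).
    by rewrite sumr_const card_Sn mulr_natl.
  by rewrite fact0 mul1n mulKf // pnatr_eq0 -lt0n fact_gt0.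
have -> : (v \o s) \o rshift 0 (n:=k) = v \o s.
  by apply/funext => i /=; congr (v (s _)); apply: val_inj.
rewrite (alternating_perm (form_multilinear w (p := p)) (form_alternating w (p := p))).
by rewrite mulrCA; congr (_ * _); rewrite mulrA -signr_addb addbb mul1r.
Qed.

Lemma dx_multilinear f p : multilinear (fun v : 'I_1 -> tangent p => v ord0 f).
Proof.
by move=> v i r x y; rewrite (ord1 i); exact: (@tangent_app_linear _ _ M p f r x y).
Qed.
Lemma dx_alternating f p : is_alternating (fun v : 'I_1 -> tangent p => v ord0 f).
Proof. by move=> v i j; rewrite !ord1 eqxx. Qed.
Definition dx f : dform M 1 :=
  Form (dx_multilinear f) (dx_alternating f) (fun X => cinfP (vapp (X ord0) f)).

Lemma wedge_dx f g p (v : 'I_2 -> tangent p) : form_wedge (dx f) (dx g) p v =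
  v (@Ordinal 2 0 isT) f * v (@Ordinal 2 1 isT) g -
  v (@Ordinal 2 1 isT) f * v (@Ordinal 2 0 isT) g.
Proof.
pose Bf (x : tangent p) (u : 'I_1 -> tangent p) := x f * u ord0 g.
have mB x : multilinear (Bf x).
  by move=> u i r y z; rewrite /Bf (dx_multilinear g) mulrDr mulrCA.
have aB x : is_alternating (Bf x) by move=> u i j; rewrite !ord1 eqxx.
have := cobound_alternation v mB aB.
have f1 : (1`! = 1)%N by [].
rewrite form_wedgeE wedge_alternation f1 muln1 invr1 !mul1r /cobound !big_ord_recl big_ord0.
have -> : alternation (fun w => Bf (w ord0) (w \o lift ord0)) v =
   alternation (fun w : 'I_(1 + 1) -> tangent p =>
     dx f p (w \o lshift 1 (m:=1)) * dx g p (w \o rshift 1 (n:=1))) v.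
  apply: eq_bigr => s _; congr (_ * _); rewrite /Bf /dx /=.
  congr (v (s _) _ * v (s _) _); exact: val_inj.
move=> ->; rewrite /Bf /= expr0 expr1 mul1r mulN1r addr0.
congr (v _ _ * v _ _ - v _ _ * v _ _); exact: val_inj.
Qed.

Lemma derivation_zform (D : operator1 M) k f (w : dform M k) : is_insertion T D ->
  D _ (form_wedge (zform f) w) = form_wedge (zform f) (D _ w).
Proof.
move=> [[_ DL] D0 _]; rewrite DL D0; apply: form_eq => p v.
rewrite formDE formZE form_castE expr0 mul1r.
have -> : form_wedge (0 : dform M 1) w p v = 0.
  rewrite form_wedgeE wedge_alternation /alternation big1 ?mulr0 // => s _.
  by rewrite mul0r mulr0.
rewrite add0r; congr (form_wedge _ _ p _); apply/funext => i /=; congr v; exact: val_inj.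
Qed.

(** By the Leibniz rule an insertion operator is linear over functions, and near
    [p] a two-form is, up to a function equal to [1] at [p], a combination of
    wedge products of differentials, on which the operator is prescribed. *)
Lemma insertion_unique2 (D D' : operator1 M) (B : dform M 2) :
  is_insertion T D -> is_insertion T D' -> D _ B = D' _ B.
Proof.
move=> iD iD'; have [[Dlin DL] D0 D1] := iD; have [[Dlin' DL'] D0' D1'] := iD'.
have Edx f : D _ (dx f) = D' _ (dx f) by apply: form_eq => p v; rewrite D1 D1'.
have Edd f g : D _ (form_wedge (dx f) (dx g)) = D' _ (form_wedge (dx f) (dx g)).
  by rewrite DL DL' !Edx.
have Dsum (D'' : operator1 M) (I : Type) (s : seq I) (F : I -> dform M 2) :
    (forall k, linear (D'' k)) -> D'' _ (\sum_(i <- s) F i) = \sum_(i <- s) D'' _ (F i).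
  move=> lD; have D''D u v : D'' 2 (u + v) = D'' 2 u + D'' 2 v.
    by rewrite -[u in LHS]scale1r lD scale1r.
  apply: (big_morph _ D''D); apply: (addrI (D'' 2 0)); by rewrite -D''D !addr0.
apply: form_eq => p v; have [F Fp] := frame_at p.
pose c i j := (2^-1 : R) *: ev2 B (fr_E F i) (fr_E F j).
have BE : form_wedge (zform (fr_phi F * fr_phi F)) B =
    \sum_i \sum_j form_wedge (zform (c i j)) (form_wedge (dx (fr_x F i)) (dx (fr_x F j))).
  apply: form_eq => q u; rewrite wedge_zform.
  have S (I : Type) (s : seq I) (G : I -> dform M 2) :
      (\sum_(i <- s) G i) q u = \sum_(i <- s) G i q u.
    apply: (big_morph (fun w : dform M 2 => w q u)) => // x y; exact: formDE.
  rewrite S; under eq_bigr do rewrite S.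
  under eq_bigr do under eq_bigr do rewrite wedge_zform wedge_dx.
  rewrite [u in LHS]duo_eta; move: (u (@Ordinal 2 0 isT)) (u (@Ordinal 2 1 isT)) => x y.
  have lin1 (I : Type) (s : seq I) (P : pred I) (G : I -> tangent q) z :
      B q (duo (\sum_(i <- s | P i) G i) z) = \sum_(i <- s | P i) B q (duo (G i) z).
    apply: (big_morph (fun t => B q (duo t z))) => [a b|]; last exact: form2_0l.
    by rewrite -[a in LHS]scale1r form2_linear1 mul1r.
  have lin2 (I : Type) (s : seq I) (P : pred I) (G : I -> tangent q) z :
      B q (duo z (\sum_(i <- s | P i) G i)) = \sum_(i <- s | P i) B q (duo z (G i)).
    apply: (big_morph (fun t => B q (duo z t))) => [a b|]; last exact: form2_0r.
    by rewrite -[a in LHS]scale1r form2_linear2 mul1r.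
  have sc r s (z t : tangent q) : B q (duo (r *: z) (s *: t)) = r * s * B q (duo z t).
    rewrite -[r *: z]addr0 -[s *: t]addr0 form2_linear1 form2_linear2 form2_0l form2_0r.
    by rewrite !addr0 mulrA.
  have E a b : fr_phi F q * fr_phi F q * B q (duo a b) =
      \sum_i \sum_j a (fr_x F i) * b (fr_x F j) * ev2 B (fr_E F i) (fr_E F j) q.
    rewrite -sc !fr_decomp lin1; apply: eq_bigr => i _.
    by rewrite lin2; apply: eq_bigr => j _; rewrite sc ev2E.
  rewrite cinfM.
  (* Antisymmetrise, since the wedge products on the right are skew. *)
  have E2 : fr_phi F q * fr_phi F q * B q (duo x y) = 2^-1 *
     (fr_phi F q * fr_phi F q * B q (duo x y) - fr_phi F q * fr_phi F q * B q (duo y x)).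
    by rewrite (form2_skew B y x); field.
  rewrite E2 !E -sumrB mulr_sumr; apply: eq_bigr => i _.
  rewrite -sumrB mulr_sumr; apply: eq_bigr => j _.
  by rewrite /c cinfZ; ring.
have DE (D'' : operator1 M) : is_insertion T D'' -> D'' _ B p v =
    (\sum_i \sum_j form_wedge (zform (c i j))
        (D'' _ (form_wedge (dx (fr_x F i)) (dx (fr_x F j)) : dform M 2))) p v.
  move=> i''; have [[l'' _] _ _] := i''.
  have -> : D'' _ B p v = form_wedge (zform (fr_phi F * fr_phi F)) (D'' _ B) p v.
    by rewrite wedge_zform cinfM Fp !mul1r.
  rewrite -(derivation_zform _ _ i'') BE Dsum //; apply: (congr1 (fun w : dform M 3 => w p v)).
  apply: eq_bigr => i _; rewrite Dsum //; apply: eq_bigr => j _.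
  exact: derivation_zform.
rewrite (DE _ iD) (DE _ iD'); apply: (congr1 (fun w : dform M 3 => w p v)).
by apply: eq_bigr => i _; apply: eq_bigr => j _; rewrite Edd.
Qed.

Definition Tv (X Y : vfield M) : vfield M := VField (tform2_smooth T X Y).

Lemma insertion2 (B : dform M 2) X Y Z : ev3 (insertion T B) X Y Z =
  ev2 B (Tv X Y) Z - ev2 B (Tv X Z) Y + ev2 B (Tv Y Z) X.
Proof.
rewrite (insertion_unique2 B (insertionP T) (form_insP T)).
apply: cinf_eq => p; rewrite ev3E cinfD cinfB !ev2E form_insE /ins_val /cobound /endo_deriv.
have TvE X' Y' : Tv X' Y' p = tform2_fun T (X' p) (Y' p) by [].
rewrite !TvE; move: (X p) (Y p) (Z p) => x y z.
have h1 a b c : B p (duo (half_T T a b) c) = 2^-1 * B p (duo (tform2_fun T a b) c).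
  by rewrite -[half_T T a b]addr0 form2_linear1 form2_0l addr0.
have h2 a b c : B p (duo c (half_T T a b)) = - (2^-1 * B p (duo (tform2_fun T a b) c)).
  by rewrite form2_skew h1.
have sw a b c : B p (duo (tform2_fun T a b) c) = - B p (duo (tform2_fun T b a) c).
  by rewrite tform2_skew -scaleN1r -[_ *: _]addr0 form2_linear1 form2_0l addr0 mulN1r.
have dE (v : 'I_2 -> tangent p) a b : v (@Ordinal 2 0 isT) = a -> v (@Ordinal 2 1 isT) = b -> v = duo a b.
  by move=> <- <-; exact: duo_eta.
rewrite !big_ord_recl !big_ord0 !addr0 /=.
rewrite (dE (update _ _ _) (half_T T x y) z) // (dE (update _ _ _) y (half_T T x z)) //.
rewrite (dE (update _ _ _) (half_T T y x) z) // (dE (update _ _ _) x (half_T T y z)) //.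
rewrite (dE (update _ _ _) (half_T T z x) y) // (dE (update _ _ _) x (half_T T z y)) //.
rewrite !h1 !h2 (sw y x) (sw z x) (sw z y) /bump /=.
by field.
Qed.

Lemma curved_deriv2 (B : dform M 2) X Y Z :
  ev3 (curved_deriv T B) X Y Z = curved_formula T B X Y Z.
Proof.
have evB (w w' : dform M 3) : ev3 (w - w') X Y Z = ev3 w X Y Z - ev3 w' X Y Z.
  by apply: cinf_eq => p; rewrite cinfB !ev3E formDE formNE.
rewrite evB ext_deriv2 insertion2 /curved_formula.
have tv X' Y' Z' : ev2 B (tbracket T X' Y') Z' =
    ev2 B (tbracket (tform0 M) X' Y') Z' + ev2 B (Tv X' Y') Z'.
  apply: cinf_eq => p; rewrite cinfD !ev2E -[X in X + _]mul1r -form2_linear1.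
  congr (B p (duo _ _)); apply: tangent_eq => f.
  rewrite [RHS]tangent_addE [X in _ = X + _]tangent_scaleE mul1r !tbracketE tangent_zeroE addr0.
  by [].
rewrite !tv; ring.
Qed.

End Uniqueness.

(** * Isotropic splittings by a partition of unity *)

Section WeightedSplitting.
Variables (R : realType) (n : nat) (M : manifold R n) (A : algebroid_data M).
Hypothesis eA : exact_algebroid A.
Implicit Types (f : cinf M) (p q : M) (a b c : section A).

(** A splitting of the anchor up to a weight, which may vanish: weighted splittings
    can be added and multiplied by non-negative functions, and a true splitting is
    obtained by dividing by a positive weight. *)
Record wsplit := WSplit {
  ws_map : forall q, tangent q -> A q;
  ws_weight : cinf M;
  ws_linear : forall q, linear (@ws_map q);
  ws_anchor : forall q v, anchor A q (ws_map v) = ws_weight q *: v;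
  ws_ge0 : forall q, 0 <= ws_weight q;
  ws_section : forall X : vfield M, exists a : section A, forall q, a q = ws_map (X q)
}.

Lemma wsplit0 : wsplit.
Proof.
apply: (@WSplit (fun q _ => 0) 0) => //.
- by move=> q r u v; rewrite scaler0 addr0.
- by move=> q v; rewrite linear0 scale0r.
- by move=> X; exists 0.
Qed.

(** Lift the fields [E i] of a frame at [p] to sections [a i] at the single point
    [p].  Their anchors form, in the frame, a matrix [P] that is the identity at
    [p]; its adjugate gives a lift of [det P] times the identity without any
    inversion.  The extra factors make the weight a square. *)
Lemma wsplit_at p : exists w : wsplit, 0 < ws_weight w p.
Proof.
have [F Fp] := frame_at p.
have /choice [a aE] i : exists a : section A, sanchor a p = fr_E F i p by exact: anchor_lift.
pose P : 'M[cinf M]_n := \matrix_(i, j) vapp (sanchor (a i)) (fr_x F j).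
pose N := \adj P; pose d := \det P; pose h := fr_phi F * fr_phi F * d.
pose co (q : M) (v : tangent q) i : R := \sum_j v (fr_x F j) * N j i q.
pose sg (q : M) (v : tangent q) : A q := h q *: \sum_i co q v i *: a i q.
have NP q j k : \sum_i N j i q * P i k q = d q *+ (j == k).
  have := congr1 (fun Q : 'M[cinf M]_n => Q j k q) (mul_adj_mx P).
  rewrite mxE cinf_sum [X in _ = cinf_fun X q]mxE => E; rewrite [LHS]E.
  by case: eqP.
have lsg q : linear (@sg q).
  move=> r u v; rewrite /sg !scaler_sumr -big_split; apply: eq_bigr => i _.
  rewrite !scalerA -[RHS]scalerDl; congr (_ *: _).
  rewrite mulrC (_ : co q (r *: u + v) i = r * co q u i + co q v i).
    by rewrite mulrDl; congr (_ + _); ring.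
  rewrite /co mulr_sumr -big_split; apply: eq_bigr => j _.
  by rewrite tangent_addE tangent_scaleE mulrDl mulrA.
have dp : d p = 1.
  rewrite -[LHS]/(cinf_eval p d) -det_map_mx (_ : map_mx _ _ = 1%:M) ?det1 //.
  apply/matrixP => i j; rewrite !mxE -[LHS]/(sanchor (a i) p (fr_x F j)) aE fr_dual Fp.
  by case: eqP.
have an q (v : tangent q) : anchor A q (sg q v) = (fr_phi F * d * (fr_phi F * d)) q *: v.
  rewrite linearZZ linear_sum; under eq_bigr do rewrite linearZZ.
  have -> : h q = (fr_phi F * d) q * fr_phi F q by rewrite /h !cinfM; ring.
  rewrite (cinfM (fr_phi F * d) (fr_phi F * d)) -[LHS]scalerA -[RHS]scalerA.
  congr (_ *: _).
  have E i : fr_phi F q *: (anchor A q (a i q) : tangent q) = \sum_k P i k q *: (fr_E F k q : tangent q).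
    by rewrite fr_decomp; apply: eq_bigr => k _; rewrite mxE.
  rewrite scaler_sumr (eq_bigr (fun i => \sum_k (co q v i * P i k q) *: (fr_E F k q : tangent q))).
    rewrite exchange_big (cinfM (fr_phi F)) mulrC -scalerA fr_decomp scaler_sumr.
    apply: eq_bigr => k _.
    rewrite -scaler_suml scalerA; congr (_ *: _).
    under eq_bigr do rewrite /co mulr_suml.
    rewrite exchange_big (eq_bigr (fun j => v (fr_x F j) * (d q *+ (j == k)))) => [|j _].
      rewrite (bigD1 k) //= eqxx mulr1n big1 ?addr0 => [|j jk]; first by rewrite mulrC.
      by rewrite (negbTE jk) mulr0.
    by rewrite -NP mulr_sumr; apply: eq_bigr => i _; rewrite mulrA.
  move=> i _; rewrite scalerA mulrC -scalerA E scaler_sumr.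
  by apply: eq_bigr => k _; rewrite scalerA.
have ge0 q : 0 <= (fr_phi F * d * (fr_phi F * d)) q by rewrite cinfM -expr2 sqr_ge0.
have se (X : vfield M) : exists b : section A, forall q, b q = sg q (X q).
  exists (h *: \sum_i (\sum_j vapp X (fr_x F j) * N j i) *: a i) => q.
  rewrite sectionZE section_sumE; congr (_ *: _); apply: eq_bigr => i _.
  by rewrite sectionZE cinf_sum.
exists (WSplit lsg an ge0 se) => /=.
by rewrite !fctE Fp dp !mul1r ltr01.
Qed.

(** Lindelof: a countable base, each member of which is sent to a weighted
    splitting of positive weight on it when there is one. *)
Lemma wsplit_cover : exists w : nat -> wsplit, forall q, exists k, 0 < ws_weight (w k) q.
Proof.
have [B [cB [oB bB]]] := @manifold_second_countable _ _ M.
have /countable_injP [f finj] := cB.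
pose U k : set M := xget set0 [set U | B U /\ f U = k].
have /choice [w wE] k : exists w : wsplit, forall w', U k `<=` [set q | 0 < ws_weight w' q] ->
    U k `<=` [set q | 0 < ws_weight w q].
  have [[w' H]|H] := pselect (exists w' : wsplit, U k `<=` [set q | 0 < ws_weight w' q]).
    by exists w'.
  by exists wsplit0 => w' H'; case: H; exists w'.
exists w => q; have [w' wq] := wsplit_at q.
have oW : open [set q | 0 < ws_weight w' q] by exact: (cinf_open (ws_weight w') (@open_gt R 0)).
have nW : nbhs q [set q | 0 < ws_weight w' q] by apply: open_nbhs_nbhs.
have [V [BV Vq] VW] := bB q _ nW.
have UE : U (f V) = V.
  rewrite /U; case: xgetP => [V' -> [BV' fV']|/(_ V) []//].
  by apply: finj => //; rewrite inE.
by exists (f V); apply: (wE (f V) w'); rewrite UE.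
Qed.

(** Where some earlier weight exceeds [1 / (k + 1)] the k-th member is switched
    off.  Near a point with positive m-th weight this happens for all large [k], so
    the family becomes locally finite; and the first member with positive weight
    at a point stays positive there. *)
Definition cutoff (w : nat -> wsplit) k q : R :=
  \prod_(j < k) flat 1 (k.+1%:R^-1 - ws_weight (w j) q).

Lemma cutoff_smooth w k : smooth_on setT (cutoff w k).
Proof.
apply: smooth_on_prod => [|j _]; first exact: openT.
apply: (@smooth_on_flat _ _ _ _ (fun q => k.+1%:R^-1 - ws_weight (w j) q)); first exact: openT.
by apply: smooth_onB; [exact: openT|exact/smooth_on_cst/openT|exact: cinfP].
Qed.

Lemma cutoff_ge0 w k q : 0 <= cutoff w k q.
Proof. by apply: prodr_ge0 => j _; exact: flat_ge0. Qed.

Lemma cutoff_locally_finite w q : (exists k, 0 < ws_weight (w k) q) ->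
  exists N V, [/\ open V, V q & forall k q', (N <= k)%N -> V q' -> cutoff w k q' = 0].
Proof.
move=> [m wm]; pose e := ws_weight (w m) q / 2.
have e0 : 0 < e by rewrite divr_gt0.
have [N Ne] : exists N : nat, N.+1%:R^-1 < e.
  have [N HN] := @ltr_add_invr R 0 e e0.
  by exists N; rewrite add0r in HN.
exists (maxn N m.+1), [set q' | e < ws_weight (w m) q']; split.
- exact: (cinf_open (ws_weight (w m)) (@open_gt R e)).
- by rewrite /= /e; lra.
move=> k q' /=; rewrite geq_max => /andP[Nk mk] ek.
rewrite /cutoff (bigD1 (Ordinal mk)) //= [flat _ _](_ : _ = 0) ?mul0r //.
rewrite /flat ifF //; apply/negbTE; rewrite -leNgt subr_le0.
apply: (le_trans _ (ltW (lt_trans Ne ek))).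
by rewrite lef_pV2 ?posrE // ler_nat ltnS.
Qed.

Lemma cutoff_cover w q : (exists k, 0 < ws_weight (w k) q) ->
  exists k, 0 < cutoff w k q * ws_weight (w k) q.
Proof.
move=> wq; have [m wm min] := ex_minnP wq.
exists m; apply: mulr_gt0 => //; apply: prodr_gt0 => j _.
rewrite flat_gt0 (_ : ws_weight (w j) q = 0) ?subr0 //.
apply/eqP; rewrite eq_le ws_ge0 andbT leNgt; apply/negP => /min.
by rewrite leqNgt ltn_ord.
Qed.

Lemma sum_truncate (V : zmodType) (F : nat -> V) (a b : nat) :
  (forall k, (a <= k)%N -> F k = 0) -> (forall k, (b <= k)%N -> F k = 0) ->
  \sum_(k < a) F k = \sum_(k < b) F k.
Proof.
wlog ab : a b / (a <= b)%N.
  by move=> W; have [ab|/ltnW ba] := leqP a b => Fa Fb; [exact: W|apply/esym/W].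
move=> Fa _; rewrite -!(big_mkord xpredT) [RHS](big_cat_nat (leq0n a) ab) /=.
suff -> : \sum_(a <= k < b) F k = 0 by rewrite addr0.
by rewrite big_nat_cond big1 // => k /andP[/andP[ak _] _]; exact: Fa.
Qed.

(** The sum of the cut-off weighted splittings divided by the sum of their weights.
    At each point the sums are truncated at a bound [Nq q] that depends on the
    point, which is harmless by [sum_truncate]. *)
Theorem smooth_splitting : exists s : forall q, tangent q -> A q,
  [/\ forall q, linear (s q), (forall q v, anchor A q (s q v) = v) &
      forall (X : vfield M) (b : section A), smooth_on setT (fun q => pairing (s q (X q)) (b q))].
Proof.
have [w wq] := wsplit_cover.
pose bd q := cid (cutoff_locally_finite (wq q)); pose Nq q := sval (bd q).
have NP q k : (Nq q <= k)%N -> cutoff w k q = 0.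
  by rewrite /Nq; case: (bd q) => N /= [V [_ Vq H]] Nk; exact: (H _ _ Nk Vq).
pose Psi q := \sum_(k < Nq q) cutoff w k q * ws_weight (w k) q.
have Psi_ge0 k q : 0 <= cutoff w k q * ws_weight (w k) q.
  by apply: mulr_ge0; [exact: cutoff_ge0|exact: ws_ge0].
have Psi0 q : 0 < Psi q.
  have [k kq] := cutoff_cover (wq q).
  have kN : (k < Nq q)%N by rewrite ltnNge; apply/negP => /NP H; move: kq; rewrite H mul0r ltxx.
  rewrite /Psi (bigD1 (Ordinal kN)) //=; apply: ltr_wpDr => //.
  by apply: sumr_ge0 => j _; exact: Psi_ge0.
pose sg q (v : tangent q) : A q := \sum_(k < Nq q) cutoff w k q *: ws_map (w k) v.
exists (fun q v => (Psi q)^-1 *: sg q v); split.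
- move=> q r u v; rewrite scalerA mulrC -scalerA -scalerDr; congr (_ *: _).
  rewrite /sg scaler_sumr -big_split; apply: eq_bigr => k _.
  by rewrite ws_linear scalerDr !scalerA mulrC.
- move=> q v; rewrite linearZZ linear_sum.
  rewrite (eq_bigr (fun k : 'I_(Nq q) => (cutoff w k q * ws_weight (w k) q) *: v)) => [|k _].
    by rewrite -scaler_suml scalerA mulVf ?scale1r // gt_eqF.
  by rewrite linearZZ ws_anchor scalerA.
move=> X b; apply: smooth_on_near => q _.
have [K [V [oV Vq H]]] := cutoff_locally_finite (wq q).
exists V; split=> //.
have /choice [a aE] k : exists a : section A, forall q, a q = ws_map (w k) (X q) by exact: ws_section.
pose P : cinf M := \sum_(k < K) mkcinf (cutoff_smooth w k) * ws_weight (w k).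
pose S : cinf M := \sum_(k < K) mkcinf (cutoff_smooth w k) * spairing (a k) b.
have PE q' : V q' -> Psi q' = P q'.
  move=> Vq'; rewrite cinf_sum; apply: (sum_truncate (F := fun k => cutoff w k q' * ws_weight (w k) q')).
    by move=> k /NP ->; rewrite mul0r.
  by move=> k /H -> //; rewrite mul0r.
exists (fun q => (P q)^-1 * S q).
  apply: smooth_onM => //; last exact: smooth_onS (cinfP S).
  apply: smooth_onV => // [q' Vq'|]; first by rewrite -PE // gt_eqF.
  exact: smooth_onS (cinfP P).
move=> q' Vq'; rewrite pairingZl -PE //; congr (_ * _).
rewrite /S cinf_sum pairing_suml.
transitivity (\sum_(k < K) pairing (cutoff w k q' *: ws_map (w k) (X q')) (b q')).
  by apply: eq_bigr => k _; rewrite pairingZl -aE.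
apply: (sum_truncate (F := fun k => pairing (cutoff w k q' *: ws_map (w k) (X q')) (b q'))).
  by move=> k /H -> //; rewrite scale0r pairing0l.
by move=> k /NP ->; rewrite scale0r pairing0l.
Qed.

(** The defect [tau u v = <s u, s v>] of a splitting is removed by subtracting
    half of its image under [rho^*]. *)
Theorem isotropic_splitting : exists s : forall q, tangent q -> A q,
  [/\ forall q, linear (s q), (forall q v, anchor A q (s q v) = v),
      (forall q u v, pairing (s q u) (s q v) = 0) &
      forall (X : vfield M) (b : section A), smooth_on setT (fun q => pairing (s q (X q)) (b q))].
Proof.
have [s [sl sa ss]] := smooth_splitting.
pose tau q (u v : tangent q) : R := pairing (s q u) (s q v).
have taul q (u : tangent q) : linear_for *%R (tau q u).
  by move=> r x y; rewrite /tau sl pairingDr pairingZr.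
pose s' q (u : tangent q) : A q := s q u - 2^-1 *: coanchor A (tau q u).
have s'P q (u : tangent q) (e : A q) :
    pairing (s' q u) e = pairing (s q u) e - 2^-1 * tau q u (anchor A q e).
  by rewrite pairingBl pairingZl coanchorP.
have s'a q (u : tangent q) : anchor A q (s' q u) = u.
  by rewrite linearB linearZZ anchor_coanchor // scaler0 subr0.
exists s'; split=> //.
- move=> q r u v; apply: pairing_inj => e; rewrite s'P pairingDl pairingZl !s'P.
  by rewrite /tau !sl !pairingDl !pairingZl; ring.
- move=> q u v; rewrite s'P s'a (pairing_sym (s q u)) s'P sa /tau (pairing_sym (s q v)).
  by field.
move=> X b.
have s1 := ss X b.
pose c : section A := weak_section (ss (sanchor b)).
have s2 := ss X c.
have -> : (fun q => pairing (s' q (X q)) (b q)) = mkcinf s1 - (2^-1 : R) *: mkcinf s2.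
  by apply/funext => q; exact: s'P.
exact: cinfP.
Qed.

End WeightedSplitting.

Section StandardForm.
Variables (R : realType) (n : nat) (M : manifold R n) (T : tform2 M) (A : algebroid_data M).
Hypothesis eA : exact_algebroid A.
Local Notation A0 := (std_data T).

(** The isometry is [(v, alpha) |-> s v + rho^* alpha] for an isotropic splitting
    [s], with inverse [e |-> (rho e, <e, s ->)]. *)
Theorem standard_isometry : exists (phi : vbmorphism A0 A) (psi : vbmorphism A A0),
  [/\ (forall p, cancel (phi p) (psi p) /\ cancel (psi p) (phi p)),
      (forall p (e e' : A0 p), pairing (phi p e) (phi p e') = pairing e e') &
      (forall p (e : A0 p), anchor A p (phi p e) = anchor A0 p e)].
Proof.
have [s [sl sa si ss]] := isotropic_splitting eA.
pose f p (e : A0 p) : A p := s p (e : std_fibre p).1 + coanchor A (e : std_fibre p).2.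
have cl p (al : covector p) := covector_linear al.
have fP p (e : A0 p) u : pairing (f p e) u =
    pairing (s p (e : std_fibre p).1) u + (e : std_fibre p).2 (anchor A p u).
  by rewrite pairingDl coanchorP.
have fa p (e : A0 p) : anchor A p (f p e) = (e : std_fibre p).1.
  by rewrite linearD sa anchor_coanchor // addr0.
have fl p : linear (f p).
  move=> r u v; apply: pairing_inj => e; rewrite fP pairingDl pairingZl !fP.
  have -> : ((r *: u + v : A0 p) : std_fibre p).1 =
          r *: (u : std_fibre p).1 + (v : std_fibre p).1 by [].
  have -> : ((r *: u + v : A0 p) : std_fibre p).2 =
          r *: (u : std_fibre p).2 + (v : std_fibre p).2 by [].
  rewrite sl pairingDl pairingZl covector_addE covector_scaleE; ring.
pose phi0 p : {linear A0 p -> A p} := HB.pack (f p) (GRing.isLinear.Build _ _ _ _ _ (fl p)).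
have fs (a : section A0) t j : smooth_on (tdom t) (fun p => tmap t (phi0 p (a p)) 0 j).
  apply: weak_smooth => b.
  have -> : (fun p => pairing (phi0 p (a p)) (b p)) =
     mkcinf (ss (std_vf a) b) + cov a (sanchor b).
    by apply/funext => p; rewrite cinfD; exact: fP.
  exact: cinfP.
have gl0 p (e : A p) : linear_for *%R (fun v => pairing e (s p v)).
  by move=> r u v; rewrite sl pairingDr pairingZr.
pose g p (e : A p) : A0 p := (anchor A p e, mkcovector (gl0 p e)) : std_fibre p.
have gl p : linear (g p).
  move=> r u v; rewrite /g linearP; apply: (congr1 (pair _)).
  by apply: covector_eq => x; rewrite covector_addE covector_scaleE /= pairingDl pairingZl.
pose psi0 p : {linear A p -> A0 p} := HB.pack (g p) (GRing.isLinear.Build _ _ _ _ _ (gl p)).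
have gs (a : section A) t j : smooth_on (tdom t) (fun p => tmap t (psi0 p (a p)) 0 j).
  apply: (@std_section_smooth _ _ _ (sanchor a) (fun p => mkcovector (gl0 p (a p)))) => Y.
  by have := ss Y a; congr (smooth_on _ _); apply/funext => p; rewrite pairing_sym.
exists (VBMorphism fs), (VBMorphism gs); split.
- move=> p; split=> [[v al]|e].
    rewrite /= /g fa; apply: (congr1 (pair _)); apply: covector_eq => x.
    by rewrite [LHS]fP si add0r sa.
  apply: pairing_inj => u; rewrite [LHS]fP /=.
  have : pairing (e - s p (anchor A p e)) (u - s p (anchor A p u)) = 0.
    by apply: (ker_isotropic eA); rewrite linearB sa subrr.
  rewrite pairingBl !pairingBr si subr0 => /eqP; rewrite subr_eq0 => /eqP <-.
  by rewrite subrK.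
- move=> p e e'; rewrite [LHS]fP fa (pairing_sym (s p _)) [X in X + _]fP si add0r sa.
  by rewrite addrC.
- by move=> p e; exact: fa.
Qed.

End StandardForm.

(** * Classification of exact curved Courant algebroids *)

Section Morphisms.
Variables (R : realType) (n : nat) (M : manifold R n).

Definition vbm_id (E : vbundle M) : vbmorphism E E :=
  @VBMorphism _ _ _ E E (fun p => idfun) (@section_smooth _ _ _ E).

Definition vbm_comp (E E' E'' : vbundle M) (psi : vbmorphism E' E'') (phi : vbmorphism E E') :
  vbmorphism E E'' :=
  @VBMorphism _ _ _ E E'' (fun p => psi p \o phi p)
    (fun a => section_smooth (vbm_app psi (vbm_app phi a))).

Variable T : tform2 M.

Lemma isomorphic_refl (A : exact_cca T) : isomorphic A A.
Proof.
exists (vbm_id A); split=> //; first by exists (vbm_id A).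
by move=> a b; apply: section_eq => p; congr (bracket _ _ p); apply: section_eq.
Qed.

Lemma isomorphic_sym (A A' : exact_cca T) : isomorphic A A' -> isomorphic A' A.
Proof.
move=> [phi [[psi K] iso anc br]]; exists psi; split.
- by exists phi => p; have [? ?] := K p.
- by move=> p e e'; rewrite -iso !(K p).2.
- by move=> p e; rewrite -anc (K p).2.
- move=> a b; apply: section_eq => p.
  have E (c : section A') : vbm_app phi (vbm_app psi c) = c.
    by apply: section_eq => q; rewrite !vbm_appE (K q).2.
  rewrite -[LHS](K p).1 vbm_appE; congr (psi p _).
  by rewrite -[LHS]/(vbm_app phi _ p) -br !E.
Qed.

Lemma isomorphic_trans (A A' A'' : exact_cca T) :
  isomorphic A A' -> isomorphic A' A'' -> isomorphic A A''.
Proof.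
move=> [phi [[psi K] iso anc br]] [phi' [[psi' K'] iso' anc' br']].
exists (vbm_comp phi' phi); split.
- exists (vbm_comp psi psi') => p; split=> e /=.
    by rewrite (K' p).1 (K p).1.
  by rewrite (K p).2 (K' p).2.
- by move=> p e e'; rewrite /= iso' iso.
- by move=> p e; rewrite /= anc' anc.
- move=> a b; have E (c : section A) : vbm_app (vbm_comp phi' phi) c = vbm_app phi' (vbm_app phi c).
    exact: section_eq.
  by rewrite !E br' br.
Qed.

Lemma curved_derivD (B B' : dform M 2) :
  curved_deriv T (B + B') = curved_deriv T B + curved_deriv T B'.
Proof.
have e2 X Y : ev2 (B + B') X Y = ev2 B X Y + ev2 B' X Y.
  by apply: cinf_eq => p; rewrite cinfD !ev2E formDE.
have e3 (w w' : dform M 3) X Y Z : ev3 (w + w') X Y Z = ev3 w X Y Z + ev3 w' X Y Z.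
  by apply: cinf_eq => p; rewrite cinfD !ev3E formDE.
apply: form3_eq => X Y Z; rewrite e3 !curved_deriv2 /curved_formula !e2 !vappD; ring.
Qed.

Lemma curved_deriv0 : curved_deriv T (0 : dform M 2) = 0.
Proof. by apply: (addrI (curved_deriv T (0 : dform M 2))); rewrite -curved_derivD !addr0. Qed.

Lemma curved_derivN (B : dform M 2) : curved_deriv T (- B) = - curved_deriv T B.
Proof. by apply: (addrI (curved_deriv T B)); rewrite -curved_derivD !subrr curved_deriv0. Qed.

Lemma cohomologous_sym (H H' : dform M 3) : cohomologous T H H' -> cohomologous T H' H.
Proof. by move=> [B BE]; exists (- B); rewrite curved_derivN -BE opprB. Qed.
Lemma cohomologous_trans (H H' H'' : dform M 3) :
  cohomologous T H H' -> cohomologous T H' H'' -> cohomologous T H H''.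
Proof.
move=> [B BE] [B' BE']; exists (B + B'); rewrite curved_derivD -BE -BE'.
by rewrite [RHS]addrC addrA subrK.
Qed.

Local Notation A0 := (std_data T).
Let m0 : metric_algebroid A0 := std_metric T.
Let e0 : exact_algebroid A0 := std_exact T.
Let c0 : has_curvature A0 T. Proof. exact: std_curvature. Qed.
Let lift (X : vfield M) : exists a : section A0, sanchor a = X := std_lift X.

Definition std_ecca (H : dform M 3) : exact_cca T := twist_ecca m0 e0 c0 H.

Lemma isomorphic_twist (H : dform M 3) (A : exact_cca T)
    (phi : vbmorphism A0 A) (psi : vbmorphism A A0) :
  (forall p, cancel (phi p) (psi p) /\ cancel (psi p) (phi p)) ->
  (forall p (e e' : A0 p), pairing (phi p e) (phi p e') = pairing e e') ->
  (forall p (e : A0 p), anchor A p (phi p e) = anchor A0 p e) ->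
  (forall a b c, spairing (bracket (vbm_app phi a) (vbm_app phi b)) (vbm_app phi c) =
     spairing (bracket a b) c + ev3 H (sanchor a) (sanchor b) (sanchor c)) ->
  isomorphic (std_ecca H) A.
Proof.
move=> K iso anc br; exists phi; split=> //; first by exists psi.
move=> a b; apply: spairing_inj => c.
have -> : c = vbm_app phi (vbm_app psi c).
  by apply: section_eq => q; rewrite !vbm_appE (K q).2.
rewrite br [RHS](vbm_spairing iso); exact/esym/twist_bracketE.
Qed.

Lemma std_ecca_surjective (A : exact_cca T) : exists H, isomorphic (std_ecca H) A.
Proof.
have mA : metric_algebroid A by have [] := ecca_cca A.
have [phi [psi [K iso anc]]] := standard_isometry T (ecca_exact A).
have [H HE] := bracket_diff_descends m0 e0 c0 mA (ecca_exact A) (ecca_curvature (e := A)) lift iso anc.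
exists H; apply: (isomorphic_twist K iso anc) => a b c.
by rewrite HE /bracket_diff subrKC.
Qed.

(** [exp (-B)] is an isomorphism when [H' - H = d^T B]. *)
Lemma cohomologous_isomorphic (H H' : dform M 3) :
  cohomologous T H H' -> isomorphic (std_ecca H) (std_ecca H').
Proof.
move=> [B BE]; pose phi := bfield A0 (- B); pose psi := bfield A0 B.
apply: (@isomorphic_twist H (std_ecca H') phi psi).
- move=> p; split; apply: (bfieldK e0) => //; by rewrite opprK.
- exact: (bfield_map_iso e0 (- B)).
- exact: (bfield_map_anchor e0 (- B)).
move=> a b c; rewrite [LHS](twist_bracketE H').
pose be (x : section A0) := vbm_app phi x - x.
have beE x : vbm_app phi x = x + be x by rewrite subrKC.
have beB x y : spairing (be x) y = ev2 (- B) (sanchor x) (sanchor y).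
  apply: cinf_eq => p; rewrite ev2E spairingE sectionBE pairingBl.
  by rewrite [X in X - _](bfield_pairing (- B)) addrC addKr.
have an x : sanchor (vbm_app phi x) = sanchor x.
  by apply: vfield_eq => p; exact: (bfield_map_anchor e0 (- B)).
rewrite !an; have := bfield_expand m0 e0 c0 beB a b c.
rewrite -!beE => /eqP; rewrite subr_eq => /eqP ->.
rewrite -curved_deriv2 curved_derivN -BE.
have e3 (w w' : dform M 3) X Y Z : ev3 (- (w - w')) X Y Z = ev3 w' X Y Z - ev3 w X Y Z.
  by apply: cinf_eq => p; rewrite opprB cinfB !ev3E formDE formNE.
by rewrite e3; ring.
Qed.

(** An isomorphism [phi] preserves the pairing and the anchor, so [<phi a - a, b>]
    is skew: [phi a - a] and [phi b - b] lie in the isotropic kernel of the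
    anchor.  It descends to a two-form [B] with [phi = exp B]. *)
Lemma isomorphic_cohomologous (H H' : dform M 3) :
  isomorphic (std_ecca H) (std_ecca H') -> cohomologous T H H'.
Proof.
move=> [phi' [_ iso anc br]]; pose phi : vbmorphism A0 A0 := phi'.
have {}iso p (e e' : A0 p) : pairing (phi p e) (phi p e') = pairing e e' by exact: iso.
have {}anc p (e : A0 p) : anchor A0 p (phi p e) = anchor A0 p e by exact: anc.
have {}br (a b : section A0) : twist_bracket H' (vbm_app phi a) (vbm_app phi b) =
  vbm_app phi (twist_bracket H a b) by exact: br.
pose be (x : section A0) := vbm_app phi x - x.
have beE x : vbm_app phi x = x + be x by rewrite subrKC.
have be0 x p : anchor A0 p (be x p) = 0.
  by rewrite sectionBE linearB [X in X - _]anc subrr.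
have an x : sanchor (vbm_app phi x) = sanchor x by exact: vbm_sanchor.
have [|||B BE] := @descend2 _ _ _ A0 e0 lift (fun a b => spairing (be a) b).
- by move=> a f c c'; rewrite spairingDr spairingZr.
- move=> a b; apply/eqP; rewrite -addr_eq0; apply/eqP.
  have z : spairing (be a) (be b) = 0.
    by apply: cinf_eq => p; apply: (ker_isotropic e0); exact: be0.
  have := vbm_spairing iso a b; rewrite !beE spairingDl !(spairingDr _ b (be b)) z addr0.
  rewrite -[X in _ = X]addr0 -addrA => /addrI; rewrite addrC => <-.
  by rewrite (spairingC a); ring.
- by move=> a c p c0'; apply: (ker_isotropic e0); [exact: be0|exact: c0'].
have beB x y : spairing (be x) y = ev2 B (sanchor x) (sanchor y) by rewrite BE.
exists (- B); rewrite curved_derivN; apply: form3_eq => X Y Z.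
have [a <-] := lift X; have [b <-] := lift Y; have [c <-] := lift Z.
have e3 (w w' : dform M 3) X' Y' Z' : ev3 (w - w') X' Y' Z' = ev3 w X' Y' Z' - ev3 w' X' Y' Z'.
  by apply: cinf_eq => p; rewrite cinfB !ev3E formDE formNE.
have e3N (w : dform M 3) X' Y' Z' : ev3 (- w) X' Y' Z' = - ev3 w X' Y' Z'.
  by apply: cinf_eq => p; rewrite cinfN !ev3E formNE.
rewrite e3 e3N curved_deriv2 -(bfield_expand m0 e0 c0 beB) -!beE.
have := congr1 (fun u => spairing u (vbm_app phi c)) (br a b).
rewrite twist_bracketE (vbm_spairing iso) twist_bracketE !an => E.
by rewrite (canRL (addrK _) E); ring.
Qed.
End Morphisms.

(** The inverse picks representatives by choice. *)
Lemma quotient_bijection (X Y : Type) (r : X -> X -> Prop) (s : Y -> Y -> Prop) (F : X -> Y) :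
  (forall x x', r x x' -> r x' x) -> (forall x x' x'', r x x' -> r x' x'' -> r x x'') ->
  (forall y, s y y) -> (forall y y', s y y' -> s y' y) ->
  (forall y y' y'', s y y' -> s y' y'' -> s y y'') ->
  (forall x x', r x x' <-> s (F x) (F x')) -> (forall y, exists x, s (F x) y) ->
  exists f : quotient r -> quotient s, bijective f.
Proof.
move=> rs rt s1 ss st rF sF.
have rE x x' : r x x' -> r x = r x'.
  move=> xx'; apply/funext => y; apply/propext; split=> [xy|x'y]; last exact: rt xx' x'y.
  exact: rt (rs _ _ xx') xy.
have sE y y' : s y y' -> s y = s y'.
  move=> yy'; apply/funext => z; apply/propext; split=> [yz|y'z]; last exact: st yy' y'z.
  exact: st (ss _ _ yy') yz.
pose rep (C : quotient r) : X := sval (cid (svalP C)).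
have repE C : sval C = r (rep C) := svalP (cid (svalP C)).
pose cls y : quotient s := exist _ (s y) (ex_intro _ y erefl).
have eqQ (Z : Type) (t : Z -> Z -> Prop) (C D : quotient t) : sval C = sval D -> C = D.
  by case: C D => [C hC] [D hD] /= CD; subst D; congr exist; exact: Prop_irrelevance.
have rr x : r x x by apply/rF; exact: s1.
pose clr x : quotient r := exist _ (r x) (ex_intro _ x erefl).
have /choice [g gE] : forall D : quotient s, exists x, sval D = s (F x).
  by move=> [D [y Dy]]; have [x /sE Fx] := sF y; exists x; rewrite /= Dy Fx.
exists (fun C => cls (F (rep C))); exists (fun D => clr (g D)) => [C|D].
  apply: eqQ; rewrite /= repE; apply: rE; apply/rF.
  have := gE (cls (F (rep C))); rewrite /= => <-; exact: s1.
apply: eqQ; rewrite /= [RHS]gE; apply: sE; apply/rF.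
have := repE (clr (g D)); rewrite /= => E.
have : r (rep (clr (g D))) (rep (clr (g D))) by exact: rr.
by rewrite -{1}E => /rs.
Qed.

Theorem theorem3p8 (R : realType) (n : nat) (M : manifold R n) (T : tform2 M) :
  exists f : quotient (cohomologous T) -> quotient (@isomorphic R n M T),
    bijective f.
Proof.
apply: (quotient_bijection (F := @std_ecca R n M T)).
- exact: cohomologous_sym.
- exact: cohomologous_trans.
- exact: isomorphic_refl.
- exact: isomorphic_sym.
- exact: isomorphic_trans.
- by move=> H H'; split; [exact: cohomologous_isomorphic|exact: isomorphic_cohomologous].
- exact: std_ecca_surjective.
Qed.
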